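(* Let $\Psi:[0,\infty)\to\mathbb{R}$ be a real measurable function, let $V:\mathbb{R}^d\to\mathbb{R}$, and consider $H=H_0+V$ on $L^2(\mathbb{R}^d)$ with $H_0=\Psi(p^2/2)$, $p=-i\nabla$. Suppose that: (H.1) $\Psi\in C^1(0,\infty)$, $\Psi\ge 0$, $\Psi'\ge 0$, and $\Psi(+0)=\Psi(0)=0$; (H.3) there exist constants $c_2,d_2\ge 0$ such that $u\Psi'(u)\le c_2\Psi(u)+d_2$ for all $u\ge 0$; (H.4) there exists a constant $\mu>0$ such that $2u\Psi'(u)\ge\mu\Psi(u)$ for all $u\ge 0$; (H.6) $V\in C^1(\mathbb{R}^d)$ and there are constants $c,\gamma>0$ such that $|V(x)|\le c\langle x\rangle^{-\gamma}$ and $|\nabla V(x)|\le c\langle x\rangle^{-1-\gamma}$ for all $x\in\mathbb{R}^d$. Then $\mathrm{Spec}_{\rm p}(H)\setminus\{0\}$ is discrete and the multiplicity of its elements is at most finite. The only possible accumulation point of $\mathrm{Spec}_{\rm p}(H)$ is zero.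
   Context: $\langle x\rangle=\sqrt{1+|x|^2}$. $H_0=\Psi(p^2/2)$ is the Fourier multiplier with symbol $\Psi(|\xi|^2/2)$; since $V$ is bounded by (H.6), $H$ is self-adjoint on $\mathrm{Dom}(H)=\mathrm{Dom}(H_0)$. $\mathrm{Spec}_{\rm p}(H)$ denotes the pure point spectrum, i.e. the set of eigenvalues of $H$. At $u=0$, where $\Psi'$ need not be defined, $u\Psi'(u)$ is read as $0$.
   Formalization: The formal theorem adds that Ψ is not identically zero on [0,∞): for Ψ=0, H is multiplication by V, and a C¹ compactly supported V equal to 1 on the unit ball makes 1 an eigenvalue of infinite multiplicity, so the claim fails. *)

(* Defs.v *)
From HB Require Import structures.
From mathcomp Require Import all_boot all_order all_algebra.
From mathcomp Require Import all_classical all_reals all_analysis.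
From mathcomp Require Import complex.
Set Implicit Arguments.
Unset Strict Implicit.
Unset Printing Implicit Defensive.
Import Order.TTheory GRing.Theory Num.Theory numFieldNormedType.Exports.
Local Open Scope classical_set_scope.
Local Open Scope ring_scope.
Local Open Scope complex_scope.

Definition rV_display : measure_display. Proof. exact. Qed.

Section measurable_rV.
Context {R : realType} {n : nat}.

Definition rV_coord (i : 'I_n) (x : 'rV[R]_n) : R := x ord0 i.

Let rV_set0 : g_sigma_preimage rV_coord set0.
Proof. exact: sigma_algebra0. Qed.

Let rV_setC A : g_sigma_preimage rV_coord A -> g_sigma_preimage rV_coord (~` A).
Proof. exact: sigma_algebraC. Qed.

Let rV_bigcup (F : (set 'rV[R]_n)^nat) :
  (forall i, g_sigma_preimage rV_coord (F i)) ->
  g_sigma_preimage rV_coord (\bigcup_i (F i)).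
Proof. exact: sigma_algebra_bigcup. Qed.

(* The sigma-algebra generated by the coordinates, i.e. the Borel one. *)
HB.instance Definition _ := @isMeasurable.Build rV_display 'rV[R]_n
  (g_sigma_preimage rV_coord) rV_set0 rV_setC rV_bigcup.

Lemma measurable_rV_coord (i : 'I_n) :
  measurable_fun [set: 'rV[R]_n] (rV_coord i).
Proof.
move=> _ Y mY; rewrite setTI; apply: sub_sigma_algebra => /=.
rewrite -bigcup_seq/=; exists i => /=; first by rewrite mem_index_enum.
by exists Y => //; rewrite setTI.
Qed.

Lemma measurable_fun_rV d (T : measurableType d) (f : T -> 'rV[R]_n) :
  (forall i, measurable_fun [set: T] (fun t => f t ord0 i)) ->
  measurable_fun [set: T] f.
Proof.
move=> mf; apply: (measurability
  (\big[setU/set0]_(i < n) preimage_set_system setT (rV_coord i) measurable)).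
  by [].
move=> _ [B + <-]; rewrite -bigcup_seq => -[i _ [A mA <-]].
by rewrite !setTI -comp_preimage -[X in measurable X]setTI; exact: (mf i).
Qed.

End measurable_rV.

Section lebesgue_rV.
Context {R : realType}.

Definition rV_cons n (p : measurableTypeR R * 'rV[R]_n) : 'rV[R]_n.+1 :=
  \row_i oapp (p.2 ord0) p.1 (unlift ord0 i).

Definition rV_uncons n (x : 'rV[R]_n.+1) : measurableTypeR R * 'rV[R]_n :=
  (x ord0 ord0, \row_i x ord0 (lift ord0 i)).

Lemma rV_cons0 n (p : measurableTypeR R * 'rV[R]_n) : rV_cons p ord0 ord0 = p.1.
Proof. by rewrite mxE unlift_none. Qed.

Lemma rV_consS n (p : measurableTypeR R * 'rV[R]_n) i :
  rV_cons p ord0 (lift ord0 i) = p.2 ord0 i.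
Proof. by rewrite mxE liftK. Qed.

Lemma rV_consK n : cancel (@rV_cons n) (@rV_uncons n).
Proof.
move=> [a x]; rewrite /rV_uncons rV_cons0; congr pair.
by apply/rowP => i; rewrite mxE rV_consS.
Qed.

Lemma measurable_rV_cons n : measurable_fun setT (@rV_cons n).
Proof.
apply: measurable_fun_rV => i; case: (unliftP ord0 i) => [j|] ->.
  under eq_fun do rewrite rV_consS.
  apply: (measurableT_comp (@measurable_rV_coord R n j)).
  exact: measurable_snd.
by under eq_fun do rewrite rV_cons0; exact: measurable_fst.
Qed.

Lemma measurable_rV_uncons n : measurable_fun setT (@rV_uncons n).
Proof.
apply/measurable_fun_pairP; split; first exact: measurable_rV_coord.
apply: measurable_fun_rV => i; rewrite /rV_uncons /=.
by under eq_fun do rewrite mxE; exact: measurable_rV_coord.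
Qed.

Section step.
Context n (mu : {sigma_finite_measure set 'rV[R]_n -> \bar R}).
Local Open Scope ereal_scope.

Definition lebesgue_rV_step (A : set 'rV[R]_n.+1) : \bar R :=
  (@lebesgue_measure R \x mu) (@rV_cons n @^-1` A).

Let step0 : lebesgue_rV_step set0 = 0.
Proof. by rewrite /lebesgue_rV_step preimage_set0 measure0. Qed.

Let step_ge0 A : 0 <= lebesgue_rV_step A.
Proof. exact: measure_ge0. Qed.

Let mpre A : measurable A -> measurable (@rV_cons n @^-1` A).
Proof.
by move=> mA; rewrite -[X in measurable X]setTI; exact: measurable_rV_cons.
Qed.

Let step_sigma_additive : semi_sigma_additive lebesgue_rV_step.
Proof.
move=> F mF tF mUF; rewrite /lebesgue_rV_step preimage_bigcup.
apply: measure_semi_sigma_additive.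
- by move=> k; exact: mpre.
- apply/trivIsetP => /= i j _ _ ij; rewrite -preimage_setI.
  by move/trivIsetP : tF => /(_ _ _ _ _ ij) ->//; rewrite preimage_set0.
- by rewrite -preimage_bigcup; exact: mpre.
Qed.

HB.instance Definition _ := isMeasure.Build _ _ _ lebesgue_rV_step
  step0 step_ge0 step_sigma_additive.

Let step_sigma_finite : sigma_finite setT lebesgue_rV_step.
Proof.
have /sigma_finiteP[F [TF ndF Foo]] := sigma_finiteT (@lebesgue_measure R).
have /sigma_finiteP[G [TG ndG Goo]] := sigma_finiteT mu.
exists (fun k => @rV_uncons n @^-1` (F k `*` G k)).
  apply/esym; rewrite -subTset => x _.
  have [i _ Fi] : (\bigcup_i F i) (rV_uncons x).1 by rewrite -TF.
  have [j _ Gj] : (\bigcup_i G i) (rV_uncons x).2 by rewrite -TG.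
  exists (maxn i j) => //; split.
    by move: Fi; exact/subsetPset/ndF/leq_maxl.
  by move: Gj; exact/subsetPset/ndG/leq_maxr.
move=> k; have [mF Fy] := Foo k; have [mG Gy] := Goo k; split.
  rewrite -[X in measurable X]setTI; apply: measurable_rV_uncons => //.
  exact: measurableX.
rewrite /lebesgue_rV_step -comp_preimage.
have -> : @rV_uncons n \o @rV_cons n = id.
  by apply/funext => p; exact: rV_consK.
by rewrite preimage_id product_measure1E// lte_mul_pinfty// ge0_fin_numE.
Qed.

HB.instance Definition _ := Measure_isSigmaFinite.Build _ _ _ lebesgue_rV_step
  step_sigma_finite.

End step.

Fixpoint lebesgue_rV n : {sigma_finite_measure set 'rV[R]_n -> \bar R} :=
  match n with
  | 0 => [the {sigma_finite_measure set 'rV[R]_0 -> \bar R} of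
           dirac (0 : 'rV[R]_0)]
  | n.+1 => [the {sigma_finite_measure set 'rV[R]_n.+1 -> \bar R} of
              lebesgue_rV_step (lebesgue_rV n)]
  end.

Lemma lebesgue_rV_box n (A : 'I_n -> set R) : (forall i, measurable (A i)) ->
  lebesgue_rV n [set x : 'rV[R]_n | forall i, A i (x ord0 i)] =
  (\prod_(i < n) lebesgue_measure (A i))%E.
Proof.
elim: n A => [|n IHn] A mA /=.
  by rewrite big_ord0 diracE mem_set// => -[].
rewrite /lebesgue_rV_step big_ord_recl.
set B := [set x : 'rV[R]_n | forall i, A (lift ord0 i) (x ord0 i)].
have -> : @rV_cons n @^-1` [set x : 'rV[R]_n.+1 | forall i, A i (x ord0 i)] =
    A ord0 `*` B.
  apply/seteqP; split => [p /= Ap|p /= [A0 AS] i].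
    split; first by have := Ap ord0; rewrite rV_cons0.
    by move=> i; have := Ap (lift ord0 i); rewrite rV_consS.
  case: (unliftP ord0 i) => [j|] ->; first by rewrite rV_consS; exact: AS.
  by rewrite rV_cons0.
have mB : measurable B.
  have -> : B = \bigcap_(i in [set: 'I_n]) (rV_coord i @^-1` A (lift ord0 i)).
    by apply/seteqP; split => [x Bx i _|x Bx i]; exact: Bx.
  apply: fin_bigcap_measurable => // i _.
  by rewrite -[X in measurable X]setTI; exact: measurable_rV_coord.
rewrite product_measure1E; [|exact: mA|exact: mB].
by congr (_ * _)%E; apply: (IHn (fun i => A (lift ord0 i))) => i; exact: mA.
Qed.

End lebesgue_rV.

Section euclidean.
Context {R : realType} {d : nat}.
Implicit Types x y : 'rV[R]_d.

Definition dotv x y : R := \sum_(i < d) x ord0 i * y ord0 i.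

(* The library norm `|x| on 'rV[R]_d is the sup norm; this is the Euclidean one. *)
Definition enorm x : R := Num.sqrt (dotv x x).

Definition japanese x : R := Num.sqrt (1 + enorm x ^+ 2).

Definition grad (V : 'rV[R]_d -> R) x : 'rV[R]_d :=
  \row_i 'D_(delta_mx ord0 i) V x.

Definition C1 (V : 'rV[R]_d -> R) :=
  (forall x, differentiable V x) /\ continuous (grad V).

End euclidean.

Section L2.
Context {R : realType} {d : nat}.
Local Notation leb := (@lebesgue_rV R d).
Implicit Types f g : 'rV[R]_d -> R[i].

Definition cmeasurable f :=
  measurable_fun [set: 'rV[R]_d] (fun x => complex.Re (f x)) /\
  measurable_fun [set: 'rV[R]_d] (fun x => complex.Im (f x)).

Definition cLnorm (p : \bar R) f : \bar R :=
  Lnorm leb p (fun x => (Normc.normc (f x))%:E).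

Definition Lp (p : \bar R) f := cmeasurable f /\ (cLnorm p f < +oo)%E.

Definition cintegral f : R[i] :=
  (\int[leb]_x complex.Re (f x)) +i* (\int[leb]_x complex.Im (f x)).

Definition expi (t : R) : R[i] := cos t +i* sin t.

Definition fourier1 f (xi : 'rV[R]_d) : R[i] :=
  ((2 * pi) `^ (- (d%:R / 2)))%:C *
  cintegral (fun x => expi (- dotv x xi) * f x).

(* [is_fourier f g]: g is (a representative of) the Fourier-Plancherel transform
   of f, the extension of fourier1 by L^2-continuity from L^1 /\ L^2 to L^2. *)
Definition is_fourier f g :=
  [/\ Lp 2%:E f, Lp 2%:E g &
    exists u : nat -> 'rV[R]_d -> R[i],
      [/\ forall n, Lp 1 (u n) /\ Lp 2%:E (u n),
        cLnorm 2%:E (fun x => u n x - f x) @[n --> \oo] --> 0%E &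
        cLnorm 2%:E (fun xi => fourier1 (u n) xi - g xi) @[n --> \oo] --> 0%E]].

End L2.

(* Unbounded operators on L^2 are given by their graphs, on representatives:
   [T f g] means that f is in the domain of T and T f = g almost everywhere. *)
Section schrodinger.
Context {R : realType} {d : nat}.
Variables (Psi : R -> R) (V : 'rV[R]_d -> R).
Implicit Types f g h : 'rV[R]_d -> R[i].

(* is_fourier includes the requirement that the symbol times the transform
   of f be square integrable, i.e. that f be in the domain. *)
Definition kinetic f g :=
  exists2 fhat, is_fourier f fhat &
    is_fourier g (fun xi => (Psi (enorm xi ^+ 2 / 2))%:C * fhat xi).

(* V is bounded, so that the domain is that of the kinetic term. *)
Definition hamiltonian f g :=
  exists2 h, kinetic f h &
    Lp 2%:E g /\ g = (fun x => h x + (V x)%:C * f x) %[ae lebesgue_rV d].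

Definition eigenfunctions (lambda : R[i]) : set ('rV[R]_d -> R[i]) :=
  [set f | hamiltonian f (fun x => lambda * f x)].

(* Eigenvalues are not assumed to be real. R[i]^o is R[i] with the topology of
   its modulus. *)
Definition spec_p : set R[i]^o :=
  [set lambda | exists2 f, eigenfunctions lambda f & ~ f = cst 0 %[ae lebesgue_rV d]].

(* Finite dimension modulo almost everywhere equality. *)
Definition finite_multiplicity (lambda : R[i]) :=
  exists (n : nat) (e : 'I_n -> 'rV[R]_d -> R[i]),
    (forall i, eigenfunctions lambda (e i)) /\
    forall f, eigenfunctions lambda f ->
      exists c : 'I_n -> R[i],
        f = (fun x => \sum_(i < n) c i * e i x) %[ae lebesgue_rV d].

End schrodinger.

(* Main.v *)
Require Import Defs.
From HB Require Import structures.
From mathcomp Require Import all_boot all_order all_algebra.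
From mathcomp Require Import all_classical all_reals all_analysis.
From mathcomp Require Import measurable_realfun.
From mathcomp Require Import complex ring lra.
Set Implicit Arguments.
Unset Strict Implicit.
Unset Printing Implicit Defensive.
Import Order.TTheory GRing.Theory Num.Theory numFieldNormedType.Exports.
Local Open Scope classical_set_scope.
Local Open Scope ring_scope.

(* Let f be an eigenfunction for lambda. Comparing f with its dilates f(t x) and letting t
   tend to 1 gives the virial inequality mu <f, H_0 f> <= <f, W f> with
   W = c <x>^(-gamma): in Fourier space the difference quotients of Psi are dominated by H.3,
   and H.4 bounds their limit from below. Hence
   |lambda| ||f||^2 <= (1/mu + 1) <f, W f>, and <f, H_0 f> is bounded for normalized f. As Psi
   tends to infinity, this bound makes the normalized eigenfunctions equicontinuous in L^2
   under translations, so they are close to their averages over small balls; by Bessel's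
   inequality the averages of an orthonormal family have bounded total mass in every ball.
   If |lambda| >= eta, the decay of W forces f to have a fixed amount of mass in a fixed ball.
   So an orthonormal family of eigenfunctions with |lambda| >= eta has boundedly many
   members, which gives all three claims, eigenvalues being real and eigenfunctions for
   distinct eigenvalues orthogonal.

   Plancherel's theorem is proved with the weights exp(-e |xi_j|), whose Fourier transforms
   are Poisson kernels, and the continuity of translations in L^2. *)

(** * Lebesgue measure on row vectors *)

(** The formal virial identity is a commutator with the generator of dilations, and an arbitrary
    eigenfunction need not lie in the domain of that generator. Finite dilations D avoid the
    difficulty: <D f, H_0 f> - <D (H_0 f), f> involves square integrable functions only, and once
    H_0 f = lambda f - V f is inserted the eigenvalue cancels.

    The count of eigenfunctions takes the place of a compactness argument. If each of N orthonormal
    functions has mass at least beta in a ball, summing the local masses gives N beta <= N beta / 2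
    + C. The first term on the right is the error made by averaging, which grows with N but carries
    a factor that the choice of the averaging radius makes small; the second comes from Bessel's
    inequality and does not depend on N.

    Orthonormality is meant for the real part of the inner product. This loses nothing: a complex
    space of dimension k has real dimension 2k, so a bound over the reals bounds the complex
    dimension as well. *)

Section measurable_rV_ops.
Context {R : realType} {n : nat} d (T : measurableType d).
Implicit Types f g : T -> 'rV[R]_n.

Lemma measurable_rV_entry f i : measurable_fun setT f ->
  measurable_fun setT (fun t => f t ord0 i).
Proof. by move=> mf; exact: (measurableT_comp (@measurable_rV_coord R n i)). Qed.

Lemma measurable_rVD f g : measurable_fun setT f -> measurable_fun setT g ->
  measurable_fun setT (fun t => f t + g t).
Proof.
move=> mf mg; apply: measurable_fun_rV => i.
under eq_fun do rewrite mxE.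
by apply: measurable_funD; exact: measurable_rV_entry.
Qed.

Lemma measurable_rVZ (k : T -> R) f : measurable_fun setT k ->
  measurable_fun setT f -> measurable_fun setT (fun t => k t *: f t).
Proof.
move=> mk mf; apply: measurable_fun_rV => i.
under eq_fun do rewrite mxE.
by apply: measurable_funM => //; exact: measurable_rV_entry.
Qed.

Lemma measurable_rVN f : measurable_fun setT f ->
  measurable_fun setT (fun t => - f t).
Proof.
move=> mf; under eq_fun do rewrite -scaleN1r.
by apply: measurable_rVZ => //; exact: measurable_cst.
Qed.

Lemma measurable_dotv f g : measurable_fun setT f -> measurable_fun setT g ->
  measurable_fun setT (fun t => dotv (f t) (g t)).
Proof.
move=> mf mg; apply: measurable_sum => i.
by apply: measurable_funM; exact: measurable_rV_entry.
Qed.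

End measurable_rV_ops.

Section affine_change_of_variables.
Context {R : realType}.
Local Open Scope ereal_scope.

Lemma measurable_affineR (a b : R) :
  measurable_fun setT (fun t : measurableTypeR R => a * t + b : measurableTypeR R)%R.
Proof. by apply: measurable_funD => //; exact: measurable_funM. Qed.

(** Uniqueness of Lebesgue measure: |a| times its push-forward under the affine map has the right
    value on half-open intervals. For a < 0 the preimage of such an interval is closed at the other
    end, which does not change its length. *)
Lemma ge0_integral_affineR (a b : R) (f : R -> \bar R) : a != 0%R ->
  measurable_fun setT f -> (forall t, 0 <= f t) ->
  \int[lebesgue_measure]_t f (a * t + b)%R =
  (`|a|^-1)%:E * \int[lebesgue_measure]_t f t.
Proof.
move=> a0 mf f0.
have mphi := measurable_affineR a b.
have na0 : (0 < `|a|)%R by rewrite normr_gt0.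
pose c : {nonneg R} := NngNum (normr_ge0 a).
pose phi (t : measurableTypeR R) : measurableTypeR R := (a * t + b)%R.
pose pm : {measure set (measurableTypeR R) -> \bar R} :=
  measure_function_pushforward__canonical__measure_function_Measure
    lebesgue_measure (mphi : measurable_fun setT phi).
pose nu := mscale c pm.
have nuE A : measurable A -> lebesgue_measure A = nu A.
  apply: lebesgue_measure_unique => X [[x y] _ <-]/=.
  rewrite /nu /mscale /= /pushforward.
  have [xy|yx] := ltP x y; last first.
    rewrite set_itv_ge ?preimage_set0 ?measure0 ?mule0//.
    by rewrite bnd_simp -leNgt.
  rewrite lebesgue_measure_itv/= lte_fin xy.
  have [ap|an] := ltP 0%R a.
    have -> : phi @^-1` `]x, y] = `]((x - b) / a)%R, ((y - b) / a)%R]%classic.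
      apply/seteqP; split => t /=; rewrite /phi !in_itv/= => /andP[];
      rewrite ?ltr_pdivrMr ?ler_pdivlMr// ?[(t * a)%R]mulrC => h1 h2; apply/andP; split; lra.
    rewrite lebesgue_measure_itv/= lte_fin ltr_pM2r ?invr_gt0// ltrD2r xy.
    by rewrite -!EFinD -EFinM; congr EFin; rewrite gtr0_norm//; field.
  have ap : (a < 0)%R by rewrite lt_neqAle a0.
  have -> : phi @^-1` `]x, y] = `[((y - b) / a)%R, ((x - b) / a)%R[%classic.
    apply/seteqP; split => t /=; rewrite /phi !in_itv/= => /andP[];
    rewrite ?ltr_ndivlMr ?ler_ndivrMr// ?[(t * a)%R]mulrC => h1 h2; apply/andP; split; lra.
  rewrite lebesgue_measure_itv/= lte_fin ltr_nM2r ?invr_lt0// ltrD2r xy.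
  by rewrite -!EFinD -EFinM; congr EFin; rewrite ltr0_norm//; field.
rewrite (@eq_measure_integral _ _ _ _ nu lebesgue_measure f); last first.
  by move=> A mA _; exact: nuE.
rewrite ge0_integral_mscale//= (ge0_integral_pushforward mphi)//=.
by rewrite preimage_setT muleA -EFinM mulVf ?gt_eqF// mul1e.
Qed.

(** By construction [lebesgue_rV n.+1] is the push-forward of a product measure under [rV_cons], so
    this is Tonelli's theorem. *)
Lemma ge0_integral_rVS n (f : 'rV[R]_n.+1 -> \bar R) :
  measurable_fun setT f -> (forall x, 0 <= f x) ->
  \int[lebesgue_rV n.+1]_x f x =
  \int[lebesgue_measure]_t \int[lebesgue_rV n]_x f (rV_cons (t, x)).
Proof.
move=> mf f0.
pose pm : {measure set 'rV[R]_n.+1 -> \bar R} :=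
  measure_function_pushforward__canonical__measure_function_Measure
    (lebesgue_measure \x lebesgue_rV n) (@measurable_rV_cons R n).
rewrite (@eq_measure_integral _ _ _ _ pm)// /pm.
rewrite (ge0_integral_pushforward (@measurable_rV_cons R n))//=.
rewrite preimage_setT fubini_tonelli1//=.
by apply: measurableT_comp => //; exact: measurable_rV_cons.
Qed.

(** A scalar dilation followed by a translation acts on each coordinate separately, so induction on
    the dimension reduces the formula to the line. *)
Lemma ge0_integral_affine n (a : R) (b : 'rV[R]_n) (f : 'rV[R]_n -> \bar R) :
  a != 0%R -> measurable_fun setT f -> (forall x, 0 <= f x) ->
  \int[lebesgue_rV n]_x f (a *: x + b)%R =
  (`|a| ^- n)%:E * \int[lebesgue_rV n]_x f x.
Proof.
move=> a0; elim: n b f => [|n IH] b f mf f0.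
  rewrite expr0 invr1 mul1e; apply: eq_integral => x _.
  by congr f; apply/rowP => -[].
have mfc : measurable_fun setT (f \o @rV_cons R n).
  by apply: measurableT_comp => //; exact: measurable_rV_cons.
rewrite !ge0_integral_rVS//; last first.
  apply: measurableT_comp => //; apply: measurable_rVD => //.
  by apply: measurable_rVZ => //.
pose b' : 'rV[R]_n := (\row_i b ord0 (lift ord0 i))%R.
pose g t := \int[lebesgue_rV n]_x f (rV_cons (t, x)).
transitivity (\int[lebesgue_measure]_t ((`|a| ^- n)%:E * g (a * t + b ord0 ord0)%R)).
  apply: eq_integral => t _.
  rewrite -(IH b')//; last first.
    exact: (measurableT_comp mfc (@measurable_pair1 _ _ _ _ _)).
  apply: eq_integral => x _; congr f.
  apply/rowP => i; rewrite !mxE; by case: unliftP => [j ->|->]/=; rewrite ?mxE.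
have mg : measurable_fun setT g.
  apply: (measurable_fun_fubini_tonelli_F (f \o @rV_cons R n)) => //=.
have g0 t : 0 <= g t by exact: integral_ge0.
rewrite ge0_integralZl//=; last first.
  by apply: (measurableT_comp mg); exact: measurable_affineR.
rewrite ge0_integral_affineR// muleA -EFinM; congr (_ * _).
by rewrite -invfM -exprSr.
Qed.

End affine_change_of_variables.

(** * Real square integrable functions *)

(** The choice s = C, t = B gives C (A C - B^2) >= 0. If C = 0, the form with s = 1 is affine in t
    and can stay nonnegative only if B = 0. Both the L^2 and the Euclidean Cauchy-Schwarz
    inequalities come from here. *)
Lemma quadratic_CS (R : realFieldType) (A B C : R) :
  (forall s t, 0 <= s ^+ 2 * A - 2 * s * t * B + t ^+ 2 * C) -> B ^+ 2 <= A * C.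
Proof.
move=> H.
have A0 : 0 <= A by have := H 1 0; lra.
have C0 : 0 <= C by have := H 0 1; lra.
have [Cz|Cn] := eqVneq C 0.
  rewrite Cz mulr0; have [->|Bn] := eqVneq B 0; first by rewrite expr0n.
  have := H 1 ((A + 1) / B); rewrite Cz.
  have -> : 2 * 1 * ((A + 1) / B) * B = 2 * (A + 1) by field.
  lra.
have Cp : 0 < C by rewrite lt_neqAle eq_sym Cn.
have := H C B => h.
have : 0 <= C * (A * C - B ^+ 2) by nra.
by rewrite pmulr_rge0// subr_ge0.
Qed.

Section integrable_real.
Context d (T : measurableType d) (R : realType) (mu : {measure set T -> \bar R}).
Implicit Types f g : T -> R.
Local Notation integrableR f := (mu.-integrable [set: T] (EFin \o f)).

Lemma integrableR_measurable f : integrableR f -> measurable_fun setT f.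
Proof. by move=> /integrableP[/measurable_EFinP]. Qed.

Lemma integrableRD f g : integrableR f -> integrableR g ->
  integrableR (fun x => f x + g x).
Proof. by move=> f1 g1; exact: (integrableD measurableT f1 g1). Qed.

Lemma integrableRB f g : integrableR f -> integrableR g ->
  integrableR (fun x => f x - g x).
Proof. by move=> f1 g1; exact: (integrableB measurableT f1 g1). Qed.

Lemma integrableRZ k f : integrableR f -> integrableR (fun x => k * f x).
Proof. by move=> f1; exact: (integrableZl measurableT k f1). Qed.

Lemma le_integrableR f g : measurable_fun setT f -> (forall x, `|f x| <= `|g x|) ->
  integrableR g -> integrableR f.
Proof.
move=> mf fg; apply: le_integrable => //; first exact/measurable_EFinP.
by move=> x _; rewrite lee_fin.
Qed.

Lemma integral_EFin_Rintegral f : integrableR f ->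
  (\int[mu]_x (f x)%:E)%E = (\int[mu]_x f x)%:E.
Proof. by move=> f1; rewrite /Rintegral fineK//; exact: integrable_fin_num. Qed.

Lemma ge0_integrableR f : measurable_fun setT f -> (forall x, 0 <= f x) ->
  (\int[mu]_x (f x)%:E < +oo)%E -> integrableR f.
Proof.
move=> mf f0 foo; apply/integrableP; split; first exact/measurable_EFinP.
by under eq_integral do rewrite /= ger0_norm//.
Qed.

Lemma integrableR_indic (A : set T) : measurable A -> (mu A < +oo)%E ->
  integrableR (\1_A : T -> R).
Proof.
move=> mA Aoo; apply: ge0_integrableR => //.
by rewrite integral_indic// setIT.
Qed.

Lemma cvg_Rintegral_dominated (u : nat -> T -> R) f g :
  (forall n, measurable_fun setT (u n)) ->
  (forall x, u n x @[n --> \oo] --> f x) -> integrableR g ->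
  (forall n x, `|u n x| <= g x) ->
  [/\ measurable_fun setT f, integrableR f &
      \int[mu]_x u n x @[n --> \oo] --> \int[mu]_x f x].
Proof.
move=> mu_ uf ig ug.
have mf : measurable_fun setT f by exact: (measurable_fun_cvg (h := u)).
have [i1 _ i2] : [/\ integrableR f,
    (\int[mu]_x `|(u n x)%:E - (f x)%:E| @[n --> \oo] --> 0)%E &
    (\int[mu]_x (u n x)%:E @[n --> \oo] --> \int[mu]_x (f x)%:E)%E].
  apply: (dominated_convergence measurableT (g := EFin \o g)) => //.
  - by move=> n; exact/measurable_EFinP.
  - exact/measurable_EFinP.
  - by apply: aeW => x _; apply: cvg_EFin; [exact: nearW|exact: uf].
  - by apply: aeW => x n _; rewrite lee_fin.
split => //.
have iu n : integrableR (u n).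
  by apply: le_integrableR ig => // x; rewrite (le_trans (ug n x))// ler_norm.
by apply: fine_cvg; rewrite -integral_EFin_Rintegral.
Qed.

End integrable_real.

Section L2_real.
Context d (T : measurableType d) (R : realType) (mu : {measure set T -> \bar R}).
Implicit Types u v w : T -> R.
Local Notation integrableR f := (mu.-integrable [set: T] (EFin \o f)).

Definition L2r u := measurable_fun setT u /\ integrableR (fun x => u x ^+ 2).

(** [Rintegral] turns an infinite integral into 0; hence the side conditions [L2r] in the algebraic
    rules, while positivity holds without them. *)
Definition rip u v : R := \int[mu]_x (u x * v x).

Lemma L2r_mul u v : L2r u -> L2r v -> integrableR (fun x => u x * v x).
Proof.
move=> [mu_ u2] [mv v2]; apply: le_integrableR (integrableRD u2 v2).
  exact: measurable_funM.
move=> x; rewrite [leRHS]ger0_norm; last by rewrite addr_ge0// sqr_ge0.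
by rewrite ler_norml; apply/andP; split; nra.
Qed.

Lemma L2rZ k u : L2r u -> L2r (fun x => k * u x).
Proof.
move=> [mu_ u2]; split; first exact: measurable_funM.
under [X in EFin \o X]eq_fun do rewrite exprMn.
exact: integrableRZ.
Qed.

Lemma L2r_le u v : measurable_fun setT v -> (forall x, `|v x| <= `|u x|) ->
  L2r u -> L2r v.
Proof.
move=> mv vu [_ u2]; split => //; apply: le_integrableR u2.
  exact: measurable_funX.
by move=> x; rewrite !normrX lerXn2r// nnegrE.
Qed.

Lemma L2rD u v : L2r u -> L2r v -> L2r (fun x => u x + v x).
Proof.
move=> Lu Lv; have Luv := L2r_mul Lu Lv.
case: Lu Lv => [mu_ u2] [mv v2]; split; first exact: measurable_funD.
under [X in EFin \o X]eq_fun do rewrite sqrrD -mulr_natl.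
by apply: integrableRD => //; apply: integrableRD => //; exact: integrableRZ.
Qed.

Lemma L2rB u v : L2r u -> L2r v -> L2r (fun x => u x - v x).
Proof.
move=> Lu /(L2rZ (-1)) Lv; have := L2rD Lu Lv.
by under [X in L2r X]eq_fun do rewrite mulN1r.
Qed.

Lemma L2r0 : L2r (fun=> 0).
Proof.
split; first exact: measurable_cst.
by under [X in EFin \o X]eq_fun do rewrite expr0n; exact: integrable0.
Qed.

Lemma L2r_bounded (k : T -> R) M u : measurable_fun setT k ->
  (forall x, `|k x| <= M) -> L2r u -> L2r (fun x => k x * u x).
Proof.
move=> mk kM Lu; apply: (L2r_le _ _ (L2rZ M Lu)).
  by apply: measurable_funM => //; exact: Lu.1.
by move=> x; rewrite !normrM ler_wpM2r// (le_trans (kM x))// ler_norm.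
Qed.

Lemma ripC u v : rip u v = rip v u.
Proof. by rewrite /rip; under eq_Rintegral do rewrite mulrC. Qed.

Lemma ripDl u v w : L2r u -> L2r v -> L2r w ->
  rip (fun x => u x + v x) w = rip u w + rip v w.
Proof.
move=> Lu Lv Lw; rewrite /rip.
under eq_Rintegral do rewrite mulrDl.
by rewrite RintegralD//; exact: L2r_mul.
Qed.

Lemma ripZl k u v : L2r u -> L2r v -> rip (fun x => k * u x) v = k * rip u v.
Proof.
move=> Lu Lv; rewrite /rip.
under eq_Rintegral do rewrite -mulrA.
by rewrite RintegralZl//; exact: L2r_mul.
Qed.

Lemma ripBl u v w : L2r u -> L2r v -> L2r w ->
  rip (fun x => u x - v x) w = rip u w - rip v w.
Proof.
move=> Lu Lv Lw; rewrite /rip.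
under eq_Rintegral do rewrite mulrBl.
by rewrite RintegralB//; exact: L2r_mul.
Qed.

Lemma ripDr u v w : L2r u -> L2r v -> L2r w ->
  rip w (fun x => u x + v x) = rip w u + rip w v.
Proof. by move=> *; rewrite ripC ripDl// !(ripC w). Qed.

Lemma ripZr k u v : L2r u -> L2r v -> rip v (fun x => k * u x) = k * rip v u.
Proof. by move=> *; rewrite ripC ripZl// (ripC v). Qed.

Lemma ripBr u v w : L2r u -> L2r v -> L2r w ->
  rip w (fun x => u x - v x) = rip w u - rip w v.
Proof. by move=> *; rewrite ripC ripBl// !(ripC w). Qed.

Lemma rip_ge0 u : 0 <= rip u u.
Proof. by apply: Rintegral_ge0 => x _; rewrite -expr2 sqr_ge0. Qed.

Lemma ripE u : L2r u -> (\int[mu]_x (u x ^+ 2)%:E)%E = (rip u u)%:E.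
Proof.
by move=> [mu_ u2]; rewrite integral_EFin_Rintegral.
Qed.

Lemma ripBB u v : L2r u -> L2r v ->
  rip (fun x => u x - v x) (fun x => u x - v x) =
  rip u u - 2 * rip u v + rip v v.
Proof.
move=> Lu Lv; rewrite ripBl ?ripBr//; last exact: L2rB.
by rewrite (ripC v u); ring.
Qed.

Lemma ripDD u v : L2r u -> L2r v ->
  rip (fun x => u x + v x) (fun x => u x + v x) =
  rip u u + 2 * rip u v + rip v v.
Proof.
move=> Lu Lv; rewrite ripDl ?ripDr//; last exact: L2rD.
by rewrite (ripC v u); ring.
Qed.

Lemma ripD_le u v : L2r u -> L2r v ->
  rip (fun x => u x + v x) (fun x => u x + v x) <= 2 * rip u u + 2 * rip v v.
Proof.
move=> Lu Lv; rewrite ripDD//.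
by have := rip_ge0 (fun x => u x - v x); rewrite ripBB//; lra.
Qed.

Lemma rip_CS u v : L2r u -> L2r v -> rip u v ^+ 2 <= rip u u * rip v v.
Proof.
move=> Lu Lv.
apply: quadratic_CS => s t.
have := rip_ge0 (fun x => s * u x - t * v x).
rewrite ripBB; [|exact: L2rZ|exact: L2rZ].
rewrite !ripZl ?ripZr//; try exact: L2rZ.
by congr (0 <= _); ring.
Qed.

Lemma cvg_rip (u v : nat -> T -> R) u0 v0 :
  (forall n, L2r (u n)) -> (forall n, L2r (v n)) -> L2r u0 -> L2r v0 ->
  rip (fun x => u n x - u0 x) (fun x => u n x - u0 x) @[n --> \oo] --> 0 ->
  rip (fun x => v n x - v0 x) (fun x => v n x - v0 x) @[n --> \oo] --> 0 ->
  rip (u n) (v n) @[n --> \oo] --> rip u0 v0.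
Proof.
move=> Lu Lv Lu0 Lv0 cu cv.
pose a n := rip (fun x => u n x - u0 x) (fun x => u n x - u0 x).
pose b n := rip (fun x => v n x - v0 x) (fun x => v n x - v0 x).
have sa : Num.sqrt (a n) @[n --> \oo] --> 0.
  by rewrite -[X in _ --> X]sqrtr0; exact: (continuous_cvg _ (@sqrt_continuous R 0)).
have sb : Num.sqrt (b n) @[n --> \oo] --> 0.
  by rewrite -[X in _ --> X]sqrtr0; exact: (continuous_cvg _ (@sqrt_continuous R 0)).
have CS f g : L2r f -> L2r g -> `|rip f g| <= Num.sqrt (rip f f) * Num.sqrt (rip g g).
  move=> Lf Lg; rewrite -sqrtrM ?rip_ge0// -sqrtr_sqr ler_sqrt ?mulr_ge0 ?rip_ge0//.
  exact: rip_CS.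
apply/subr_cvg0/norm_cvg0P.
apply: (@squeeze_cvgr _ _ _ _ (fun=> 0) (fun n => Num.sqrt (a n) * Num.sqrt (b n)
   + Num.sqrt (a n) * Num.sqrt (rip v0 v0) + Num.sqrt (rip u0 u0) * Num.sqrt (b n))).
- apply: nearW => n; rewrite normr_ge0/=.
  have L1 := L2rB (Lu n) Lu0; have L2 := L2rB (Lv n) Lv0.
  (* Each of the three terms contains a factor that tends to 0 in norm. *)
  have -> : rip (u n) (v n) - rip u0 v0 =
     rip (fun x => u n x - u0 x) (fun x => v n x - v0 x) +
     rip (fun x => u n x - u0 x) v0 + rip u0 (fun x => v n x - v0 x).
    by rewrite !ripBl ?ripBr//; ring.
  by rewrite (le_trans (ler_normD _ _))// lerD ?CS//
     (le_trans (ler_normD _ _))// lerD ?CS//.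
- exact: cvg_cst.
- have -> : (0 : R) = 0 * 0 + 0 * Num.sqrt (rip v0 v0) + Num.sqrt (rip u0 u0) * 0.
    by ring.
  apply: cvgD; first apply: cvgD.
  + exact: cvgM.
  + by apply: cvgM => //; exact: cvg_cst.
  + by apply: cvgM => //; exact: cvg_cst.
Qed.

Lemma cvg_L2r_dominated (u : nat -> T -> R) v g :
  (forall n, measurable_fun setT (u n)) ->
  (forall x, u n x @[n --> \oo] --> v x) -> L2r g ->
  (forall n x, `|u n x| <= `|g x|) ->
  L2r v /\
  rip (fun x => u n x - v x) (fun x => u n x - v x) @[n --> \oo] --> 0.
Proof.
move=> mu_ uv Lg ug.
have mv : measurable_fun setT v by exact: (measurable_fun_cvg (h := u)).
have vg x : `|v x| <= `|g x|.
  have /cvg_norm := uv x => /(_ _ _) h.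
  by apply: (@ler_cvg_to _ _ _ _ _ (fun=> `|g x|) _ _ h (cvg_cst _)); exact: nearW.
split; first exact: L2r_le Lg.
have i4 := integrableRZ 4 Lg.2.
have m4 n : measurable_fun setT (fun x => (u n x - v x) * (u n x - v x)).
  by apply: measurable_funM; exact: measurable_funB.
have c4 x : (u n x - v x) * (u n x - v x) @[n --> \oo] --> 0.
  by rewrite -[X in _ --> X](mulr0 0); apply: cvgM; exact/subr_cvg0.
have b4 n x : `|(u n x - v x) * (u n x - v x)| <= 4 * g x ^+ 2.
  rewrite -expr2 ger0_norm ?sqr_ge0//.
  have := ug n x; have := vg x.
  rewrite -(ler_pXn2r (n := 2)) ?nnegrE//.
  move=> h1; rewrite -(ler_pXn2r (n := 2)) ?nnegrE// => h2.
  by move: h1 h2; rewrite !real_normK ?num_real//; nra.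
have [_ _] := cvg_Rintegral_dominated m4 c4 i4 b4.
by rewrite Rintegral_cst// mul0r.
Qed.

End L2_real.

(** * Borel sets of row vectors *)

Section borel_rV.
Context {R : realType} {d : nat}.
Local Notation X := 'rV[R]_d.

Lemma ball_rVE (x : X) (e : R) : 0 < e ->
  ball x e = [set y : X | forall i, ball (x ord0 i) e (y ord0 i)].
Proof.
move=> e0; apply/seteqP; split => y /=; first by move=> [_ h] i; exact: h.
by move=> h; split => // i j; rewrite (ord1 i); exact: h.
Qed.

Lemma measurable_ball_rV (x : X) (e : R) : measurable (ball x e).
Proof.
have [e0|e0] := ltP 0 e; last first.
  rewrite (_ : ball x e = set0) //; apply/seteqP; split => // y [] /=.
  by rewrite ltNge e0.
rewrite ball_rVE// (_ : mkset _ =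
  \bigcap_(i in [set: 'I_d]) (rV_coord i @^-1` ball (x ord0 i) e)); last first.
  by apply/seteqP; split => y /= h i => [_|]; exact: h.
apply: fin_bigcap_measurable => // i _.
rewrite -[X in measurable X]setTI; apply: measurable_rV_coord => //.
exact: measurable_ball.
Qed.

(** Balls of the sup norm are boxes, hence measurable, and an open set is the union of those balls
    with rational centre and radius 1/(k+1) that it contains; there are countably many. *)
Lemma open_measurable_rV (O : set X) : open O -> measurable O.
Proof.
move=> oO.
pose q (z : 'rV[rat]_d) : X := \row_i ratr (z ord0 i).
pose B (p : 'rV[rat]_d * nat) : set X := ball (q p.1) (p.2.+1%:R^-1).
have -> : O = \bigcup_(p in [set p | B p `<=` O]) B p.
  apply/seteqP; split => [x Ox|x [p /= pO]]; last exact: pO.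
  have /nbhs_ballP[e /= e0 xeO] : nbhs x O by exact: open_nbhs_nbhs.
  have [k] : exists k, k.+1%:R^-1 < e / 2.
    have [k _ kP] := near_infty_natSinv_lt (PosNum (divr_gt0 e0 (ltr0Sn R 1))).
    by exists k; exact: kP (leqnn k).
  set r := k.+1%:R^-1 => re.
  have r0 : 0 < r by rewrite invr_gt0.
  have /choice[z zP] : forall i, exists z : rat, `|x ord0 i - ratr z| < r.
    move=> i; have /rat_in_itvoo[z] : x ord0 i - r < x ord0 i + r by lra.
    rewrite in_itv/= => /andP[z1 z2]; exists z.
    by rewrite ltr_distl; apply/andP; split; lra.
  exists (\row_i z i, k) => /=; last first.
    rewrite /B ball_rVE// => i; rewrite !mxE /ball/= distrC.
    exact: zP.
  move=> y; rewrite /B ball_rVE//= -/r => yB; apply: xeO.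
  rewrite ball_rVE// => i; have := yB i; have := zP i.
  rewrite !mxE /ball/= => h1 h2.
  rewrite (splitr e) (le_lt_trans (ler_distD (ratr (z i)) _ _))// ltrD//.
    exact: lt_trans re.
  exact: lt_trans re.
rewrite bigcup_mkcond; apply: countable_bigcupT_measurable => // p.
by case: ifP => // _; exact: measurable_ball_rV.
Qed.

(** The measurable structure is generated by the coordinates, while the continuity argument below
    starts from open sets; this identity lets Dynkin's theorem connect the two. *)
Lemma measurable_rV_gen_open : @measurable _ X = <<s [set O : set X | open O] >>.
Proof.
apply/seteqP; split => [A mA|A]; last first.
  apply; split => [|O]; last exact: open_measurable_rV.
  split; [exact: measurable0|by move=> B; rewrite setTD; exact: measurableC|].
  by move=> F mF; exact: bigcup_measurable.
move: A mA; apply: smallest_sub; first exact: smallest_sigma_algebra.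
rewrite -bigcup_seq => A [i _ [B mB <-]].
pose f (x : g_sigma_algebraType [set O : set X | open O]) : R := x ord0 i.
have mf : measurable_fun setT f.
  apply: (measurability _ (RGenOpens.measurableE R)).
  move=> _ [_ [a [b ->]] <-]; rewrite setTI.
  apply: sub_sigma_algebra => /=.
  apply: (@open_comp X R (fun x => x ord0 i)); last exact: interval_open.
  by move=> x _; exact: coord_continuous.
exact: mf.
Qed.

Lemma continuous_measurable_fun_rV (f : X -> R) : continuous f ->
  measurable_fun setT f.
Proof.
move=> cf; apply: (measurability _ (RGenOpens.measurableE R)).
move=> _ [_ [a [b ->]] <-]; rewrite setTI; apply: open_measurable_rV.
by apply: open_comp; [move=> x _; exact: cf|exact: interval_open].
Qed.

Lemma lebesgue_rV_ball_lty (x : X) e : (lebesgue_rV d (ball x e) < +oo)%E.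
Proof.
have [e0|e0] := ltP 0 e; last first.
  rewrite (_ : ball x e = set0) ?measure0//; apply/seteqP; split => // y [] /=.
  by rewrite ltNge e0.
rewrite ball_rVE// (lebesgue_rV_box (A := fun i => ball (x ord0 i) e)); last first.
  by move=> i; exact: measurable_ball.
under eq_bigr do rewrite lebesgue_measure_ball ?ltW//.
by rewrite prodEFin ltry.
Qed.

Lemma lebesgue_rV_ball_gt0 (x : X) e : 0 < e -> 0 < fine (lebesgue_rV d (ball x e)).
Proof.
move=> e0; rewrite ball_rVE// (lebesgue_rV_box (A := fun i => ball (x ord0 i) e)).
  under eq_bigr do rewrite lebesgue_measure_ball ?ltW//.
  by rewrite prodEFin/= prodr_gt0// => i _; rewrite pmulrn_lgt0.
by move=> i; exact: measurable_ball.
Qed.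

End borel_rV.

(** * Continuity of composition operators on L^2 *)

Section composition_continuity.
Context {R : realType} {d : nat}.
Local Notation X := 'rV[R]_d.
Local Notation mu := (@lebesgue_rV R d).
(** Covers translations, with C n = 1, and dilations by b n, with C n = b n ^- d, where C n is the
    inverse of the Jacobian. *)
Variables (phi : nat -> X -> X) (C : nat -> R).
Hypothesis mphi : forall n, measurable_fun setT (phi n).
Hypothesis phi_id : forall x, phi n x @[n --> \oo] --> x.
Hypothesis C1 : C n @[n --> \oo] --> (1 : R).
Hypothesis phi_int : forall n (f : X -> \bar R), measurable_fun setT f ->
  (forall x, 0 <= f x)%E ->
  (\int[mu]_x f (phi n x) = (C n)%:E * \int[mu]_x f x)%E.

Lemma L2r_comp n u : L2r mu u -> L2r mu (u \o phi n).
Proof.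
move=> [mu_ u2]; have mup : measurable_fun setT (u \o phi n) by exact: measurableT_comp.
split => //; apply: ge0_integrableR => [|x|].
- exact: measurable_funX.
- exact: sqr_ge0.
- rewrite (phi_int n (f := fun x => (u x ^+ 2)%:E)) => [||x]; last 2 first.
  + exact: measurable_int u2.
  + by rewrite lee_fin sqr_ge0.
  by rewrite integral_EFin_Rintegral// -EFinM ltry.
Qed.

Lemma rip_comp n u : L2r mu u ->
  rip mu (u \o phi n) (u \o phi n) = C n * rip mu u u.
Proof.
move=> Lu; apply: EFin_inj; rewrite EFinM -!ripE//; last exact: L2r_comp.
rewrite -(phi_int n (f := fun x => (u x ^+ 2)%:E))// => [|x].
  exact: measurable_int Lu.2.
by rewrite lee_fin sqr_ge0.
Qed.

(** The class of good functions is a linear space, closed in L^2 by [P_lim]. It is enlarged from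
    indicators of open sets to measurable sets, nonnegative functions and finally all of L^2. *)
Let P u := L2r mu u /\
  rip mu (fun x => u (phi n x) - u x) (fun x => u (phi n x) - u x)
    @[n --> \oo] --> (0 : R).

Let PD u v : P u -> P v -> P (fun x => u x + v x).
Proof.
move=> [Lu cu] [Lv cv]; split; first exact: L2rD.
pose a n := rip mu (fun x => u (phi n x) - u x) (fun x => u (phi n x) - u x).
pose b n := rip mu (fun x => v (phi n x) - v x) (fun x => v (phi n x) - v x).
apply: (@squeeze_cvgr _ _ _ _ (fun=> 0) (fun n => 2 * a n + 2 * b n)).
- apply: nearW => n; rewrite rip_ge0/=.
  have L1 := L2rB (L2r_comp n Lu) Lu; have L2 := L2rB (L2r_comp n Lv) Lv.
  rewrite (le_trans _ (ripD_le L1 L2))//.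
  by under eq_fun do rewrite opprD addrACA.
- exact: cvg_cst.
- rewrite [X in _ --> X](_ : 0 = 2 * 0 + 2 * 0); last by rewrite !mulr0 addr0.
  by apply: cvgD; apply: cvgM => //; exact: cvg_cst.
Qed.

Let PZ k u : P u -> P (fun x => k * u x).
Proof.
move=> [Lu cu]; split; first exact: L2rZ.
pose a n := rip mu (fun x => u (phi n x) - u x) (fun x => u (phi n x) - u x).
rewrite (_ : (fun _ => _) = fun n => k * (k * a n)); last first.
  apply/funext => n; have L1 := L2rB (L2r_comp n Lu) Lu.
  rewrite /a -ripZr// -ripZl//; last exact: L2rZ.
  by under eq_fun do rewrite -mulrBr.
rewrite [X in _ --> X](_ : 0 = k * (k * 0)); last by rewrite !mulr0.
by apply: cvgM; [exact: cvg_cst|apply: cvgM => //; exact: cvg_cst].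
Qed.

Let PB u v : P u -> P v -> P (fun x => u x - v x).
Proof.
move=> Pu /(PZ (-1)) /(PD Pu).
by under [X in P X]eq_fun do rewrite mulN1r.
Qed.

Let P_lim (w : nat -> X -> R) u : (forall n, P (w n)) -> L2r mu u ->
  rip mu (fun x => w n x - u x) (fun x => w n x - u x) @[n --> \oo] --> (0 : R) ->
  P u.
Proof.
move=> Pw Lu wu; split => //.
apply/cvgrPdist_le => e e0.
(* With w close to u, u o phi - u = (w o phi - w) - (w - u) o phi + (w - u). Two uses of [ripD_le]
   bound the squared norm by (4 + 4 C n + 2) e / 16, which is at most e once C n <= 2. *)
have e16 : 0 < e / 16 by rewrite divr_gt0.
have [m mP] : exists m, rip mu (fun x => w m x - u x) (fun x => w m x - u x) <= e / 16.
  have /cvgrPdist_le/(_ _ e16)[m _ mP] := wu; exists m.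
  by have := mP m (leqnn m); rewrite /= sub0r normrN ger0_norm// rip_ge0.
have /cvgrPdist_le/(_ _ e16) wm := (Pw m).2.
have /cvgrPdist_le/(_ 1 ltr01) C2 := C1.
near=> n.
have Cn : C n <= 2.
  have : `|1 - C n| <= 1 by near: n.
  by rewrite ler_norml => /andP[]; lra.
have wn : rip mu (fun x => w m (phi n x) - w m x) (fun x => w m (phi n x) - w m x) <= e / 16.
  have : `|0 - rip mu (fun x => w m (phi n x) - w m x) (fun x => w m (phi n x) - w m x)| <= e / 16.
    by near: n.
  by rewrite sub0r normrN ger0_norm// rip_ge0.
rewrite sub0r normrN ger0_norm ?rip_ge0//.
have Lw := (Pw m).1.
have L1 := L2rB Lw Lu.
have L2 := L2rB (L2r_comp n Lw) Lw.
have L3 := L2r_comp n L1.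
have L4 := L2rB L2 L3.
have h1 := ripD_le L4 L1.
have h2 := ripD_le L2 (L2rZ (-1) L3).
have E1 : (fun x => w m (phi n x) - w m x - ((fun y => w m y - u y) \o phi n) x + (w m x - u x))
        = (fun x => u (phi n x) - u x).
  by apply/funext => x /=; ring.
have E2 : (fun x => w m (phi n x) - w m x + -1 * ((fun y => w m y - u y) \o phi n) x)
        = (fun x => w m (phi n x) - w m x - ((fun y => w m y - u y) \o phi n) x).
  by apply/funext => x; rewrite mulN1r.
rewrite E1 in h1; rewrite E2 in h2.
rewrite ripZl ?ripZr// in h2; last exact: L2rZ.
rewrite rip_comp// in h2.
have p0 := rip_ge0 mu (fun x => w m x - u x).
nra.
Unshelve. all: by end_near.
Qed.

(* Scheffe: as [O] is open, the integral of [\1_O \o phi n * \1_O] tends to [mu O]. *)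
Let P_open (O : set X) : open O -> (mu O < +oo)%E -> P (\1_O).
Proof.
move=> oO muO; have mO := open_measurable_rV oO.
have iO : mu.-integrable setT (EFin \o \1_O) by exact: integrableR_indic.
have sq1 (A : set X) x : (\1_A x : R) ^+ 2 = \1_A x.
  by rewrite indicE; case: (_ \in _); rewrite ?expr0n ?expr1n.
have LO : L2r mu (\1_O).
  split; first exact: measurable_indic.
  by under [X in EFin \o X]eq_fun do rewrite sq1.
split => //.
rewrite (_ : (fun n => _) = fun n => C n * rip mu (\1_O) (\1_O)
   - 2 * rip mu (\1_O \o phi n) (\1_O) + rip mu (\1_O) (\1_O)); last first.
  apply/funext => n; rewrite -rip_comp//.
  by rewrite -ripBB//; exact: L2r_comp.
rewrite [X in _ --> X](_ : 0 = 1 * rip mu (\1_O) (\1_O) - 2 * rip mu (\1_O) (\1_O)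
   + rip mu (\1_O) (\1_O)); last by ring.
apply: cvgD; last exact: cvg_cst.
apply: cvgB; first by apply: cvgM => //; exact: cvg_cst.
apply: cvgM; first exact: cvg_cst.
have c x : (\1_O \o phi n) x * \1_O x @[n --> \oo] --> (\1_O x * \1_O x : R).
  have [xO|xO] := pselect (O x); last first.
    rewrite [in X in _ --> X]indicE memNset// mulr0.
    rewrite (_ : (fun _ => _) = fun=> 0); first exact: cvg_cst.
    by apply/funext => n; rewrite [X in _ * X]indicE memNset// mulr0.
  apply: cvg_near_cst; have : \forall n \near \oo, O (phi n x).
    by have /(_ O) := @phi_id x; apply; exact: open_nbhs_nbhs.
  by apply: filterS => n On; rewrite /= !indicE !mem_set.
have [||_ _ //] := @cvg_Rintegral_dominated _ _ _ mu
   (fun n x => (\1_O \o phi n) x * \1_O x) _ _ _ c iO.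
- move=> n; apply: measurable_funM => //; apply: measurableT_comp => //.
- move=> n x; rewrite /= !indicE; case: (_ \in _); case: (_ \in _);
  by rewrite ?mulr1 ?mulr0 ?mul0r ?normr0 ?normr1.
Qed.

(** Dynkin's theorem. Intersecting with a fixed ball [K] keeps the measures finite, so that a
    complement becomes the difference of [\1_K] and [\1_(S]&[K)]. For a disjoint union the partial
    sums are dominated by [\1_K] and converge in L^2. *)
Let P_measurable (m : nat) (A : set X) : measurable A ->
  P (\1_(A `&` ball 0 m%:R)).
Proof.
rewrite measurable_rV_gen_open => gA.
set K : set X := ball 0 m%:R.
have oK : open K by exact: ball_open.
have Koo := lebesgue_rV_ball_lty (0 : X) m%:R.
have PK : P (\1_K) by exact: P_open.
apply: (@dynkin_induction _ X [set O | open O] (fun A => P (\1_(A `&` K)))) gA.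
- exact: measurable_rV_gen_open.
- by move=> S S' oS oS'; exact: openI.
- by rewrite setTI.
- move=> O oO; apply: P_open; first exact: openI.
  apply: le_lt_trans Koo; apply: le_measure; rewrite ?inE//.
  + by apply: measurableI; exact: open_measurable_rV.
  + exact: measurable_ball_rV.
- move=> S mS PS; rewrite (_ : \1_ _ = fun x => \1_K x - \1_(S `&` K) x :> R).
    exact: PB.
  apply/funext => x; rewrite !indicE !in_setI in_setC.
  by case: (_ \in S); case: (_ \in K); rewrite /= ?subrr ?subr0.
move=> F mF tF PF.
have PS n : P (fun x => \sum_(k < n) \1_(F k `&` K) x).
  elim: n => [|n IH].
    under [X in P X]eq_fun do rewrite big_ord0.
    by have := PB PK PK; under [X in P X]eq_fun do rewrite subrr.
  by under [X in P X]eq_fun do rewrite big_ord_recr /=; exact: PD.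
have FE x : (exists2 n, F n x & forall k, k != n -> ~ F k x) \/ (forall k, ~ F k x).
  have [[n Fn]|h] := pselect (exists n, F n x); [left|right].
    exists n => // k kn Fk; move/trivIsetP : tF => /(_ k n I I kn).
    by apply/eqP/set0P; exists x.
  by move=> k Fk; apply: h; exists k.
have sumE n x : \sum_(k < n) (\1_(F k `&` K) x : R) = \1_((\bigcup_(k < n) F k) `&` K) x.
  rewrite indicE; have [/set_mem[[k /= kn Fk] Kx]|] := boolP (x \in _).
    rewrite (bigD1 (Ordinal kn))//= indicE mem_set// big1 ?addr0//.
    move=> j jk; rewrite indicE memNset// => -[Fj _].
    move/trivIsetP : tF => /(_ j k I I jk).
    by apply/eqP/set0P; exists x.
  move=> h; apply: big1 => k _; rewrite indicE memNset// => -[Fk Kx].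
  by move: h; rewrite mem_set//; split => //; exists k => //=.
have c x : \sum_(k < n) \1_(F k `&` K) x @[n --> \oo] --> (\1_((\bigcup_k F k) `&` K) x : R).
  apply: cvg_near_cst.
  have [[[k _ Fk] Kx]|h] := pselect (((\bigcup_k F k) `&` K) x).
    exists k.+1 => //= n kn; rewrite sumE !indicE !mem_set//.
    + by split => //; exists k.
    + by split => //; exists k.
  apply: nearW => n; rewrite sumE !indicE !memNset// => -[[k _ Fk] Kx].
  by apply: h; split => //; exists k.
have [|L cL] := cvg_L2r_dominated (fun n => (PS n).1.1) c PK.1.
  move=> n x; rewrite sumE !indicE in_setI.
  by case: (_ \in _) => //=; case: (_ \in _); rewrite ?normr0 ?normr1.
exact: P_lim PS L cL.
Qed.

Import HBNNSimple.

Let P_ge0 u : L2r mu u -> (forall x, 0 <= u x) -> P u.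
Proof.
move=> Lu u0.
have mu_ : measurable_fun setT (EFin \o u) by apply/measurable_EFinP; exact: Lu.1.
pose g := nnsfun_approx measurableT mu_.
(* Simple functions are cut off to a growing ball because [P_measurable] only treats bounded
   sets. *)
pose w n x := g n x * \1_(ball (0 : X) n%:R) x.
have gc x : g n x @[n --> \oo] --> u x.
  exact: fine_cvg (cvg_nnsfun_approx measurableT mu_ (fun y _ => u0 y) I).
have g0 n x : 0 <= g n x by exact: fun_ge0.
have gu n x : g n x <= u x.
  rewrite -(cvg_lim _ (gc x))//; apply: nondecreasing_cvgn_le.
    by move=> a b ab; exact/lefP/(nd_nnsfun_approx measurableT mu_ ab).
  by apply/cvg_ex; exists (u x).
have Pw n : P (w n).
  have -> : w n = fun x => \sum_(y <- finmap.enum_fset (fset_set (range (g n))))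
      y * \1_((g n @^-1` [set y]) `&` ball (0 : X) n%:R) x.
    apply/funext => x; rewrite /w fimfunE fsbig_finite//= mulr_suml.
    by apply: eq_bigr => y _; rewrite indicI mulrA.
  elim: (finmap.enum_fset _) => [|y s IH].
    under [X in P X]eq_fun do rewrite big_nil.
    have := PZ 0 (@P_measurable 0 setT measurableT).
    by under [X in P X -> _]eq_fun do rewrite mul0r.
  under [X in P X]eq_fun do rewrite big_cons.
  by apply: PD => //; apply: PZ; exact: P_measurable.
have wc x : w n x @[n --> \oo] --> u x.
  rewrite -[X in _ --> X]mulr1; apply: cvgM => //.
  apply: cvg_near_cst; near=> n.
  rewrite indicE mem_set// -ball_normE/= sub0r normrN.
  near: n; exact: nbhs_infty_gtr.
have [|L cL] := cvg_L2r_dominated (fun n => (Pw n).1.1) wc Lu.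
  move=> n x; rewrite /w indicE; case: (_ \in _); rewrite ?mulr1 ?mulr0 ?normr0//.
  by rewrite !ger0_norm// (le_trans (g0 n x)).
exact: P_lim Pw L cL.
Unshelve. all: by end_near.
Qed.

(** u = (|u| + u) - |u| is a difference of two nonnegative square integrable functions. *)
Lemma L2r_comp_cvg u : L2r mu u ->
  rip mu (fun x => u (phi n x) - u x) (fun x => u (phi n x) - u x)
    @[n --> \oo] --> (0 : R).
Proof.
move=> Lu; have Pa : P (fun x => `|u x|).
  apply: P_ge0 => //; apply: (L2r_le _ _ Lu) => [|x]; last by rewrite normr_id.
  by apply: measurableT_comp => //; exact: Lu.1.
have Pau : P (fun x => `|u x| + u x).
  apply: P_ge0 => [|x]; first by apply: L2rD => //; exact: Pa.1.
  by have := ler_norm (- u x); rewrite normrN; lra.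
have := PB Pau Pa; rewrite (_ : (fun _ => _) = u); first by case.
by apply/funext => x; rewrite addrC addKr.
Qed.

End composition_continuity.

(** * The Abel weight and the Poisson kernel *)

Section poisson_line.
Context {R : realType}.
Local Notation mu := (@lebesgue_measure R).
Variable e : R.
Hypothesis e0 : 0 < e.

(* Its Fourier transform is elementary, unlike that of a Gaussian. *)
Definition abel (e s : R) : R := expR (- (e * `|s|)).

Lemma abel_gt0 s : 0 < abel e s. Proof. exact: expR_gt0. Qed.

Lemma continuous_abel : continuous (abel e).
Proof.
move=> s; rewrite /abel; apply: continuous_comp; last exact: continuous_expR.
apply: cvgN; apply: cvgM; first exact: cvg_cst.
exact: norm_continuous.
Qed.

(** Adding 1 to the cosine makes the integrand nonnegative, so that the fundamental theorem of
    calculus applies on the half-line with no prior integrability; the extra term is removed in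
    [integral_abel_cos]. *)
Let integral_abel_half z :
  (\int[mu]_(s in `[0%R, +oo[) (expR (- (e * s)) * (1 + cos (z * s)))%:E =
   (e^-1 + e / (e ^+ 2 + z ^+ 2))%:E)%E.
Proof.
pose f s : R := expR (- (e * s)) * (1 + cos (z * s)).
have D0 : e ^+ 2 + z ^+ 2 != 0.
  by rewrite gt_eqF// ltr_wpDr ?sqr_ge0// exprn_gt0.
pose F s : R := expR (- (e * s)) *
  ((z * sin (z * s) - e * cos (z * s)) / (e ^+ 2 + z ^+ 2) - e^-1).
have dF (s : R) : is_derive s (1 : R) F (f s).
  apply: is_derive_eq; rewrite /GRing.scale/= /f.
  by field; rewrite D0 gt_eqF.
have cf : continuous f.
  move=> s; apply: (@differentiable_continuous _ R^o R^o); apply/derivable1_diffP.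
  exact: ex_derive.
rewrite (@ge0_continuous_FTC2y _ f F 0 0).
- by rewrite sub0e /F !mulr0 sin0 cos0 oppr0 expR0; congr EFin; field; rewrite D0 gt_eqF.
- by move=> s _; rewrite mulr_ge0 ?expR_ge0//; have := cos_geN1 (z * s); lra.
- exact: continuous_subspaceT.
(* [M] bounds the bracket in [F], so |F s| <= M exp(-e s) tends to 0. *)
- pose M := (`|z| + e) / (e ^+ 2 + z ^+ 2) + e^-1.
  have M0 : 0 <= M.
    by rewrite addr_ge0 ?invr_ge0 ?(ltW e0)// divr_ge0// addr_ge0 ?sqr_ge0// ltW.
  have c0 : M * expR (- (e * s)) @[s --> +oo%R] --> 0.
    rewrite -[X in _ --> X](mulr0 M); apply: cvgM; first exact: cvg_cst.
    apply: (cvg_comp (fun s => e * s) (fun t => expR (- t))); last exact: cvgr_expR.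
    exact: gt0_cvgMry.
  apply/norm_cvg0P; apply: (squeeze_cvgr _ (cvg_cst 0) c0).
  apply: nearW => s; rewrite normr_ge0/= normrM mulrC (ger0_norm (expR_ge0 _)).
  rewrite ler_wpM2r ?expR_ge0// (le_trans (ler_normB _ _))// lerD//.
    rewrite normrM (ger0_norm (_ : 0 <= (e ^+ 2 + z ^+ 2)^-1)); last first.
      by rewrite invr_ge0 addr_ge0 ?sqr_ge0.
    rewrite ler_wpM2r ?invr_ge0 ?addr_ge0 ?sqr_ge0// (le_trans (ler_normB _ _))//.
    rewrite !normrM (gtr0_norm e0) lerD// ler_piMr//.
    + by rewrite ler_norml sin_geN1 sin_le1.
    + exact: ltW.
    + by rewrite ler_norml cos_geN1 cos_le1.
  by rewrite ger0_norm// invr_ge0 ltW.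
- by move=> s _; exact: ex_derive.
- apply: cvg_at_right_filter; apply: differentiable_continuous; apply/derivable1_diffP.
  exact: ex_derive.
- by move=> s _; rewrite derive1E; exact: derive_val.
Qed.

Let integral_abel_cos1 z :
  (\int[mu]_s (abel e s * (1 + cos (z * s)))%:E =
   (2 * (e^-1 + e / (e ^+ 2 + z ^+ 2)))%:E)%E.
Proof.
have p0 s : 0 <= abel e s * (1 + cos (z * s)).
  apply: mulr_ge0; first exact/ltW/abel_gt0.
  by have := cos_geN1 (z * s); lra.
rewrite ge0_symfun_integralT//.
- rewrite EFinM -integral_abel_half -set_itvcy; congr (_ * _)%E.
  apply: eq_integral => s /set_mem/=; rewrite in_itv/= andbT => s0.
  by rewrite /abel ger0_norm.
- move=> s; apply: cvgM; first exact: continuous_abel.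
  apply: cvgD; first exact: cvg_cst.
  apply: continuous_comp; last exact: continuous_cos.
  by apply: cvgM; [exact: cvg_cst|exact: cvg_id].
- by move=> s /=; rewrite /abel normrN mulrN cosN.
Qed.

Lemma integrable_abel_cos1 z :
  mu.-integrable setT (EFin \o (fun s => abel e s * (1 + cos (z * s)))).
Proof.
apply: ge0_integrableR.
- apply: continuous_measurable_fun => s; apply: cvgM; first exact: continuous_abel.
  apply: cvgD; first exact: cvg_cst.
  apply: continuous_comp; last exact: continuous_cos.
  by apply: cvgM; [exact: cvg_cst|exact: cvg_id].
- move=> s; apply: mulr_ge0; first exact/ltW/abel_gt0.
  by have := cos_geN1 (z * s); lra.
- by rewrite integral_abel_cos1 ltry.
Qed.

Lemma integrable_abel : mu.-integrable setT (EFin \o abel e).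
Proof.
have := integrable_abel_cos1 0; rewrite (_ : (fun _ => _) = (fun s => 2 * abel e s)).
  move=> /(integrableRZ 2^-1); under [X in EFin \o X]eq_fun do rewrite mulKf//.
  by [].
by apply/funext => s; rewrite mul0r cos0; ring.
Qed.

Lemma integral_abel_cos z :
  \int[mu]_s (abel e s * cos (z * s)) = 2 * e / (e ^+ 2 + z ^+ 2).
Proof.
have D0 : e ^+ 2 + z ^+ 2 != 0.
  by rewrite gt_eqF// ltr_wpDr ?sqr_ge0// exprn_gt0.
have R1 z' : \int[mu]_s (abel e s * (1 + cos (z' * s))) =
    2 * (e^-1 + e / (e ^+ 2 + z' ^+ 2)).
  by rewrite /Rintegral integral_abel_cos1.
have R0 : \int[mu]_s abel e s = 2 / e.
  have := R1 0; rewrite (_ : (fun _ => _) = (fun s => 2 * abel e s)); last first.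
    by apply/funext => s; rewrite mul0r cos0; ring.
  rewrite RintegralZl//; last exact: integrable_abel.
  move=> /(congr1 (fun r => 2^-1 * r)); rewrite !mulKf// => ->.
  by field; rewrite gt_eqF.
rewrite (_ : (fun _ => _) = (fun s => abel e s * (1 + cos (z * s)) - abel e s)); last first.
  by apply/funext => s; ring.
rewrite RintegralB//; [|exact: integrable_abel_cos1|exact: integrable_abel].
by rewrite R1 R0; field; rewrite D0 gt_eqF.
Qed.

End poisson_line.

Lemma integral_cauchy (R : realType) :
  (\int[@lebesgue_measure R]_s (pi^-1 * (1 + s ^+ 2)^-1)%:E = 1)%E.
Proof.
have c : continuous (fun s : R => (1 + s ^+ 2)^-1).
  by move=> s; exact: continuous_oneDsqrV.
under eq_integral do rewrite EFinM.
rewrite ge0_integralZl_EFin//; last 3 first.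
- by move=> s _; rewrite lee_fin invr_ge0 addr_ge0// sqr_ge0.
- by apply/measurable_EFinP; exact: continuous_measurable_fun.
- by rewrite invr_ge0 pi_ge0.
rewrite ge0_symfun_integralT//.
- rewrite -set_itvcy integral0y_oneDsqr -!EFinM; congr EFin.
  have p0 : (pi : R) != 0 by rewrite gt_eqF ?pi_gt0.
  have H (p : R) : p != 0 -> p^-1 * (2 * (p / 2)) = 1 by move=> ?; field.
  exact: H.
- by move=> s; rewrite invr_ge0 addr_ge0// sqr_ge0.
- by move=> s /=; rewrite sqrrN.
Qed.

Section affine_Rintegral.
Context {R : realType} {n : nat}.
Local Notation mu := (@lebesgue_rV R n).
Variables (a : R) (b : 'rV[R]_n).
Hypothesis a0 : a != 0.
Implicit Types f : 'rV[R]_n -> R.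

Lemma measurable_affine_rV : measurable_fun setT (fun x : 'rV[R]_n => a *: x + b).
Proof. by apply: measurable_rVD => //; exact: measurable_rVZ. Qed.

Lemma integrableR_affine f : mu.-integrable setT (EFin \o f) ->
  mu.-integrable setT (EFin \o (fun x => f (a *: x + b))).
Proof.
move=> f1; have mf := integrableR_measurable f1.
apply/integrableP; split.
  apply/measurable_EFinP.
  by apply: (measurableT_comp mf); exact: measurable_affine_rV.
rewrite (ge0_integral_affine b a0 (f := fun x => `|f x|%:E))//.
  by move: f1 => /integrableP[_ foo]; rewrite lte_mul_pinfty ?lee_fin ?invr_ge0 ?exprn_ge0.
by apply/measurable_EFinP; exact: measurableT_comp.
Qed.

Lemma Rintegral_affine f : mu.-integrable setT (EFin \o f) ->
  \int[mu]_x f (a *: x + b) = `|a| ^- n * \int[mu]_x f x.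
Proof.
move=> f1; have mf := integrableR_measurable f1.
have f1' := integrableR_affine f1.
apply: EFin_inj; rewrite EFinM -!integral_EFin_Rintegral//.
pose g := EFin \o f.
have mg : measurable_fun setT g by exact/measurable_EFinP.
rewrite integralE [X in (_ = _ * X)%E]integralE muleBr//; last first.
  exact: integrable_add_def.
rewrite -!(ge0_integral_affine b a0)//=; [|exact: measurable_funeneg|exact: measurable_funepos].
by rewrite (funepos_comp g (fun x => a *: x + b)) (funeneg_comp g (fun x => a *: x + b)).
Qed.

End affine_Rintegral.

Section product_integrals.
Context {R : realType}.
Local Notation leb := (@lebesgue_measure R).

Lemma ge0_integral_prod n (g : R -> R) : measurable_fun setT g ->
  (forall s, 0 <= g s) ->
  (\int[lebesgue_rV n]_x (\prod_(i < n) g (x ord0 i))%:E =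
   \prod_(i < n) \int[leb]_s (g s)%:E)%E.
Proof.
move=> mg g0.
have mp k : measurable_fun setT (fun x : 'rV[R]_k => \prod_(i < k) g (x ord0 i)).
  apply: measurable_prod => i _.
  exact: (measurableT_comp mg (@measurable_rV_coord R k i)).
elim: n => [|n IH].
  rewrite big_ord0 integral_dirac//; first by rewrite big_ord0 diracT mul1e.
  by apply/measurable_EFinP; exact: mp.
rewrite ge0_integral_rVS//; last 2 first.
- by apply/measurable_EFinP; exact: mp.
- by move=> x; rewrite lee_fin prodr_ge0.
rewrite big_ord_recl -IH.
transitivity (\int[leb]_t ((g t)%:E *
    \int[lebesgue_rV n]_x (\prod_(i < n) g (x ord0 i))%:E))%E.
  apply: eq_integral => t _.
  rewrite -ge0_integralZl_EFin//; last 2 first.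
  - by move=> x _; rewrite lee_fin prodr_ge0.
  - by apply/measurable_EFinP; exact: mp.
  apply: eq_integral => x _; rewrite big_ord_recl rV_cons0 -EFinM; congr (_ * _)%:E.
  by apply: eq_bigr => i _; rewrite rV_consS.
rewrite ge0_integralZr//; last 2 first.
- by move=> t _; rewrite lee_fin.
- by apply: integral_ge0 => x _; rewrite lee_fin prodr_ge0.
exact/measurable_EFinP.
Qed.

(** Integrability is asked of every slice, not of almost every one, since the real-valued inner
    integral has to agree with the extended one at each t. *)
Lemma Rintegral_rVS n (f : 'rV[R]_n.+1 -> R) :
  (lebesgue_rV n.+1).-integrable setT (EFin \o f) ->
  (forall t, (lebesgue_rV n).-integrable setT (EFin \o (fun x => f (rV_cons (t, x))))) ->
  \int[lebesgue_rV n.+1]_x f x = \int[leb]_t \int[lebesgue_rV n]_x f (rV_cons (t, x)).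
Proof.
move=> f1 ft1; have mf := integrableR_measurable f1.
pose pm : {measure set 'rV[R]_n.+1 -> \bar R} :=
  measure_function_pushforward__canonical__measure_function_Measure
    (leb \x lebesgue_rV n)%E (@measurable_rV_cons R n).
have mfc : measurable_fun setT (f \o @rV_cons R n).
  by apply: measurableT_comp => //; exact: measurable_rV_cons.
have fc1 : (leb \x lebesgue_rV n)%E.-integrable setT (EFin \o (f \o @rV_cons R n)).
  apply/integrable12ltyP; first exact/measurable_EFinP.
  move: f1 => /integrableP[_]; rewrite ge0_integral_rVS//.
  by apply/measurable_EFinP; exact: measurableT_comp.
rewrite /Rintegral; congr fine.
rewrite (@eq_measure_integral _ _ _ _ pm)// /pm.
rewrite (integral_pushforward (@measurable_rV_cons R n))//=; last exact/measurable_EFinP.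
rewrite preimage_setT -integral12_prod_meas1//.
apply: eq_integral => t _; rewrite /fubini_F/= fineK//.
exact: (integrable_fin_num measurableT (ft1 t)).
Qed.

End product_integrals.

Section abel_rV.
Context {R : realType}.
Variable e : R.
Hypothesis e0 : 0 < e.
Local Notation leb := (@lebesgue_measure R).

Definition abel_rV n (x : 'rV[R]_n) : R := \prod_(i < n) abel e (x ord0 i).

(** Product of the standard Cauchy densities, that is, of Poisson kernels at height 1; it has total
    mass 1. *)
Definition cauchy_rV n (z : 'rV[R]_n) : R :=
  \prod_(i < n) (pi^-1 * (1 + z ord0 i ^+ 2)^-1).

Lemma abel_rV_gt0 n (x : 'rV[R]_n) : 0 < abel_rV x.
Proof. by apply: prodr_gt0 => i _; exact: abel_gt0. Qed.

Lemma measurable_abel : measurable_fun setT (abel e).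
Proof. by apply: continuous_measurable_fun; exact: continuous_abel. Qed.

Lemma measurable_abel_rV n : measurable_fun setT (@abel_rV n).
Proof.
apply: measurable_prod => i _.
exact: (measurableT_comp measurable_abel (@measurable_rV_coord R n i)).
Qed.

Lemma integrable_abel_rV n :
  (lebesgue_rV n).-integrable setT (EFin \o @abel_rV n).
Proof.
apply: ge0_integrableR; first exact: measurable_abel_rV.
  by move=> x; exact/ltW/abel_rV_gt0.
rewrite ge0_integral_prod; [|exact: measurable_abel|by move=> s; exact/ltW/abel_gt0].
under eq_bigr do rewrite (integral_EFin_Rintegral (integrable_abel e0)).
by rewrite prodEFin ltry.
Qed.

Lemma integrable_abel_rV_bounded n (k : 'rV[R]_n -> R) :
  measurable_fun setT k -> (forall x, `|k x| <= 1) ->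
  (lebesgue_rV n).-integrable setT (EFin \o (fun x => abel_rV x * k x)).
Proof.
move=> mk k1; apply: (le_integrableR _ _ (integrable_abel_rV n)).
  by apply: measurable_funM => //; exact: measurable_abel_rV.
by move=> x; rewrite normrM ler_piMr.
Qed.

Lemma measurable_cos_dotv n (z : 'rV[R]_n) :
  measurable_fun setT (fun x => cos (dotv z x)).
Proof.
apply: (measurableT_comp (continuous_measurable_fun (@continuous_cos R))).
by apply: measurable_dotv => //; exact: measurable_cst.
Qed.

Lemma measurable_sin_dotv n (z : 'rV[R]_n) :
  measurable_fun setT (fun x => sin (dotv z x)).
Proof.
apply: (measurableT_comp (continuous_measurable_fun (@continuous_sin R))).
by apply: measurable_dotv => //; exact: measurable_cst.
Qed.

Lemma cos_norm_le1 (t : R) : `|cos t| <= 1.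
Proof. by rewrite ler_norml cos_geN1 cos_le1. Qed.

Lemma sin_norm_le1 (t : R) : `|sin t| <= 1.
Proof. by rewrite ler_norml sin_geN1 sin_le1. Qed.

(** The weight is even and the sine odd; x -> -x is the affine change of variables with factor
    -1. *)
Lemma integral_abel_rV_sin n (z : 'rV[R]_n) :
  \int[lebesgue_rV n]_x (abel_rV x * sin (dotv z x)) = 0.
Proof.
have i1 := integrable_abel_rV_bounded (measurable_sin_dotv z) (fun x => sin_norm_le1 _).
have N10 : -1 != 0 :> R by rewrite oppr_eq0 oner_eq0.
have := Rintegral_affine 0 N10 i1.
rewrite normrN normr1 expr1n invr1 mul1r.
rewrite (_ : (fun _ => _) = (fun x => -1 * (abel_rV x * sin (dotv z x)))).
  by rewrite RintegralZl//; lra.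
apply/funext => x; rewrite addr0.
have -> : dotv z (-1 *: x) = - dotv z x.
  by rewrite /dotv -sumrN; apply: eq_bigr => i _; rewrite !mxE mulN1r mulrN.
rewrite sinN mulrN mulN1r; congr (- (_ * _)).
by apply: eq_bigr => i _; rewrite /abel !mxE mulN1r normrN.
Qed.

(** Splitting off the first coordinate, the addition formula yields a product of cosines minus a
    product of sines, and the latter integrates to 0 by [integral_abel_rV_sin]. *)
Lemma integral_abel_rV_cos n (z : 'rV[R]_n) :
  \int[lebesgue_rV n]_x (abel_rV x * cos (dotv z x)) =
  \prod_(i < n) (2 * e / (e ^+ 2 + z ord0 i ^+ 2)).
Proof.
elim: n z => [|n IH] z.
  rewrite big_ord0 /Rintegral integral_dirac//; last first.
    apply/measurable_EFinP; apply: measurable_funM; first exact: measurable_abel_rV.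
    exact: measurable_cos_dotv.
  by rewrite diracT mul1e /abel_rV /dotv !big_ord0 cos0 mulr1.
pose z' : 'rV[R]_n := \row_i z ord0 (lift ord0 i).
have iC := integrable_abel_rV_bounded (measurable_cos_dotv z') (fun x => cos_norm_le1 _).
have iS := integrable_abel_rV_bounded (measurable_sin_dotv z') (fun x => sin_norm_le1 _).
have E t (x : 'rV[R]_n) : abel_rV (rV_cons (t, x)) * cos (dotv z (rV_cons (t, x))) =
    abel e t * cos (z ord0 ord0 * t) * (abel_rV x * cos (dotv z' x))
  - abel e t * sin (z ord0 ord0 * t) * (abel_rV x * sin (dotv z' x)).
  rewrite {1}/abel_rV big_ord_recl rV_cons0/=.
  have -> : \prod_(i < n) abel e (rV_cons (t, x) ord0 (lift ord0 i)) = abel_rV x.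
    by apply: eq_bigr => i _; rewrite rV_consS.
  have -> : dotv z (rV_cons (t, x)) = z ord0 ord0 * t + dotv z' x.
    rewrite /dotv big_ord_recl rV_cons0; congr (_ + _).
    by apply: eq_bigr => i _; rewrite rV_consS mxE.
  by rewrite cosD; ring.
rewrite Rintegral_rVS; last 2 first.
- exact: (integrable_abel_rV_bounded (measurable_cos_dotv z) (fun x => cos_norm_le1 _)).
- move=> t; under [X in EFin \o X]eq_fun do rewrite E.
  by apply: integrableRB; exact: integrableRZ.
transitivity (\int[leb]_t (abel e t * cos (z ord0 ord0 * t) *
    \prod_(i < n) (2 * e / (e ^+ 2 + z' ord0 i ^+ 2)))).
  apply: eq_Rintegral => t _; under eq_Rintegral do rewrite E.
  rewrite RintegralB//; [|exact: integrableRZ|exact: integrableRZ].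
  by rewrite !RintegralZl// IH integral_abel_rV_sin mulr0 subr0.
rewrite RintegralZr//; last first.
  apply: (le_integrableR _ _ (integrable_abel e0)).
    apply: measurable_funM; first exact: measurable_abel.
    apply: (measurableT_comp (continuous_measurable_fun (@continuous_cos R))).
    exact: measurable_funM.
  by move=> t; rewrite normrM ler_piMr ?cos_norm_le1.
rewrite integral_abel_cos// [RHS]big_ord_recl; congr (_ * _).
by apply: eq_bigr => i _; rewrite mxE.
Qed.

Lemma integral_abel_rV_cosE n (z : 'rV[R]_n) :
  \int[lebesgue_rV n]_x (abel_rV x * cos (dotv z x)) =
  (2 * pi) ^+ n * e ^- n * cauchy_rV (e^-1 *: z).
Proof.
rewrite integral_abel_rV_cos /cauchy_rV -exprVn -exprMn.
have -> : (2 * pi / e) ^+ n = \prod_(i < n) (2 * pi / e) by rewrite prodr_const card_ord.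
rewrite -big_split/=.
apply: eq_bigr => i _; rewrite !mxE.
have H (p x : R) : p != 0 -> 2 * e / (e ^+ 2 + x ^+ 2) =
    2 * p / e * (p^-1 * (1 + (e^-1 * x) ^+ 2)^-1).
  move=> p0; field; rewrite p0 gt_eqF//= andbT.
  by rewrite gt_eqF//= ltr_wpDr ?sqr_ge0// exprn_gt0.
by apply: H; rewrite gt_eqF ?pi_gt0.
Qed.

Lemma cauchy_rV_gt0 n (z : 'rV[R]_n) : 0 < cauchy_rV z.
Proof.
apply: prodr_gt0 => i _; rewrite mulr_gt0 ?invr_gt0 ?pi_gt0//.
by rewrite ltr_wpDr ?sqr_ge0.
Qed.

Lemma measurable_cauchy : measurable_fun setT (fun s : R => pi^-1 * (1 + s ^+ 2)^-1).
Proof.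
apply: measurable_funM; first exact: measurable_cst.
by apply: continuous_measurable_fun => s; exact: continuous_oneDsqrV.
Qed.

Lemma measurable_cauchy_rV n : measurable_fun setT (@cauchy_rV n).
Proof.
apply: measurable_prod => i _.
exact: (measurableT_comp measurable_cauchy (@measurable_rV_coord R n i)).
Qed.

Lemma integral_cauchy_rV n :
  (\int[lebesgue_rV n]_z (cauchy_rV z)%:E = 1)%E.
Proof.
rewrite (ge0_integral_prod _ measurable_cauchy); last first.
  by move=> s; rewrite mulr_ge0 ?invr_ge0 ?pi_ge0// addr_ge0// sqr_ge0.
by apply: big1 => i _; exact: integral_cauchy.
Qed.

End abel_rV.

(** * The Plancherel theorem *)

Section fubini_bounded.
Context d1 d2 (T1 : measurableType d1) (T2 : measurableType d2) (R : realType).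
Variables (m1 : {sigma_finite_measure set T1 -> \bar R})
          (m2 : {sigma_finite_measure set T2 -> \bar R}).

Lemma Rintegral_fubini (f : T1 * T2 -> R) :
  (m1 \x m2)%E.-integrable setT (EFin \o f) ->
  (forall x, m2.-integrable setT (EFin \o (fun y => f (x, y)))) ->
  (forall y, m1.-integrable setT (EFin \o (fun x => f (x, y)))) ->
  \int[m1]_x \int[m2]_y f (x, y) = \int[m2]_y \int[m1]_x f (x, y).
Proof.
move=> f1 fx fy; rewrite /Rintegral; congr fine.
transitivity (\int[m1]_x fubini_F m2 (EFin \o f) x)%E.
  apply: eq_integral => x _; rewrite /fubini_F/= fineK//.
  exact: (integrable_fin_num measurableT (fx x)).
rewrite integral12_prod_meas1// -integral21_prod_meas1//.
apply: eq_integral => y _; rewrite /fubini_G/= fineK//.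
exact: (integrable_fin_num measurableT (fy y)).
Qed.

Lemma measurable_Rintegral2 (f : T1 * T2 -> R) :
  (m1 \x m2)%E.-integrable setT (EFin \o f) ->
  measurable_fun setT (fun x => \int[m2]_y f (x, y)).
Proof.
by move=> f1; have := measurable_fubini_F f1; exact: measurableT_comp.
Qed.

Lemma measurable_Rintegral1 (f : T1 * T2 -> R) :
  (m1 \x m2)%E.-integrable setT (EFin \o f) ->
  measurable_fun setT (fun y => \int[m1]_x f (x, y)).
Proof.
by move=> f1; have := measurable_fubini_G f1; exact: measurableT_comp.
Qed.

Variables (p : T1 -> R) (q : T2 -> R) (k : T1 * T2 -> R) (M : R).
Hypothesis ip : m1.-integrable setT (EFin \o p).
Hypothesis iq : m2.-integrable setT (EFin \o q).
Hypothesis mk : measurable_fun setT k.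
Hypothesis kM : forall z, `|k z| <= M.

(** The sign of [M] can only be read off at a point of the product, so the empty product is treated
    separately in the next lemma. *)
Let M0 (z : T1 * T2) : 0 <= M. Proof. exact: le_trans (kM z). Qed.

Lemma integrable_prod_bounded :
  (m1 \x m2)%E.-integrable setT (EFin \o (fun z => p z.1 * (q z.2 * k z))).
Proof.
have mp := integrableR_measurable ip; have mq := integrableR_measurable iq.
have mf : measurable_fun setT (fun z : T1 * T2 => p z.1 * (q z.2 * k z)).
  apply: measurable_funM; first exact: measurableT_comp.
  by apply: measurable_funM => //; exact: measurableT_comp.
apply/integrable12ltyP; first exact/measurable_EFinP.
have [[z0]|T0] := pselect (inhabited (T1 * T2)%type); last first.
  rewrite (_ : (\int[m1]_x _)%E = 0%E) ?ltry//.
  rewrite (eq_integral (cst 0%E)); first by rewrite integral0.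
  move=> x _; rewrite (eq_integral (cst 0%E)); first by rewrite integral0.
  by move=> y _; exfalso; apply: T0; constructor.
have M0' := M0 z0.
have ip' := integrable_norm ip; have iq' := integrable_norm iq.
apply: (@le_lt_trans _ _ (\int[m1]_x (`|p x| * (M * \int[m2]_y `|q y|))%:E)%E); last first.
  rewrite (@integral_EFin_Rintegral _ _ _ m1 (fun x => `|p x| * (M * \int[m2]_y `|q y|)))//.
    exact: ltry.
  under [X in EFin \o X]eq_fun do rewrite mulrC.
  exact: integrableRZ.
apply: ge0_le_integral => //.
- by move=> x _; exact: integral_ge0.
- apply: (measurable_fun_fubini_tonelli_F (fun z => `|p z.1 * (q z.2 * k z)|%:E)) => //.
  by apply/measurable_EFinP; exact: measurableT_comp.
- apply/measurable_EFinP; apply: measurable_funM; last exact: measurable_cst.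
  exact: measurableT_comp.
move=> x _; apply: (@le_trans _ _ (\int[m2]_y (`|p x| * (M * `|q y|))%:E)%E).
  apply: ge0_le_integral => //.
  - apply/measurable_EFinP; apply: measurableT_comp => //.
    exact: (measurableT_comp mf (@measurable_pair1 _ _ _ _ _)).
  - apply/measurable_EFinP; apply: measurable_funM; first exact: measurable_cst.
    apply: measurable_funM; first exact: measurable_cst.
    exact: measurableT_comp.
  - move=> y _; rewrite /= lee_fin !normrM ler_wpM2l// mulrC ler_wpM2r//.
rewrite (@integral_EFin_Rintegral _ _ _ m2 (fun y => `|p x| * (M * `|q y|))).
  by rewrite !RintegralZl//; exact: integrableRZ.
by apply: integrableRZ; exact: integrableRZ.
Qed.

Let ixy x : m2.-integrable setT (EFin \o (fun y => q y * k (x, y))).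
Proof.
have mq := integrableR_measurable iq.
apply: (le_integrableR _ _ (integrableRZ M iq)).
  apply: measurable_funM => //.
  exact: (measurableT_comp mk (@measurable_pair1 _ _ _ _ _)).
move=> y; rewrite !normrM mulrC ler_wpM2r// (le_trans (kM _))//.
exact: ler_norm.
Qed.

Let iyx y : m1.-integrable setT (EFin \o (fun x => p x * k (x, y))).
Proof.
have mp := integrableR_measurable ip.
apply: (le_integrableR _ _ (integrableRZ M ip)).
  apply: measurable_funM => //.
  exact: (measurableT_comp mk (@measurable_pair2 _ _ _ _ _)).
move=> x; rewrite !normrM mulrC ler_wpM2r// (le_trans (kM _))//.
exact: ler_norm.
Qed.

(** The form in which Fubini's theorem is applied to transforms: two integrable factors and a
    bounded trigonometric kernel. *)
Lemma fubini_bounded :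
  \int[m1]_x (p x * \int[m2]_y (q y * k (x, y))) =
  \int[m2]_y (q y * \int[m1]_x (p x * k (x, y))).
Proof.
transitivity (\int[m1]_x \int[m2]_y (p x * (q y * k (x, y)))).
  by apply: eq_Rintegral => x _; rewrite RintegralZl.
rewrite (Rintegral_fubini (f := fun z => p z.1 * (q z.2 * k z)))/=.
- apply: eq_Rintegral => y _; rewrite -RintegralZl//.
  by apply: eq_Rintegral => x _; rewrite mulrCA.
- exact: integrable_prod_bounded.
- by move=> x; exact: integrableRZ.
- by move=> y; under [X in EFin \o X]eq_fun do rewrite mulrCA; exact: integrableRZ.
Qed.

Lemma measurable_integral_bounded :
  measurable_fun setT (fun x => p x * \int[m2]_y (q y * k (x, y))).
Proof.
rewrite (_ : (fun x => _) = fun x => \int[m2]_y (p x * (q y * k (x, y)))).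
  exact: (measurable_Rintegral2 integrable_prod_bounded).
by apply/funext => x; rewrite RintegralZl.
Qed.

End fubini_bounded.

Section plancherel_real.
Context {R : realType} {n : nat}.
Local Notation X := 'rV[R]_n.
Local Notation mu := (@lebesgue_rV R n).

(** Unnormalized real transforms. Plancherel is proved for these first, with real integrals only;
    [Re_fourier1] and [Im_fourier1] recombine them with the factor (2 pi)^(-n/2). *)
Definition cosT (u : X -> R) (xi : X) : R := \int[mu]_x (u x * cos (dotv x xi)).
Definition sinT (u : X -> R) (xi : X) : R := \int[mu]_x (u x * sin (dotv x xi)).

Lemma dotvC (x y : X) : dotv x y = dotv y x.
Proof. by apply: eq_bigr => i _; rewrite mulrC. Qed.

Lemma dotvDl (x y z : X) : dotv (x + y) z = dotv x z + dotv y z.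
Proof. by rewrite /dotv -big_split/=; apply: eq_bigr => i _; rewrite mxE mulrDl. Qed.

Lemma dotvZl a (x z : X) : dotv (a *: x) z = a * dotv x z.
Proof. by rewrite /dotv mulr_sumr; apply: eq_bigr => i _; rewrite mxE mulrA. Qed.

Lemma dotvNl (x z : X) : dotv (- x) z = - dotv x z.
Proof. by rewrite -scaleN1r dotvZl mulN1r. Qed.

Lemma measurable_dotv2 :
  measurable_fun setT (fun z : X * X => dotv z.1 z.2).
Proof. by apply: measurable_dotv; [exact: measurable_fst|exact: measurable_snd]. Qed.

Let mcos : measurable_fun setT (@cos R).
Proof. exact: continuous_measurable_fun (@continuous_cos R). Qed.
Let msin : measurable_fun setT (@sin R).
Proof. exact: continuous_measurable_fun (@continuous_sin R). Qed.

Lemma integrable_cos u (xi : X) : mu.-integrable setT (EFin \o u) ->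
  mu.-integrable setT (EFin \o (fun x => u x * cos (dotv x xi))).
Proof.
move=> iu; have mu_ := integrableR_measurable iu; apply: (le_integrableR _ _ iu).
  apply: measurable_funM => //; apply: (measurableT_comp mcos).
  by apply: measurable_dotv => //; exact: measurable_cst.
by move=> x; rewrite normrM ler_piMr ?cos_norm_le1.
Qed.

Lemma integrable_sin u (xi : X) : mu.-integrable setT (EFin \o u) ->
  mu.-integrable setT (EFin \o (fun x => u x * sin (dotv x xi))).
Proof.
move=> iu; have mu_ := integrableR_measurable iu; apply: (le_integrableR _ _ iu).
  apply: measurable_funM => //; apply: (measurableT_comp msin).
  by apply: measurable_dotv => //; exact: measurable_cst.
by move=> x; rewrite normrM ler_piMr ?sin_norm_le1.
Qed.

Section transform.
Variable u : X -> R.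
Hypothesis iu : mu.-integrable setT (EFin \o u).
Let mu_ : measurable_fun setT u := integrableR_measurable iu.

(** The integrand is not integrable in (x, xi) jointly. Multiplying by the positive integrable
    weight [abel_rV 1 xi] makes Fubini available, and [w], its inverse, undoes the
    multiplication. *)
Let measurable_transform (c : R -> R) : measurable_fun setT c ->
  (forall t, `|c t| <= 1) ->
  measurable_fun setT (fun xi : X => \int[mu]_x (u x * c (dotv x xi))).
Proof.
move=> mc c1.
have m := measurable_integral_bounded (integrable_abel_rV (@ltr01 R) n) iu
   (measurableT_comp mc measurable_dotv2) (fun x => c1 _).
pose w (x : X) : R := \prod_(i < n) expR `|x ord0 i|.
have mw : measurable_fun setT w.
  apply: measurable_prod => i _; apply: measurableT_comp => //.
  by apply: measurableT_comp => //; exact: measurable_rV_coord.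
have wE x : w x * abel_rV 1 x = 1.
  rewrite /w /abel_rV -big_split/= big1// => i _.
  by rewrite /abel mul1r -expRD subrr expR0.
rewrite (_ : (fun xi => _) = fun xi => w xi * (abel_rV 1 xi *
    \int[mu]_y (u y * (c \o (fun z : X * X => dotv z.1 z.2)) (xi, y)))).
  exact: measurable_funM.
apply/funext => xi; rewrite mulrA wE mul1r.
by apply: eq_Rintegral => y _; rewrite /= dotvC.
Qed.

Lemma measurable_cosT : measurable_fun setT (cosT u).
Proof. exact: measurable_transform mcos cos_norm_le1. Qed.

Lemma measurable_sinT : measurable_fun setT (sinT u).
Proof. exact: measurable_transform msin sin_norm_le1. Qed.

Let M : R := \int[mu]_x `|u x|.

Let transform_le (c : R -> R) : measurable_fun setT c ->
  (forall t, `|c t| <= 1) -> forall xi, `|\int[mu]_x (u x * c (dotv x xi))| <= M.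
Proof.
move=> mc c1 xi.
have i1 : mu.-integrable setT (EFin \o (fun x => u x * c (dotv x xi))).
  apply: (le_integrableR _ _ iu).
    apply: measurable_funM => //; apply: (measurableT_comp mc).
    by apply: measurable_dotv => //; exact: measurable_cst.
  by move=> x; rewrite normrM ler_piMr.
apply: (le_trans (le_normr_Rintegral _ i1)) => //.
apply: le_Rintegral => //; [exact: integrable_norm i1|exact: integrable_norm iu|].
by move=> x _; rewrite normrM ler_piMr.
Qed.

Let cos_diff (x y xi : X) : cos (dotv (x - y) xi) =
  cos (dotv x xi) * cos (dotv y xi) + sin (dotv x xi) * sin (dotv y xi).
Proof. by rewrite dotvDl dotvNl cosB. Qed.

(** The real part of exp(i x.xi) times the transform of u. Integrated against u(x) it gives the
    squared modulus of the transform, and it is itself an integral of u(y) cos((x - y).xi). *)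
Let Phi (x xi : X) := cos (dotv x xi) * cosT u xi + sin (dotv x xi) * sinT u xi.

Let PhiE x xi : Phi x xi = \int[mu]_y (u y * cos (dotv (x - y) xi)).
Proof.
have ic := integrable_cos xi iu; have is_ := integrable_sin xi iu.
under eq_Rintegral do rewrite cos_diff mulrDr mulrCA (mulrCA (u _) (sin _)).
by rewrite RintegralD ?RintegralZl//; exact: integrableRZ.
Qed.

Let sqr_transform xi : cosT u xi ^+ 2 + sinT u xi ^+ 2 = \int[mu]_x (u x * Phi x xi).
Proof.
have ic := integrable_cos xi iu; have is_ := integrable_sin xi iu.
rewrite (_ : (fun x => _) = fun x => cosT u xi * (u x * cos (dotv x xi)) +
   sinT u xi * (u x * sin (dotv x xi))); last first.
  by apply/funext => x; rewrite /Phi; ring.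
by rewrite RintegralD ?RintegralZl// ?expr2//; exact: integrableRZ.
Qed.

Let measurable_Phi : measurable_fun setT (fun z : X * X => Phi z.2 z.1).
Proof.
have m21 : measurable_fun setT (fun z : X * X => dotv z.2 z.1).
  by under eq_fun do rewrite dotvC; exact: measurable_dotv2.
apply: measurable_funD; apply: measurable_funM.
- exact: (measurableT_comp mcos m21).
- exact: (measurableT_comp measurable_cosT (@measurable_fst _ _ _ _)).
- exact: (measurableT_comp msin m21).
- exact: (measurableT_comp measurable_sinT (@measurable_fst _ _ _ _)).
Qed.

Let Phi_le x xi : `|Phi x xi| <= M.
Proof.
rewrite PhiE; have mc : measurable_fun setT (fun y : X => cos (dotv (x - y) xi)).
  apply: (measurableT_comp mcos); apply: measurable_dotv => //.
  by apply: measurable_rVD => //; exact: measurable_rVN.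
have i1 : mu.-integrable setT (EFin \o (fun y => u y * cos (dotv (x - y) xi))).
  apply: (le_integrableR _ _ iu); first exact: measurable_funM.
  by move=> y; rewrite normrM ler_piMr ?cos_norm_le1.
apply: (le_trans (le_normr_Rintegral _ i1)) => //.
apply: le_Rintegral => //; [exact: integrable_norm i1|exact: integrable_norm iu|].
by move=> y _; rewrite normrM ler_piMr ?cos_norm_le1.
Qed.

(** The weight makes the triple integral in (x, y, xi) absolutely convergent. Two exchanges bring
    the integral over xi inside, where it is the transform of the weight at x - y. *)
Let abel_sqr_transform e : 0 < e ->
  \int[mu]_xi (abel_rV e xi * (cosT u xi ^+ 2 + sinT u xi ^+ 2)) =
  \int[mu]_x (u x * \int[mu]_y (u y * ((2 * pi) ^+ n * e ^- n *
     cauchy_rV (e^-1 *: (x - y))))).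
Proof.
move=> e0; have ia := integrable_abel_rV e0 n.
under eq_Rintegral do rewrite sqr_transform.
rewrite (fubini_bounded ia iu measurable_Phi (fun z => Phi_le z.2 z.1)).
apply: eq_Rintegral => x _; congr (_ * _).
under eq_Rintegral do rewrite PhiE/=.
have mk : measurable_fun setT (fun z : X * X => cos (dotv (x - z.2) z.1)).
  apply: (measurableT_comp mcos); apply: measurable_dotv => //.
  by apply: measurable_rVD => //; exact: measurable_rVN.
have := fubini_bounded ia iu mk (fun z => cos_norm_le1 _) => /= ->.
apply: eq_Rintegral => y _; congr (_ * _).
by rewrite -integral_abel_rV_cosE.
Qed.

Hypothesis Lu : L2r mu u.

Let tau (h : X) (x : X) := u (x + h).

Let tau_affine h : tau h = fun x => u (1 *: x + h).
Proof. by apply/funext => x; rewrite scale1r. Qed.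

Let rip_tau h : rip mu (tau h) (tau h) = rip mu u u.
Proof.
rewrite tau_affine /rip (Rintegral_affine h (oner_neq0 _) (f := fun x => u x * u x)).
  by rewrite normr1 expr1n invr1 mul1r.
exact: L2r_mul.
Qed.

Let L2r_tau h : L2r mu (tau h).
Proof.
rewrite tau_affine; split.
  by apply: (measurableT_comp mu_); exact: measurable_affine_rV.
exact: (integrableR_affine h (oner_neq0 _) Lu.2).
Qed.

(** The autocorrelation of u, whose value at 0 is the squared norm. The Abel-weighted integrals are
    Poisson averages of [C] at scale e, so Plancherel amounts to its continuity at 0, that is, to
    the continuity of translations. *)
Let C h := rip mu u (tau h).

Let C_le h : `|C h| <= rip mu u u.
Proof.
have h1 := rip_CS Lu (L2r_tau h); rewrite rip_tau -expr2 in h1.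
by rewrite -(ler_pXn2r (n := 2)) ?nnegrE ?rip_ge0// real_normK ?num_real.
Qed.

Lemma cauchy_rV_even (z : X) : cauchy_rV (- z) = cauchy_rV z.
Proof. by apply: eq_bigr => i _; rewrite mxE sqrrN. Qed.

Lemma cauchy_rV_le (z : X) : cauchy_rV z <= pi ^- n.
Proof.
apply: (@le_trans _ _ (\prod_(i < n) pi^-1)); last first.
  by rewrite prodr_const card_ord exprVn.
apply: ler_prod => i _.
rewrite mulr_ge0 ?invr_ge0 ?pi_ge0 ?addr_ge0 ?sqr_ge0//=.
by rewrite ler_piMr ?invr_ge0 ?pi_ge0// invf_le1 ?ltr_wpDr ?sqr_ge0// lerDl sqr_ge0.
Qed.

Lemma integrable_cauchy_rV : mu.-integrable setT (EFin \o @cauchy_rV R n).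
Proof.
apply: ge0_integrableR; first exact: measurable_cauchy_rV.
  by move=> z; exact/ltW/cauchy_rV_gt0.
by rewrite integral_cauchy_rV ltry.
Qed.

(** The joint integrand is controlled by integrating over x first: the integral of |u(x) u(x + h)|
    is at most the squared norm of u for every h, and the Cauchy density is integrable. Boundedness
    of that density makes the slices in z integrable at every x. *)
Let integral_C_fubini e : 0 < e ->
  [/\ measurable_fun setT (fun z : X => cauchy_rV z * C (e *: z)),
      mu.-integrable setT (EFin \o
        (fun x => u x * \int[mu]_z (cauchy_rV z * u (x + e *: z)))) &
      \int[mu]_x (u x * \int[mu]_z (cauchy_rV z * u (x + e *: z))) =
      \int[mu]_z (cauchy_rV z * C (e *: z))].
Proof.
move=> e0.
pose f (z : X * X) := cauchy_rV z.2 * (u z.1 * u (z.1 + e *: z.2)).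
have mf : measurable_fun setT f.
  rewrite /f; apply: measurable_funM.
    exact: (measurableT_comp (@measurable_cauchy_rV R n)).
  apply: measurable_funM; first exact: measurableT_comp.
  apply: (measurableT_comp mu_); apply: measurable_rVD => //.
  by apply: measurable_rVZ => //; exact: measurable_cst.
have iC h : mu.-integrable setT (EFin \o (fun x => u x * tau h x)).
  exact: L2r_mul.
have absC h : \int[mu]_x `|u x * tau h x| <= rip mu u u.
  have i1 : mu.-integrable setT (EFin \o (fun x => 2^-1 * (u x ^+ 2 + tau h x ^+ 2))).
    by apply: integrableRZ; apply: integrableRD; [exact: Lu.2|exact: (L2r_tau h).2].
  apply: (@le_trans _ _ (\int[mu]_x (2^-1 * (u x ^+ 2 + tau h x ^+ 2)))).
    apply: le_Rintegral => //; first exact: integrable_norm (iC h).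
    move=> x _; have := sqr_ge0 (u x - tau h x); have := sqr_ge0 (u x + tau h x).
    by rewrite ler_norml => ? ?; apply/andP; split; nra.
  rewrite RintegralZl//; last first.
    by apply: integrableRD; [exact: Lu.2|exact: (L2r_tau h).2].
  rewrite RintegralD//; [|exact: Lu.2|exact: (L2r_tau h).2].
  have <- : \int[mu]_x (u x ^+ 2) = rip mu u u by [].
  have -> : \int[mu]_x (tau h x ^+ 2) = rip mu u u by rewrite -(rip_tau h).
  by rewrite /rip; lra.
have ifz z : mu.-integrable setT (EFin \o (fun x => f (x, z))).
  exact: (integrableRZ (cauchy_rV z) (iC (e *: z))).
have i_f : (mu \x mu)%E.-integrable setT (EFin \o f).
  apply/integrable21ltyP; first exact/measurable_EFinP.
  apply: (@le_lt_trans _ _ (\int[mu]_z (rip mu u u * cauchy_rV z)%:E)%E); last first.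
    rewrite (@integral_EFin_Rintegral _ _ _ mu (fun z => rip mu u u * cauchy_rV z)) ?ltry//.
    exact: integrableRZ integrable_cauchy_rV.
  apply: ge0_le_integral => //.
  - by move=> z _; exact: integral_ge0.
  - apply: (measurable_fun_fubini_tonelli_G (fun z => `|f z|%:E)) => //.
    by apply/measurable_EFinP; exact: measurableT_comp.
  - apply/measurable_EFinP; apply: measurable_funM; first exact: measurable_cst.
    exact: measurable_cauchy_rV.
  move=> z _.
  rewrite (@integral_EFin_Rintegral _ _ _ mu (fun x => `|f (x, z)|)); last first.
    exact: integrable_norm (ifz z).
  rewrite lee_fin /f/=.
  under eq_Rintegral do rewrite normrM ger0_norm ?(ltW (cauchy_rV_gt0 z))//.
  rewrite RintegralZl//; last exact: integrable_norm (iC (e *: z)).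
  by rewrite mulrC; apply: ler_wpM2r; [exact/ltW/cauchy_rV_gt0|exact: absC].
have ifx x : mu.-integrable setT (EFin \o (fun z => cauchy_rV z * u (x + e *: z))).
  have en0 : e != 0 by rewrite gt_eqF.
  have i1 := integrableRZ (pi ^- n) (integrableR_affine x en0 iu).
  apply: (le_integrableR _ _ i1).
    apply: measurable_funM; first exact: measurable_cauchy_rV.
    apply: (measurableT_comp mu_); apply: measurable_rVD => //.
    by apply: measurable_rVZ => //; exact: measurable_cst.
  move=> z; rewrite !normrM addrC ler_wpM2r//.
  rewrite !ger0_norm ?cauchy_rV_le//; last exact/ltW/cauchy_rV_gt0.
  by rewrite invr_ge0 exprn_ge0 ?pi_ge0.
split.
  rewrite (_ : (fun z => _) = fun z => \int[mu]_x f (x, z)).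
    exact: measurable_Rintegral1 i_f.
  by apply/funext => z; rewrite /f/= RintegralZl//; exact: iC.
  have := integrable_fubini_F i_f; apply: eq_integrable => // x _.
  rewrite /fubini_F /f/= -(RintegralZl (u x) measurableT (ifx x)).
  under [in LHS]eq_integral do rewrite mulrCA.
  rewrite (@integral_EFin_Rintegral _ _ _ mu (fun z => u x * (cauchy_rV z * u (x + e *: z))))//.
  exact: integrableRZ.
transitivity (\int[mu]_x \int[mu]_z f (x, z)).
  apply: eq_Rintegral => x _; rewrite -(RintegralZl (u x) measurableT (ifx x)).
  by apply: eq_Rintegral => z _; rewrite /f/= mulrCA.
rewrite Rintegral_fubini//.
  by apply: eq_Rintegral => z _; rewrite /f/= RintegralZl//; exact: iC.
move=> x; rewrite /f/=; under [X in EFin \o X]eq_fun do rewrite mulrCA.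
exact: integrableRZ.
Qed.

(** The substitution y = x + e z absorbs the factor [e ^- n], and the kernel is even. *)
Let abel_sqr_transform_C e : 0 < e ->
  \int[mu]_xi (abel_rV e xi * (cosT u xi ^+ 2 + sinT u xi ^+ 2)) =
  (2 * pi) ^+ n * \int[mu]_z (cauchy_rV z * C (e *: z)).
Proof.
move=> e0; have en0 : e != 0 by rewrite gt_eqF.
have [_ iG <-] := integral_C_fubini e0.
rewrite abel_sqr_transform// -RintegralZl//.
apply: eq_Rintegral => x _; rewrite [RHS]mulrCA; congr (_ * _).
have ix : mu.-integrable setT (EFin \o (fun y => u y * cauchy_rV (e^-1 *: (x - y)))).
  apply: (le_integrableR _ _ (integrableRZ (pi ^- n) iu)).
    apply: measurable_funM => //; apply: (measurableT_comp (@measurable_cauchy_rV R n)).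
    apply: measurable_rVZ; first exact: measurable_cst.
    by apply: measurable_rVD => //; exact: measurable_rVN.
  move=> y; rewrite !normrM mulrC ler_wpM2r//.
  rewrite !ger0_norm ?cauchy_rV_le//; last exact/ltW/cauchy_rV_gt0.
  by rewrite invr_ge0 exprn_ge0 ?pi_ge0.
rewrite (_ : (fun y => _) = fun y =>
    (2 * pi) ^+ n * e ^- n * (u y * cauchy_rV (e^-1 *: (x - y)))); last first.
  by apply/funext => y; ring.
rewrite RintegralZl// -mulrA; congr (_ * _).
have := Rintegral_affine x en0 ix.
rewrite (gtr0_norm e0) => <-; apply: eq_Rintegral => z _.
rewrite (addrC _ x) opprD addrA subrr sub0r scalerN scalerA mulVf// scale1r cauchy_rV_even.
exact: mulrC.
Qed.

Let eps (k : nat) : R := k.+1%:R^-1.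

Let eps_gt0 k : 0 < eps k. Proof. by rewrite invr_gt0. Qed.

Let cvg_C : \int[mu]_z (cauchy_rV z * C (eps k *: z)) @[k --> \oo] --> rip mu u u.
Proof.
have c z : cauchy_rV z * C (eps k *: z) @[k --> \oo] --> cauchy_rV z * rip mu u u.
  apply: cvgM; first exact: cvg_cst.
  apply: cvg_rip => //.
  - rewrite (_ : (fun _ => _) = fun=> 0); first exact: cvg_cst.
    by apply/funext => k; rewrite ripBB//; lra.
  - pose phi k (x : X) := x + eps k *: z.
    apply: (@L2r_comp_cvg _ _ phi (fun=> 1)) => //.
    + move=> k; apply: measurable_rVD => //; exact: measurable_cst.
    + move=> x; rewrite -[X in _ --> X]addr0; apply: cvgD; first exact: cvg_cst.
      rewrite -(scale0r z); apply: cvgZr_tmp; exact: cvg_harmonic.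
    + exact: cvg_cst.
    + move=> k f mf f0.
      have := ge0_integral_affine (eps k *: z) (oner_neq0 R) mf f0.
      rewrite normr1 expr1n invr1 => <-.
      by apply: eq_integral => x _; rewrite scale1r.
have i1 := integrableRZ (rip mu u u) integrable_cauchy_rV.
have mC k : measurable_fun setT (fun z : X => cauchy_rV z * C (eps k *: z)).
  by case: (integral_C_fubini (eps_gt0 k)).
have [|_ _] := cvg_Rintegral_dominated mC c i1.
  move=> k z; rewrite normrM mulrC ler_pM//.
  by rewrite ger0_norm// ltW// cauchy_rV_gt0.
rewrite RintegralZr; [|by []|exact: integrable_cauchy_rV].
by rewrite {2}/Rintegral integral_cauchy_rV/= mul1r.
Qed.

(** The weights increase to 1 as e decreases to 0, so monotone convergence identifies the left side
    without knowing beforehand that the transforms are square integrable; [cvg_C] gives the same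
    limit as the squared norm. *)
Lemma plancherel_real :
  (\int[mu]_xi (cosT u xi ^+ 2 + sinT u xi ^+ 2)%:E = ((2 * pi) ^+ n * rip mu u u)%:E)%E.
Proof.
pose S xi := cosT u xi ^+ 2 + sinT u xi ^+ 2.
have S0 xi : 0 <= S xi by rewrite addr_ge0// sqr_ge0.
have mS : measurable_fun setT S.
  apply: measurable_funD; apply: measurable_funX.
    exact: measurable_cosT.
  exact: measurable_sinT.
have SM xi : `|S xi| <= 2 * M ^+ 2.
  have h1 := transform_le mcos cos_norm_le1 xi.
  have h2 := transform_le msin sin_norm_le1 xi.
  rewrite ger0_norm// /S mulr2n mulrDl mul1r lerD//.
    by rewrite -(real_normK (num_real (cosT u xi))) lerXn2r// nnegrE// (le_trans _ h1).
  by rewrite -(real_normK (num_real (sinT u xi))) lerXn2r// nnegrE// (le_trans _ h1).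
have iS k : mu.-integrable setT (EFin \o (fun xi => abel_rV (eps k) xi * S xi)).
  apply: (le_integrableR _ _ (integrableRZ (2 * M ^+ 2) (integrable_abel_rV (eps_gt0 k) n))).
    by apply: measurable_funM => //; exact: measurable_abel_rV.
  move=> xi; rewrite normrM mulrC [leRHS]normrM ler_wpM2r//.
  by rewrite (le_trans (SM xi))// ler_norm.
have c1 : (\int[mu]_xi (abel_rV (eps k) xi * S xi)%:E @[k --> \oo]
    --> \int[mu]_xi (S xi)%:E)%E.
  rewrite [X in _ --> X](_ : _ = (\int[mu]_xi (limn (fun k => (abel_rV (eps k) xi * S xi)%:E)))%E); last first.
    apply: eq_integral => xi _; apply/esym/cvg_lim => //.
    apply: cvg_EFin; first exact: nearW.
    rewrite -[X in _ --> X]mul1r; apply: cvgM; last exact: cvg_cst.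
    have -> : 1 = \prod_(i < n) 1 :> R by rewrite big1.
    apply: cvg_big => [|i _]; first exact: mul_continuous.
    rewrite /abel -expR0; apply: continuous_cvg; first exact: continuous_expR.
    rewrite -oppr0 -(mul0r `|xi ord0 i|); apply: cvgN; apply: cvgMr_tmp.
    exact: cvg_harmonic.
  apply: cvg_monotone_convergence => //.
  - by move=> k; exact: measurable_int (iS k).
  - by move=> k xi _; rewrite lee_fin mulr_ge0// ltW// abel_rV_gt0.
  - move=> xi _ k k' kk'; rewrite lee_fin ler_wpM2r//.
    apply: ler_prod => i _; rewrite (ltW (abel_gt0 _ _))/=.
    rewrite /abel ler_expR lerN2 ler_wpM2r// lef_pV2 ?posrE//.
    by rewrite ler_nat ltnS.
apply: cvg_unique c1 _ => //.
rewrite (_ : (fun k => _) = fun k => ((2 * pi) ^+ n * \int[mu]_z (cauchy_rV z * C (eps k *: z)))%:E).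
  apply: cvg_EFin; first exact: nearW.
  by apply: cvgM; [exact: cvg_cst|exact: cvg_C].
by apply/funext => k; rewrite integral_EFin_Rintegral// abel_sqr_transform_C.
Qed.

End transform.
End plancherel_real.

(** * Complex-valued square integrable functions *)

Section complex_components.
Context {R : rcfType}.
Implicit Types z w : R[i].
Local Open Scope complex_scope.

(** The real part of z times the conjugate of w. *)
Definition cdot z w : R :=
  complex.Re z * complex.Re w + complex.Im z * complex.Im w.

Lemma Re_add z w : complex.Re (z + w) = complex.Re z + complex.Re w.
Proof. by case: z; case: w. Qed.
Lemma Im_add z w : complex.Im (z + w) = complex.Im z + complex.Im w.
Proof. by case: z; case: w. Qed.
Lemma Re_opp z : complex.Re (- z) = - complex.Re z. Proof. by case: z. Qed.
Lemma Im_opp z : complex.Im (- z) = - complex.Im z. Proof. by case: z. Qed.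
Lemma Re_mul z w : complex.Re (z * w) =
  complex.Re z * complex.Re w - complex.Im z * complex.Im w.
Proof. by case: z; case: w. Qed.
Lemma Im_mul z w : complex.Im (z * w) =
  complex.Re z * complex.Im w + complex.Im z * complex.Re w.
Proof. by case: z => a b; case: w => c d /=; rewrite addrC [b * c]mulrC. Qed.

Definition ReIm := (Re_add, Im_add, Re_opp, Im_opp, Re_mul, Im_mul).

Lemma cdot_ge0 z : 0 <= cdot z z.
Proof. by rewrite /cdot addr_ge0// -expr2 sqr_ge0. Qed.

Lemma cdot_eq0 z : cdot z z = 0 -> z = 0.
Proof.
case: z => a b; rewrite /cdot/= -!expr2 => /eqP.
rewrite paddr_eq0 ?sqr_ge0// !sqrf_eq0 => /andP[/eqP-> /eqP->].
by [].
Qed.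

Lemma normc_sqr z : Normc.normc z ^+ 2 = cdot z z.
Proof. by case: z => a b; rewrite /= sqr_sqrtr ?addr_ge0 ?sqr_ge0// /cdot/= !expr2. Qed.

Lemma cdot_mul z w : cdot (z * w) (z * w) = cdot z z * cdot w w.
Proof. by rewrite /cdot !ReIm; ring. Qed.

End complex_components.

Section L2_complex.
Context {R : realType} {n : nat}.
Local Notation X := 'rV[R]_n.
Local Notation mu := (@lebesgue_rV R n).
Implicit Types f g h : X -> R[i].
Local Open Scope complex_scope.

Definition reF f (x : X) : R := complex.Re (f x).
Definition imF f (x : X) : R := complex.Im (f x).

Definition L2c f := L2r mu (reF f) /\ L2r mu (imF f).
Definition L1c f := mu.-integrable setT (EFin \o reF f) /\
                    mu.-integrable setT (EFin \o imF f).

(* The real part of the inner product: L^2 is used as a real Hilbert space throughout. *)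
Definition cip f g : R := \int[mu]_x cdot (f x) (g x).

Lemma cipE f g : L2c f -> L2c g ->
  cip f g = rip mu (reF f) (reF g) + rip mu (imF f) (imF g).
Proof. by move=> [f1 f2] [g1 g2]; rewrite /cip /cdot RintegralD//; exact: L2r_mul. Qed.

Lemma integrable_cdot f g : L2c f -> L2c g ->
  mu.-integrable setT (EFin \o (fun x => cdot (f x) (g x))).
Proof. by move=> [f1 f2] [g1 g2]; apply: integrableRD; exact: L2r_mul. Qed.

Lemma L2c_measurable f : L2c f -> cmeasurable f.
Proof. by move=> [[m1 _] [m2 _]]. Qed.

Lemma L2cP f : L2c f <-> cmeasurable f /\ (\int[mu]_x (cdot (f x) (f x))%:E < +oo)%E.
Proof.
split=> [Lf|[[m1 m2] foo]].
  split; first exact: L2c_measurable.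
  by rewrite (integral_EFin_Rintegral (integrable_cdot Lf Lf)) ltry.
have mf : measurable_fun setT (fun x => cdot (f x) (f x)).
  by apply: measurable_funD; exact: measurable_funM.
have i1 := ge0_integrableR mf (fun x => cdot_ge0 _) foo.
split; split => //; (apply: (le_integrableR _ _ i1); first exact: measurable_funX) => x;
  rewrite !ger0_norm ?sqr_ge0 ?cdot_ge0// /cdot -!expr2.
  by rewrite lerDl sqr_ge0.
by rewrite lerDr sqr_ge0.
Qed.

Lemma cLnorm2E f : L2c f -> cLnorm 2%:E f = (Num.sqrt (cip f f))%:E.
Proof.
move=> Lf; rewrite /cLnorm unlock/=.
under eq_integral do rewrite powR_mulrn// real_normK ?num_real// normc_sqr.
rewrite (integral_EFin_Rintegral (integrable_cdot Lf Lf)).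
by rewrite poweR_EFin powR12_sqrt// Rintegral_ge0// => x _; exact: cdot_ge0.
Qed.

Lemma Lp2P f : Lp 2%:E f <-> L2c f.
Proof.
split=> [[mf foo]|Lf]; last by split; [exact: L2c_measurable|rewrite cLnorm2E ?ltry].
apply/L2cP; split => //; move: foo; rewrite /cLnorm unlock/=.
under eq_integral do rewrite powR_mulrn// real_normK ?num_real// normc_sqr.
have I0 : (0 <= \int[mu]_x (cdot (f x) (f x))%:E)%E.
  by apply: integral_ge0 => x _; rewrite lee_fin cdot_ge0.
move: I0; case: (integral _ _ _) => [r _ _||]; rewrite ?ltry//.
by rewrite poweRyr ?ltxx// invr_eq0.
Qed.

Lemma normc_ge0 (z : R[i]) : 0 <= Normc.normc z.
Proof. by case: z => a b; exact: sqrtr_ge0. Qed.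

Lemma normc_ge_Re (z : R[i]) : `|complex.Re z| <= Normc.normc z.
Proof.
by case: z => a b /=; rewrite -sqrtr_sqr ler_wsqrtr// lerDl sqr_ge0.
Qed.

Lemma normc_ge_Im (z : R[i]) : `|complex.Im z| <= Normc.normc z.
Proof.
by case: z => a b /=; rewrite -sqrtr_sqr ler_wsqrtr// lerDr sqr_ge0.
Qed.

Lemma normc_le_ReIm (z : R[i]) :
  Normc.normc z <= `|complex.Re z| + `|complex.Im z|.
Proof.
rewrite -(ler_pXn2r (n := 2)) ?nnegrE ?normc_ge0 ?addr_ge0//.
rewrite normc_sqr /cdot -!expr2 sqrrD !real_normK ?num_real//.
by rewrite -addrA lerD2l lerDr mulrn_wge0// mulr_ge0.
Qed.

Lemma measurable_normc f : cmeasurable f ->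
  measurable_fun setT (fun x => Normc.normc (f x)).
Proof.
move=> [m1 m2]; rewrite (_ : (fun _ => _) = fun x => Num.sqrt (cdot (f x) (f x))).
  apply: (measurableT_comp (f := @Num.sqrt R)).
    by apply: continuous_measurable_fun; exact: sqrt_continuous.
  by apply: measurable_funD; exact: measurable_funM.
apply/funext => x; rewrite -normc_sqr sqrtr_sqr ger0_norm//.
exact: normc_ge0.
Qed.

Lemma Lp1P f : Lp 1 f <-> L1c f.
Proof.
split=> [[mf foo]|[f1 f2]].
  have mn := measurable_normc mf.
  move: foo; rewrite /cLnorm Lnorm1 => foo.
  have i1 : mu.-integrable setT (EFin \o (fun x => Normc.normc (f x))).
    apply: ge0_integrableR => //; first by move=> x; exact: normc_ge0.
    by apply: le_lt_trans foo; apply: ge0_le_integral => //=;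
       [by move=> x _; rewrite lee_fin normc_ge0|exact/measurable_EFinP|
        by apply/measurable_EFinP; exact: measurableT_comp|
        by move=> x _; rewrite lee_fin ler_norm].
  split; apply: (le_integrableR _ _ i1); try exact: mf.1; try exact: mf.2.
    by move=> x; rewrite (le_trans (normc_ge_Re _))// ler_norm.
  by move=> x; rewrite (le_trans (normc_ge_Im _))// ler_norm.
have mf : cmeasurable f.
  by split; [exact: integrableR_measurable f1|exact: integrableR_measurable f2].
split=> //; rewrite /cLnorm Lnorm1.
have i1 := integrableRD (integrable_norm f1) (integrable_norm f2).
have /integrableP[_] : mu.-integrable setT (EFin \o (fun x => Normc.normc (f x))).
  apply: (le_integrableR _ _ i1); first exact: measurable_normc.
  move=> x /=; rewrite ger0_norm ?normc_ge0// (le_trans (normc_le_ReIm _))//.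
  exact: ler_norm.
by [].
Qed.

Lemma L2cD f g : L2c f -> L2c g -> L2c (fun x => f x + g x).
Proof.
move=> [f1 f2] [g1 g2]; split; rewrite /reF /imF.
  by under [X in L2r _ X]eq_fun do rewrite ReIm; exact: L2rD.
by under [X in L2r _ X]eq_fun do rewrite ReIm; exact: L2rD.
Qed.

Lemma L2c_bounded (m : X -> R[i]) M f : cmeasurable m ->
  (forall x, `|complex.Re (m x)| <= M) -> (forall x, `|complex.Im (m x)| <= M) ->
  L2c f -> L2c (fun x => m x * f x).
Proof.
move=> [m1 m2] M1 M2 [f1 f2]; split; rewrite /reF /imF.
  under [X in L2r _ X]eq_fun do rewrite ReIm.
  by apply: L2rB; apply: (@L2r_bounded _ _ _ _ _ M).
under [X in L2r _ X]eq_fun do rewrite ReIm.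
by apply: L2rD; apply: (@L2r_bounded _ _ _ _ _ M).
Qed.

Lemma L2cZ c f : L2c f -> L2c (fun x => c * f x).
Proof.
apply: (@L2c_bounded (fun=> c) (Normc.normc c)); first by split; exact: measurable_cst.
  by move=> _; exact: normc_ge_Re.
by move=> _; exact: normc_ge_Im.
Qed.

Lemma L2cB f g : L2c f -> L2c g -> L2c (fun x => f x - g x).
Proof.
move=> f1 /(L2cZ (-1)) g1; have := L2cD f1 g1.
by under [X in L2c X]eq_fun do rewrite mulN1r.
Qed.

Lemma cipC f g : cip f g = cip g f.
Proof. by apply: eq_Rintegral => x _; rewrite /cdot; congr (_ + _); exact: mulrC. Qed.

Lemma cip_ge0 f : 0 <= cip f f.
Proof. by apply: Rintegral_ge0 => x _; exact: cdot_ge0. Qed.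

Lemma cipDl f g h : L2c f -> L2c g -> L2c h ->
  cip (fun x => f x + g x) h = cip f h + cip g h.
Proof.
move=> f1 g1 h1; rewrite /cip -RintegralD//; try exact: integrable_cdot.
by apply: eq_Rintegral => x _; rewrite /cdot !ReIm; ring.
Qed.

Lemma cipBl f g h : L2c f -> L2c g -> L2c h ->
  cip (fun x => f x - g x) h = cip f h - cip g h.
Proof.
move=> f1 g1 h1; rewrite /cip -RintegralB//; try exact: integrable_cdot.
by apply: eq_Rintegral => x _; rewrite /cdot !ReIm; ring.
Qed.

Lemma cipZl (a : R) f g : L2c f -> L2c g -> cip (fun x => a%:C * f x) g = a * cip f g.
Proof.
move=> f1 g1; rewrite /cip -RintegralZl//; last exact: integrable_cdot.
by apply: eq_Rintegral => x _; rewrite /cdot !ReIm/=; ring.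
Qed.

Lemma cipDr f g h : L2c f -> L2c g -> L2c h ->
  cip h (fun x => f x + g x) = cip h f + cip h g.
Proof. by move=> *; rewrite cipC cipDl// !(cipC h). Qed.

Lemma cipBr f g h : L2c f -> L2c g -> L2c h ->
  cip h (fun x => f x - g x) = cip h f - cip h g.
Proof. by move=> *; rewrite cipC cipBl// !(cipC h). Qed.

Lemma cipZr (a : R) f g : L2c f -> L2c g -> cip g (fun x => a%:C * f x) = a * cip g f.
Proof. by move=> *; rewrite cipC cipZl// (cipC g). Qed.

Lemma cipBB f g : L2c f -> L2c g ->
  cip (fun x => f x - g x) (fun x => f x - g x) =
  cip f f - 2 * cip f g + cip g g.
Proof.
move=> Lf Lg; rewrite cipBl ?cipBr//; last exact: L2cB.
by rewrite (cipC g f); ring.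
Qed.

Lemma cipDD f g : L2c f -> L2c g ->
  cip (fun x => f x + g x) (fun x => f x + g x) =
  cip f f + 2 * cip f g + cip g g.
Proof.
move=> Lf Lg; rewrite cipDl ?cipDr//; last exact: L2cD.
by rewrite (cipC g f); ring.
Qed.

Lemma cipD_le f g : L2c f -> L2c g ->
  cip (fun x => f x + g x) (fun x => f x + g x) <= 2 * cip f f + 2 * cip g g.
Proof.
move=> Lf Lg; rewrite cipDD//.
by have := cip_ge0 (fun x => f x - g x); rewrite cipBB//; lra.
Qed.

Lemma cvg_cip (u v : nat -> X -> R[i]) f g :
  (forall k, L2c (u k)) -> (forall k, L2c (v k)) -> L2c f -> L2c g ->
  cip (fun x => u k x - f x) (fun x => u k x - f x) @[k --> \oo] --> 0 ->
  cip (fun x => v k x - g x) (fun x => v k x - g x) @[k --> \oo] --> 0 ->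
  cip (u k) (v k) @[k --> \oo] --> cip f g.
Proof.
move=> Lu Lv Lf Lg cu cv; rewrite cipE//.
under eq_fun do rewrite cipE//.
have comp (w : nat -> X -> R[i]) (h : X -> R[i]) : (forall k, L2c (w k)) -> L2c h ->
  cip (fun x => w k x - h x) (fun x => w k x - h x) @[k --> \oo] --> 0 ->
  rip mu (fun x => reF (w k) x - reF h x) (fun x => reF (w k) x - reF h x) @[k --> \oo] --> 0 /\
  rip mu (fun x => imF (w k) x - imF h x) (fun x => imF (w k) x - imF h x) @[k --> \oo] --> 0.
  move=> Lw Lh ch.
  have E k : cip (fun x => w k x - h x) (fun x => w k x - h x) =
    rip mu (fun x => reF (w k) x - reF h x) (fun x => reF (w k) x - reF h x) +
    rip mu (fun x => imF (w k) x - imF h x) (fun x => imF (w k) x - imF h x).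
    rewrite cipE; [|exact: L2cB|exact: L2cB].
    rewrite (_ : reF _ = fun x => reF (w k) x - reF h x); last first.
      by apply/funext => x; rewrite /reF !ReIm.
    rewrite (_ : imF _ = fun x => imF (w k) x - imF h x)//.
    by apply/funext => x; rewrite /imF !ReIm.
  split; apply: (squeeze_cvgr _ (cvg_cst 0) ch); apply: nearW => k; rewrite E rip_ge0/=.
    by rewrite lerDl rip_ge0.
  by rewrite lerDr rip_ge0.
have [c1 c2] := comp _ _ Lu Lf cu; have [c3 c4] := comp _ _ Lv Lg cv.
by apply: cvgD; apply: cvg_rip; by [|case: Lf|case: Lg|move=> k; case: (Lu k)|move=> k; case: (Lv k)].
Qed.

Lemma cvg_cLnorm2 (u : nat -> X -> R[i]) : (forall k, L2c (u k)) ->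
  (cLnorm 2%:E (u k) @[k --> \oo] --> 0%E) <-> (cip (u k) (u k) @[k --> \oo] --> 0).
Proof.
move=> Lu; under eq_fun do rewrite cLnorm2E//.
split=> [/fine_cvgP[_ c]|c].
  rewrite (_ : (fun _ => _) = fun k => Num.sqrt (cip (u k) (u k)) * Num.sqrt (cip (u k) (u k))).
    by rewrite -[X in _ --> X](mulr0 0); exact: cvgM.
  by apply/funext => k; rewrite -expr2 sqr_sqrtr// cip_ge0.
apply: cvg_EFin; first exact: nearW.
by rewrite -[X in _ --> X]sqrtr0; exact: (continuous_cvg _ (@sqrt_continuous R 0)).
Qed.

End L2_complex.

(** * The Fourier integral of integrable functions *)

Section fourier.
Context {R : realType} {n : nat}.
Local Notation X := 'rV[R]_n.
Local Notation mu := (@lebesgue_rV R n).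
Implicit Types f g h u : X -> R[i].
Local Open Scope complex_scope.

Let kappa : R := (2 * pi) `^ (- (n%:R / 2)).

Let pi2_gt0 : 0 < 2 * pi :> R. Proof. by rewrite mulr_gt0 ?pi_gt0. Qed.

Let kappa_sqr : kappa ^+ 2 * (2 * pi) ^+ n = 1.
Proof.
rewrite -powR_mulrn ?powR_ge0// -powRrM mulNr divfK// -[X in _ * X]powR_mulrn ?ltW//.
by rewrite -powRD ?addNr ?powRr0// (gt_eqF pi2_gt0) implybT.
Qed.

Lemma Re_fourier1 u xi : L1c u ->
  complex.Re (fourier1 u xi) = kappa * (cosT (reF u) xi + sinT (imF u) xi).
Proof.
move=> [u1 u2]; rewrite /fourier1 -/kappa Re_mul/= mul0r subr0; congr (_ * _).
rewrite /cosT /sinT -RintegralD//; [|exact: integrable_cos|exact: integrable_sin].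
apply: eq_Rintegral => x _; rewrite /reF /imF !ReIm/= cosN sinN.
by case: (u x) => a b /=; ring.
Qed.

Lemma Im_fourier1 u xi : L1c u ->
  complex.Im (fourier1 u xi) = kappa * (cosT (imF u) xi - sinT (reF u) xi).
Proof.
move=> [u1 u2]; rewrite /fourier1 -/kappa Im_mul/= mul0r addr0; congr (_ * _).
rewrite /cosT /sinT -RintegralB//; [|exact: integrable_cos|exact: integrable_sin].
apply: eq_Rintegral => x _; rewrite /reF /imF !ReIm/= cosN sinN.
by case: (u x) => a b /=; ring.
Qed.

Lemma cmeasurable_fourier1 u : L1c u -> cmeasurable (fourier1 u).
Proof.
move=> u1; split.
  under eq_fun do rewrite Re_fourier1//.
  apply: measurable_funM => //; apply: measurable_funD.
    by apply: measurable_cosT; case: u1.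
  by apply: measurable_sinT; case: u1.
under eq_fun do rewrite Im_fourier1//.
apply: measurable_funM => //; apply: measurable_funB.
  by apply: measurable_cosT; case: u1.
by apply: measurable_sinT; case: u1.
Qed.

Lemma cosTN (v : X -> R) xi : cosT v (- xi) = cosT v xi.
Proof. by apply: eq_Rintegral => x _; rewrite dotvC dotvNl cosN dotvC. Qed.

Lemma sinTN (v : X -> R) xi : mu.-integrable setT (EFin \o v) ->
  sinT v (- xi) = - sinT v xi.
Proof.
move=> v1; rewrite -mulN1r -RintegralZl//; last exact: integrable_sin.
by apply: eq_Rintegral => x _; rewrite dotvC dotvNl sinN dotvC mulrN mulN1r.
Qed.

(* Adding the values at [xi] and [- xi] removes the cross terms between the real and
   imaginary parts. *)
Lemma plancherel_fourier1 u : L1c u -> L2c u ->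
  L2c (fourier1 u) /\ cip (fourier1 u) (fourier1 u) = cip u u.
Proof.
move=> u1 u2; have [a1 b1] := u1; have [a2 b2] := u2.
have mF := cmeasurable_fourier1 u1.
(* Introduced through an existential so that [P] stays opaque. *)
have [P PE] : {P : X -> R | forall xi, P xi = cdot (fourier1 u xi) (fourier1 u xi)}.
  by exists (fun xi => cdot (fourier1 u xi) (fourier1 u xi)).
have P0 xi : 0 <= P xi by rewrite PE cdot_ge0.
have mP : measurable_fun setT P.
  rewrite (_ : P = fun xi => cdot (fourier1 u xi) (fourier1 u xi)); last exact/funext.
  by case: mF => m1 m2; apply: measurable_funD; exact: measurable_funM.
have PN : (\int[mu]_xi (P (- xi))%:E = \int[mu]_xi (P xi)%:E)%E.
  have N10 : -1 != 0 :> R by rewrite oppr_eq0 oner_eq0.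
  transitivity (\int[mu]_xi (P (-1 *: xi + 0))%:E)%E.
    by apply: eq_integral => xi _; rewrite scaleN1r addr0.
  rewrite (ge0_integral_affine (0 : X) N10 (f := fun xi => (P xi)%:E)); last 2 first.
  - exact/measurable_EFinP.
  - by move=> xi; rewrite lee_fin.
  by rewrite normrN normr1 expr1n invr1 mul1e.
have mPN : measurable_fun setT (fun xi : X => P (- xi)).
  by apply: (measurableT_comp mP); exact: measurable_rVN.
have mS (v : X -> R) : mu.-integrable setT (EFin \o v) ->
    measurable_fun setT (fun xi => cosT v xi ^+ 2 + sinT v xi ^+ 2).
  move=> v1; apply: measurable_funD; apply: measurable_funX.
    exact: measurable_cosT.
  exact: measurable_sinT.
have E xi : P xi + P (- xi) = 2 * kappa ^+ 2 *
   ((cosT (reF u) xi ^+ 2 + sinT (reF u) xi ^+ 2) +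
    (cosT (imF u) xi ^+ 2 + sinT (imF u) xi ^+ 2)).
  rewrite !PE /cdot (Re_fourier1 xi u1) (Im_fourier1 xi u1).
  rewrite (Re_fourier1 (- xi) u1) (Im_fourier1 (- xi) u1).
  rewrite (cosTN (reF u) xi) (cosTN (imF u) xi) (sinTN xi a1) (sinTN xi b1).
  move: kappa (cosT _ _) (cosT _ _) (sinT _ _) (sinT _ _) => k c1 c2 s1 s2.
  ring.
have I2 : (\int[mu]_xi (P xi)%:E + \int[mu]_xi (P xi)%:E = (2 * cip u u)%:E)%E.
  transitivity (\int[mu]_xi (P xi)%:E + \int[mu]_xi (P (- xi))%:E)%E; first by rewrite PN.
  transitivity (\int[mu]_xi ((P xi)%:E + (P (- xi))%:E))%E.
    rewrite (ge0_integralD mu measurableT (f1 := fun xi => (P xi)%:E)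
      (f2 := fun xi => (P (- xi))%:E)) => [//|||| ].
    - by move=> xi _; rewrite lee_fin.
    - exact/measurable_EFinP.
    - by move=> xi _; rewrite lee_fin.
    - exact/measurable_EFinP.
  have [S1 S1E] : {S : X -> R | forall xi, S xi = cosT (reF u) xi ^+ 2 + sinT (reF u) xi ^+ 2}.
    by exists (fun xi => cosT (reF u) xi ^+ 2 + sinT (reF u) xi ^+ 2).
  have [S2 S2E] : {S : X -> R | forall xi, S xi = cosT (imF u) xi ^+ 2 + sinT (imF u) xi ^+ 2}.
    by exists (fun xi => cosT (imF u) xi ^+ 2 + sinT (imF u) xi ^+ 2).
  have S10 xi : 0 <= S1 xi by rewrite S1E addr_ge0// sqr_ge0.
  have S20 xi : 0 <= S2 xi by rewrite S2E addr_ge0// sqr_ge0.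
  have mS1 : measurable_fun setT (EFin \o S1).
    by apply/measurable_EFinP; rewrite (funext S1E); exact: mS.
  have mS2 : measurable_fun setT (EFin \o S2).
    by apply/measurable_EFinP; rewrite (funext S2E); exact: mS.
  have I1 : (\int[mu]_xi (S1 xi)%:E = ((2 * pi) ^+ n * rip mu (reF u) (reF u))%:E)%E.
    by rewrite -(plancherel_real a1 a2); under eq_integral do rewrite S1E.
  have I2 : (\int[mu]_xi (S2 xi)%:E = ((2 * pi) ^+ n * rip mu (imF u) (imF u))%:E)%E.
    by rewrite -(plancherel_real b1 b2); under eq_integral do rewrite S2E.
  transitivity (\int[mu]_xi ((2 * kappa ^+ 2)%:E * ((S1 xi)%:E + (S2 xi)%:E)))%E.
    by apply: eq_integral => xi _; rewrite -EFinD E -S1E -S2E.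
  have k0 : 0 <= 2 * kappa ^+ 2 by rewrite mulr_ge0// sqr_ge0.
  rewrite (ge0_integralZl_EFin mu (f1 := fun xi => ((S1 xi)%:E + (S2 xi)%:E)%E) measurableT _ _ k0); last 2 first.
  - by move=> xi _; rewrite -EFinD lee_fin addr_ge0.
  - exact: emeasurable_funD.
  rewrite (ge0_integralD mu measurableT (f1 := EFin \o S1) (f2 := EFin \o S2)); last 4 first.
  - by move=> xi _; rewrite lee_fin.
  - exact: mS1.
  - by move=> xi _; rewrite lee_fin.
  - exact: mS2.
  rewrite /= I1 I2 -EFinD -EFinM cipE//.
  congr EFin; rewrite -mulrDr mulrA -(mulrA 2) kappa_sqr mulr1.
  by [].
have I1 : (\int[mu]_xi (P xi)%:E = (cip u u)%:E)%E.
  have I0 : (0 <= \int[mu]_xi (P xi)%:E)%E by apply: integral_ge0 => xi _; rewrite lee_fin.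
  (* The sum of the integral with itself is finite by [I2], so the integral is finite and can be
     halved. *)
  move: I2 I0; case: (integral _ _ _) => // r [h] _; congr EFin; lra.
have LF : L2c (fourier1 u).
  by apply/L2cP; split => //; under eq_integral do rewrite -PE; rewrite I1 ltry.
split => //; apply: EFin_inj; rewrite -I1.
rewrite -(integral_EFin_Rintegral (integrable_cdot LF LF)).
by apply: eq_integral => xi _; rewrite PE.
Qed.

Lemma L1cD f g : L1c f -> L1c g -> L1c (fun x => f x + g x).
Proof.
move=> [f1 f2] [g1 g2]; split; rewrite /reF /imF.
  by under [X in EFin \o X]eq_fun do rewrite ReIm; exact: integrableRD.
by under [X in EFin \o X]eq_fun do rewrite ReIm; exact: integrableRD.
Qed.

Lemma L1cZ c f : L1c f -> L1c (fun x => c * f x).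
Proof.
move=> [f1 f2]; split; rewrite /reF /imF.
  by under [X in EFin \o X]eq_fun do rewrite ReIm; apply: integrableRB; exact: integrableRZ.
by under [X in EFin \o X]eq_fun do rewrite ReIm; apply: integrableRD; exact: integrableRZ.
Qed.

Lemma ReIm_inj (z w : R[i]) : complex.Re z = complex.Re w -> complex.Im z = complex.Im w -> z = w.
Proof. by case: z => a b; case: w => c d /= -> ->. Qed.

Lemma cosT_lin (a b : R) (v w : X -> R) xi : mu.-integrable setT (EFin \o v) ->
  mu.-integrable setT (EFin \o w) ->
  cosT (fun x => a * v x + b * w x) xi = a * cosT v xi + b * cosT w xi.
Proof.
move=> v1 w1; have cv := integrable_cos xi v1; have cw := integrable_cos xi w1.
rewrite /cosT -!RintegralZl// -RintegralD//; try exact: integrableRZ.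
by apply: eq_Rintegral => x _; ring.
Qed.

Lemma sinT_lin (a b : R) (v w : X -> R) xi : mu.-integrable setT (EFin \o v) ->
  mu.-integrable setT (EFin \o w) ->
  sinT (fun x => a * v x + b * w x) xi = a * sinT v xi + b * sinT w xi.
Proof.
move=> v1 w1; have cv := integrable_sin xi v1; have cw := integrable_sin xi w1.
rewrite /sinT -!RintegralZl// -RintegralD//; try exact: integrableRZ.
by apply: eq_Rintegral => x _; ring.
Qed.

Lemma fourier1D f g xi : L1c f -> L1c g ->
  fourier1 (fun x => f x + g x) xi = fourier1 f xi + fourier1 g xi.
Proof.
move=> f1 g1; have fg := L1cD f1 g1.
have Er : reF (fun x => f x + g x) = fun x => 1 * reF f x + 1 * reF g x.
  by apply/funext => x; rewrite /reF !ReIm !mul1r.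
have Ei : imF (fun x => f x + g x) = fun x => 1 * imF f x + 1 * imF g x.
  by apply/funext => x; rewrite /imF !ReIm !mul1r.
case: (f1) (g1) => f11 f12 [g11 g12].
apply: ReIm_inj.
  by rewrite [RHS]Re_add !Re_fourier1// Er Ei cosT_lin// sinT_lin//; ring.
by rewrite [RHS]Im_add !Im_fourier1// Er Ei cosT_lin// sinT_lin//; ring.
Qed.

Lemma fourier1Z c f xi : L1c f ->
  fourier1 (fun x => c * f x) xi = c * fourier1 f xi.
Proof.
move=> f1; have cf := L1cZ c f1.
have Er : reF (fun x => c * f x) =
    fun x => complex.Re c * reF f x + (- complex.Im c) * imF f x.
  by apply/funext => x; rewrite /reF !ReIm mulNr.
have Ei : imF (fun x => c * f x) =
    fun x => complex.Re c * imF f x + complex.Im c * reF f x.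
  by apply/funext => x; rewrite /imF !ReIm.
case: (f1) => f11 f12; apply: ReIm_inj.
  rewrite [RHS]Re_mul !Re_fourier1// !Im_fourier1// Er Ei cosT_lin// sinT_lin//.
  ring.
rewrite [RHS]Im_mul !Re_fourier1// !Im_fourier1// Er Ei cosT_lin// sinT_lin//.
ring.
Qed.

End fourier.

(** * Fourier transforms of dilates and translates *)

Section fourier_affine.
Context {R : realType} {n : nat}.
Local Notation X := 'rV[R]_n.
Local Notation mu := (@lebesgue_rV R n).
Implicit Types f g : X -> R[i].
Local Open Scope complex_scope.
Variables (a : R) (h : X).
Hypothesis a_gt0 : 0 < a.

Let a0 : a != 0. Proof. by rewrite gt_eqF. Qed.

Lemma L1c_affine f : L1c f -> L1c (fun x => f (a *: x + h)).
Proof. by move=> [f1 f2]; split; [exact: integrableR_affine f1|exact: integrableR_affine f2]. Qed.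

Lemma L2r_affine (u : X -> R) : L2r mu u -> L2r mu (fun x => u (a *: x + h)).
Proof.
move=> [mu_ u2]; split; last exact: integrableR_affine u2.
by apply: (measurableT_comp mu_); exact: measurable_affine_rV.
Qed.

Lemma L2c_affine f : L2c f -> L2c (fun x => f (a *: x + h)).
Proof. by move=> [f1 f2]; split; [exact: L2r_affine f1|exact: L2r_affine f2]. Qed.

Lemma cip_affine f g : L2c f -> L2c g ->
  cip (fun x => f (a *: x + h)) (fun x => g (a *: x + h)) = a ^- n * cip f g.
Proof.
move=> f2 g2; rewrite /cip (Rintegral_affine h a0 (integrable_cdot f2 g2)).
by rewrite gtr0_norm.
Qed.

Let dotv_affine x (xi : X) : dotv x xi =
  dotv (a *: x + h) (a^-1 *: xi) - dotv h (a^-1 *: xi).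
Proof.
rewrite dotvDl addrK dotvZl (dotvC x (_ *: _)) dotvZl (dotvC xi).
by rewrite mulrA divff// mul1r.
Qed.

Let integral_lin (b c : R) (v w : X -> R) : mu.-integrable setT (EFin \o v) ->
  mu.-integrable setT (EFin \o w) ->
  \int[mu]_x (b * v x + c * w x) = b * \int[mu]_x v x + c * \int[mu]_x w x.
Proof.
by move=> v1 w1; rewrite RintegralD ?RintegralZl//; exact: integrableRZ.
Qed.

Lemma cosT_affine (u : X -> R) xi : mu.-integrable setT (EFin \o u) ->
  cosT (fun x => u (a *: x + h)) xi = a ^- n *
    (cos (dotv h (a^-1 *: xi)) * cosT u (a^-1 *: xi) +
     sin (dotv h (a^-1 *: xi)) * sinT u (a^-1 *: xi)).
Proof.
move=> u1; set eta := a^-1 *: xi.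
have c1 := integrable_cos eta u1; have s1 := integrable_sin eta u1.
pose F x := cos (dotv h eta) * (u x * cos (dotv x eta)) +
  sin (dotv h eta) * (u x * sin (dotv x eta)).
have iF : mu.-integrable setT (EFin \o F) by apply: integrableRD; exact: integrableRZ.
transitivity (\int[mu]_x F (a *: x + h)).
  by apply: eq_Rintegral => x _; rewrite dotv_affine cosB /F; ring.
by rewrite (Rintegral_affine h a0 iF) gtr0_norm// /F (integral_lin _ _ c1 s1).
Qed.

Lemma sinT_affine (u : X -> R) xi : mu.-integrable setT (EFin \o u) ->
  sinT (fun x => u (a *: x + h)) xi = a ^- n *
    (cos (dotv h (a^-1 *: xi)) * sinT u (a^-1 *: xi) +
     (- sin (dotv h (a^-1 *: xi))) * cosT u (a^-1 *: xi)).
Proof.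
move=> u1; set eta := a^-1 *: xi.
have c1 := integrable_cos eta u1; have s1 := integrable_sin eta u1.
pose F x := cos (dotv h eta) * (u x * sin (dotv x eta)) +
  (- sin (dotv h eta)) * (u x * cos (dotv x eta)).
have iF : mu.-integrable setT (EFin \o F) by apply: integrableRD; exact: integrableRZ.
transitivity (\int[mu]_x F (a *: x + h)).
  by apply: eq_Rintegral => x _; rewrite dotv_affine sinB /F; ring.
by rewrite (Rintegral_affine h a0 iF) gtr0_norm// /F (integral_lin _ _ s1 c1).
Qed.

(** The Jacobian of the dilation times the phase of the translation. With h = 0 it serves the virial
    inequality, with a = 1 the equicontinuity under translations. *)
Definition affine_multiplier (xi : X) : R[i] :=
  (a ^- n)%:C * expi (dotv h (a^-1 *: xi)).

Lemma fourier1_affine f xi : L1c f ->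
  fourier1 (fun x => f (a *: x + h)) xi =
  affine_multiplier xi * fourier1 f (a^-1 *: xi).
Proof.
move=> f1; have fa := L1c_affine f1; case: (f1) => fr fi; apply: ReIm_inj.
  rewrite Re_fourier1// Re_mul Re_fourier1// Im_fourier1// !ReIm/=.
  by rewrite (cosT_affine _ fr) (sinT_affine _ fi); ring.
rewrite Im_fourier1// Im_mul Re_fourier1// Im_fourier1// !ReIm/=.
by rewrite (cosT_affine _ fi) (sinT_affine _ fr); ring.
Qed.

Lemma cdot_expi t : cdot (expi t : R[i]) (expi t) = 1.
Proof. by rewrite /cdot/= -!expr2 cos2Dsin2. Qed.

Lemma cdot_affine_multiplier xi :
  cdot (affine_multiplier xi) (affine_multiplier xi) = a ^- n * a ^- n.
Proof. by rewrite cdot_mul cdot_expi mulr1 /cdot/= mul0r addr0. Qed.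

Lemma cmeasurable_affine_multiplier : cmeasurable affine_multiplier.
Proof.
have m : measurable_fun setT (fun xi : X => dotv h (a^-1 *: xi)).
  by apply: measurable_dotv; [exact: measurable_cst|exact: measurable_rVZ].
split.
  under eq_fun do rewrite ReIm/= mul0r subr0.
  apply: measurable_funM => //.
  by apply: measurableT_comp m; apply: continuous_measurable_fun; exact: continuous_cos.
under eq_fun do rewrite ReIm/= mul0r addr0.
apply: measurable_funM => //.
by apply: measurableT_comp m; apply: continuous_measurable_fun; exact: continuous_sin.
Qed.

End fourier_affine.

(** * The Fourier-Plancherel relation *)

Section is_fourier_theory.
Context {R : realType} {n : nat}.
Local Notation X := 'rV[R]_n.
Local Notation mu := (@lebesgue_rV R n).
Implicit Types f g : X -> R[i].
Local Open Scope complex_scope.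

Local Notation nrm f := (cip f f).

Lemma is_fourierP f g : is_fourier f g <->
  [/\ L2c f, L2c g & exists u : nat -> X -> R[i],
   [/\ forall k, L1c (u k) /\ L2c (u k),
       nrm (fun x => u k x - f x) @[k --> \oo] --> 0 &
       nrm (fun xi => fourier1 (u k) xi - g xi) @[k --> \oo] --> 0]].
Proof.
split=> [[/Lp2P Lf /Lp2P Lg [u [Lu c1 c2]]]|[Lf Lg [u [Lu c1 c2]]]].
  have Lu' k : L1c (u k) /\ L2c (u k).
    by have [l1 l2] := Lu k; split; [exact/Lp1P|exact/Lp2P].
  split => //; exists u; split => //; apply/cvg_cLnorm2 => // k.
    by apply: L2cB => //; case: (Lu' k).
  by apply: L2cB => //; have [l1 l2] := Lu' k; case: (plancherel_fourier1 l1 l2).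
split; [exact/Lp2P|exact/Lp2P|exists u; split].
- by move=> k; have [l1 l2] := Lu k; split; [exact/Lp1P|exact/Lp2P].
- apply/cvg_cLnorm2 => // k; apply: L2cB => //; by case: (Lu k).
- apply/cvg_cLnorm2 => // k; apply: L2cB => //.
  by have [l1 l2] := Lu k; case: (plancherel_fourier1 l1 l2).
Qed.

Lemma is_fourier_L2 f g : is_fourier f g -> L2c f /\ L2c g.
Proof. by move=> /is_fourierP[]. Qed.

Lemma is_fourier_norm f g : is_fourier f g -> nrm g = nrm f.
Proof.
move=> /is_fourierP[Lf Lg [u [Lu c1 c2]]].
have Lu2 k : L2c (u k) by case: (Lu k).
have LF k : L2c (fourier1 (u k)).
  by have [l1 l2] := Lu k; case: (plancherel_fourier1 l1 l2).
have h1 := cvg_cip Lu2 Lu2 Lf Lf c1 c1.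
have h2 := cvg_cip LF LF Lg Lg c2 c2.
apply: cvg_unique h2 _ => //.
rewrite (_ : (fun k => _) = fun k => nrm (u k))//.
by apply/funext => k; have [l1 l2] := Lu k; case: (plancherel_fourier1 l1 l2).
Qed.

Lemma is_fourierD f1 f2 g1 g2 : is_fourier f1 g1 -> is_fourier f2 g2 ->
  is_fourier (fun x => f1 x + f2 x) (fun xi => g1 xi + g2 xi).
Proof.
move=> /is_fourierP[Lf1 Lg1 [u [Lu c1 c2]]] /is_fourierP[Lf2 Lg2 [v [Lv c3 c4]]].
apply/is_fourierP; split; [exact: L2cD|exact: L2cD|].
exists (fun k x => u k x + v k x).
have sq (w1 w2 : nat -> X -> R[i]) : (forall k, L2c (w1 k)) -> (forall k, L2c (w2 k)) ->
  nrm (w1 k) @[k --> \oo] --> 0 -> nrm (w2 k) @[k --> \oo] --> 0 ->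
  nrm (fun x => w1 k x + w2 k x) @[k --> \oo] --> 0.
  move=> L1 L2 w10 w20.
  apply: (@squeeze_cvgr _ _ _ _ (fun=> 0) (fun k => 2 * nrm (w1 k) + 2 * nrm (w2 k))).
  - by apply: nearW => k; rewrite cip_ge0/= cipD_le.
  - exact: cvg_cst.
  - rewrite [X in _ --> X](_ : 0 = 2 * 0 + 2 * 0); last by rewrite !mulr0 addr0.
    by apply: cvgD; apply: cvgM => //; exact: cvg_cst.
have LFu k : L2c (fourier1 (u k)).
  by have [l1 l2] := Lu k; case: (plancherel_fourier1 l1 l2).
have LFv k : L2c (fourier1 (v k)).
  by have [l1 l2] := Lv k; case: (plancherel_fourier1 l1 l2).
split.
- move=> k; have [l1 l2] := Lu k; have [l3 l4] := Lv k.
  by split; [exact: L1cD|exact: L2cD].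
- rewrite (_ : (fun k => _) = fun k =>
     nrm (fun x => (u k x - f1 x) + (v k x - f2 x))); last first.
    by apply/funext => k; apply: eq_Rintegral => x _; rewrite opprD addrACA.
  by apply: sq => // k; apply: L2cB => //; [case: (Lu k)|case: (Lv k)].
- rewrite (_ : (fun k => _) = fun k =>
     nrm (fun x => (fourier1 (u k) x - g1 x) + (fourier1 (v k) x - g2 x))); last first.
    apply/funext => k; apply: eq_Rintegral => x _; have [l1 _] := Lu k; have [l3 _] := Lv k.
    by rewrite fourier1D// opprD addrACA.
  by apply: sq => // k; apply: L2cB.
Qed.

Lemma cip_scale (c : R[i]) f : L2c f ->
  nrm (fun x => c * f x) = cdot c c * nrm f.
Proof.
move=> Lf; rewrite /cip -RintegralZl//; last exact: integrable_cdot.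
by apply: eq_Rintegral => x _; rewrite cdot_mul.
Qed.

Lemma is_fourierZ (c : R[i]) f g : is_fourier f g ->
  is_fourier (fun x => c * f x) (fun xi => c * g xi).
Proof.
move=> /is_fourierP[Lf Lg [u [Lu c1 c2]]].
apply/is_fourierP; split; [exact: L2cZ|exact: L2cZ|].
have LFu k : L2c (fourier1 (u k)).
  by have [l1 l2] := Lu k; case: (plancherel_fourier1 l1 l2).
exists (fun k x => c * u k x); split.
- by move=> k; have [l1 l2] := Lu k; split; [exact: L1cZ|exact: L2cZ].
- rewrite (_ : (fun k => _) = fun k => cdot c c * nrm (fun x => u k x - f x)).
    by rewrite -[X in _ --> X](mulr0 (cdot c c)); apply: cvgM => //; exact: cvg_cst.
  apply/funext => k; rewrite -cip_scale; last by apply: L2cB => //; case: (Lu k).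
  by apply: eq_Rintegral => x _; rewrite mulrBr.
- rewrite (_ : (fun k => _) = fun k => cdot c c * nrm (fun x => fourier1 (u k) x - g x)).
    by rewrite -[X in _ --> X](mulr0 (cdot c c)); apply: cvgM => //; exact: cvg_cst.
  apply/funext => k; rewrite -cip_scale; last exact: L2cB.
  apply: eq_Rintegral => x _; have [l1 _] := Lu k.
  by rewrite fourier1Z// mulrBr.
Qed.

(** Real polarization: [cip] is symmetric and bilinear over the reals, so the norm identity for the
    sum is enough. *)
Lemma is_fourier_cip f1 f2 g1 g2 : is_fourier f1 g1 -> is_fourier f2 g2 ->
  cip g1 g2 = cip f1 f2.
Proof.
move=> F1 F2; have [Lf1 Lg1] := is_fourier_L2 F1; have [Lf2 Lg2] := is_fourier_L2 F2.
have := is_fourier_norm (is_fourierD F1 F2).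
rewrite !cipDD// (is_fourier_norm F1) (is_fourier_norm F2); lra.
Qed.

(** Functions are representatives, and this is how the almost everywhere equation in [hamiltonian]
    reaches the Fourier side. *)
Lemma is_fourier_ae f1 f2 g : is_fourier f1 g -> L2c f2 -> f1 = f2 %[ae mu] ->
  is_fourier f2 g.
Proof.
move=> /is_fourierP[Lf Lg [u [Lu c1 c2]]] Lf2 f12.
apply/is_fourierP; split => //; exists u; split => //.
rewrite (_ : (fun k => _) = fun k => nrm (fun x => u k x - f1 x))//.
apply/funext => k; have [_ Luk] := Lu k.
rewrite /cip /Rintegral; congr fine; apply: ae_eq_integral => //.
- exact: measurable_int (integrable_cdot (L2cB Luk Lf2) (L2cB Luk Lf2)).
- exact: measurable_int (integrable_cdot (L2cB Luk Lf) (L2cB Luk Lf)).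
- by move: f12; apply: filterS => x /= h _; rewrite h.
Qed.

Section affine.
Variables (a : R) (h : X).
Hypothesis a_gt0 : 0 < a.

Lemma L2c_affine_multiplier f : L2c f ->
  L2c (fun xi => affine_multiplier a h xi * f (a^-1 *: xi)).
Proof.
move=> Lf; have ia0 : 0 < a^-1 by rewrite invr_gt0.
have Lf' : L2c (fun xi => f (a^-1 *: xi)).
  have := L2c_affine 0 ia0 Lf.
  by under [X in L2c X]eq_fun do rewrite addr0.
have p0 : 0 <= a ^- n by rewrite invr_ge0 exprn_ge0// ltW.
apply: (@L2c_bounded _ _ _ (a ^- n)) Lf'.
- exact: cmeasurable_affine_multiplier.
- move=> xi; rewrite ReIm/= mul0r subr0 normrM (ger0_norm p0).
  by rewrite ler_piMr ?cos_norm_le1.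
- move=> xi; rewrite ReIm/= mul0r addr0 normrM (ger0_norm p0).
  by rewrite ler_piMr ?sin_norm_le1.
Qed.

Let nrm_multiplier f : L2c f ->
  nrm (fun xi => affine_multiplier a h xi * f (a^-1 *: xi)) = a ^- n * nrm f.
Proof.
move=> Lf; have ia0 : 0 < a^-1 by rewrite invr_gt0.
have Lf' : L2c (fun xi => f (a^-1 *: xi)).
  have := L2c_affine 0 ia0 Lf.
  by under [X in L2c X]eq_fun do rewrite addr0.
transitivity (\int[mu]_xi (a ^- n * a ^- n * cdot (f (a^-1 *: xi)) (f (a^-1 *: xi)))).
  by apply: eq_Rintegral => xi _; rewrite cdot_mul cdot_affine_multiplier.
rewrite RintegralZl//; last exact: integrable_cdot.
have := cip_affine 0 ia0 Lf Lf; rewrite /cip.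
under eq_Rintegral do rewrite addr0.
move=> ->; rewrite -mulrA; congr (_ * _).
by rewrite mulrA exprVn invrK mulVf ?mul1r// expf_neq0// gt_eqF.
Qed.

Lemma is_fourier_affine f g : is_fourier f g ->
  is_fourier (fun x => f (a *: x + h))
             (fun xi => affine_multiplier a h xi * g (a^-1 *: xi)).
Proof.
move=> /is_fourierP[Lf Lg [u [Lu c1 c2]]].
apply/is_fourierP; split; [exact: L2c_affine|exact: L2c_affine_multiplier|].
have LFu k : L2c (fourier1 (u k)).
  by have [l1 l2] := Lu k; case: (plancherel_fourier1 l1 l2).
exists (fun k x => u k (a *: x + h)); split.
- move=> k; have [l1 l2] := Lu k.
  by split; [exact: L1c_affine|exact: L2c_affine].
- rewrite (_ : (fun k => _) = fun k => a ^- n * nrm (fun x => u k x - f x)).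
    by rewrite -[X in _ --> X](mulr0 (a ^- n)); apply: cvgM => //; exact: cvg_cst.
  apply/funext => k; have [_ Luk] := Lu k.
  by rewrite -(cip_affine h a_gt0); [|exact: L2cB|exact: L2cB].
- rewrite (_ : (fun k => _) = fun k => a ^- n * nrm (fun x => fourier1 (u k) x - g x)).
    by rewrite -[X in _ --> X](mulr0 (a ^- n)); apply: cvgM => //; exact: cvg_cst.
  apply/funext => k; have [l1 _] := Lu k.
  rewrite -(nrm_multiplier (L2cB (LFu k) Lg)).
  by apply: eq_Rintegral => xi _; rewrite (fourier1_affine h a_gt0)// mulrBr.
Qed.

End affine.
End is_fourier_theory.

(** * The kinetic symbol *)

Section symbol.
Context {R : realType}.
Variable Psi : R -> R.
Hypothesis Psi_derivable : forall u : R, 0 < u -> derivable Psi u 1.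
Hypothesis Psi_ge0 : forall u : R, 0 <= u -> 0 <= Psi u.
Hypothesis Psi'_ge0 : forall u : R, 0 < u -> 0 <= derive1 Psi u.
Hypothesis Psi0 : Psi 0 = 0.

Lemma symbol_MVT a b : 0 < a -> a < b ->
  exists2 c, a < c < b & Psi b - Psi a = derive1 Psi c * (b - a).
Proof.
move=> a0 ab.
have dP (x : R) : x \in `]a, b[ -> is_derive x (1 : R) Psi (derive1 Psi x).
  rewrite in_itv/= => /andP[ax _].
  by rewrite derive1E; apply/derivableP/Psi_derivable; exact: lt_trans ax.
have cP : {within `[a, b], continuous Psi}.
  apply: derivable_within_continuous => x; rewrite in_itv/= => /andP[ax _].
  by apply: Psi_derivable; exact: lt_le_trans ax.
have [c] := MVT ab dP cP.
by rewrite in_itv/= => ? ?; exists c.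
Qed.

(** The mean value theorem covers u > 0 only, as differentiability is assumed on the open half-line;
    at u = 0 the values Psi 0 = 0 <= Psi v are compared directly. *)
Lemma symbol_nondecreasing u v : 0 <= u -> u <= v -> Psi u <= Psi v.
Proof.
move=> u0; rewrite le_eqVlt => /predU1P[->//|uv].
move: u0; rewrite le_eqVlt => /predU1P[u00|u0].
  by rewrite -u00 Psi0 Psi_ge0// u00 ltW.
have [c /andP[uc _] E] := symbol_MVT u0 uv.
rewrite -subr_ge0 E mulr_ge0//; last by rewrite subr_ge0 ltW.
by rewrite Psi'_ge0// (lt_trans u0).
Qed.

Section unbounded.
Variables (m : R) (m_gt0 : 0 < m).
Hypothesis H4 : forall u : R, 0 <= u -> m * Psi u <= 2 * u * derive1 Psi u.
Hypothesis Psi_neq0 : exists2 u, 0 <= u & Psi u != 0.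

(* Doubling the argument increases Psi by a fixed amount, because H4 bounds [u Psi'(u)]
   from below. *)
Lemma symbol_unbounded A : exists2 M, 0 < M & A <= Psi M.
Proof.
have [u0 u00 Pu0] := Psi_neq0.
have up : 0 < u0.
  by rewrite lt_neqAle u00 andbT; apply/eqP => E; move: Pu0; rewrite -E Psi0 eqxx.
have Pp : 0 < Psi u0 by rewrite lt_neqAle eq_sym Pu0 Psi_ge0.
(* For some c between a and 2a the increment is a Psi'(c) >= c Psi'(c) / 2 >= m Psi(c) / 4, and
   Psi(c) >= Psi(u0). *)
have step a : u0 <= a -> Psi a + m * Psi u0 / 4 <= Psi (2 * a).
  move=> ua; have a0 : 0 < a by exact: lt_le_trans ua.
  have [|c /andP[ac c2a] E] := @symbol_MVT a (2 * a) a0; first lra.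
  have c0 : 0 < c by exact: lt_trans ac.
  have h4 := H4 (ltW c0); have d0 := Psi'_ge0 c0.
  have Pc : Psi u0 <= Psi c by apply: symbol_nondecreasing => //; lra.
  have h1 : m * Psi u0 <= m * Psi c by rewrite ler_wpM2l// ltW.
  have h2 : derive1 Psi c * c <= derive1 Psi c * (2 * a) by rewrite ler_wpM2l// ltW.
  rewrite -(subrK (Psi a) (Psi (2 * a))) E; lra.
have P k : Psi u0 + k%:R * (m * Psi u0 / 4) <= Psi (2 ^+ k * u0).
  elim: k => [|k IH]; first by rewrite mul0r addr0 expr0 mul1r.
  have ge1 : 1 <= 2 ^+ k :> R by rewrite exprn_ege1// ler1n.
  have := step (2 ^+ k * u0) (ler_peMl u00 ge1).
  have -> : k.+1%:R = k%:R + 1 :> R by rewrite natr1.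
  rewrite exprS -(mulrA 2); lra.
have d0 : 0 < m * Psi u0 / 4 by rewrite divr_gt0// mulr_gt0.
pose k := (Num.trunc (`|A| / (m * Psi u0 / 4))).+1.
exists (2 ^+ k * u0); first by rewrite mulr_gt0// exprn_gt0.
apply: le_trans (P k); have : `|A| <= k%:R * (m * Psi u0 / 4).
  by rewrite -ler_pdivrMr// ltW// truncnS_gt.
by have := ler_norm A; lra.
Qed.

End unbounded.

Section dilation_quotient.
Variables (c2 d2 : R).
Hypothesis H3 : forall u : R, 0 <= u -> u * derive1 Psi u <= c2 * Psi u + d2.
Hypothesis c2_ge0 : 0 <= c2.
Hypothesis d2_ge0 : 0 <= d2.

(** Dilating xi by 1/(1 + s) divides u = |xi|^2 / 2 by (1 + s)^2. With v = u / (1 + s)^2 one has u -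
    v = v (2 + s) s, and v <= c at the mean value point c, so H.3 at c bounds Psi'(c) v. Since 2 + s
    <= 3, the constant 8 is generous. *)
Lemma symbol_dilation_quotient u s : 0 <= u -> 0 < s <= 1 ->
  0 <= (Psi u - Psi (u / (1 + s) ^+ 2)) / s <= 8 * (c2 * Psi u + d2).
Proof.
move=> u0 /andP[s0 s1]; have t1 : 1 <= (1 + s) ^+ 2 by nra.
have t0 : 0 < (1 + s) ^+ 2 by lra.
have v0 : 0 <= u / (1 + s) ^+ 2 by rewrite divr_ge0// ltW.
have vu : u / (1 + s) ^+ 2 <= u by rewrite ler_pdivrMr// ler_peMr.
apply/andP; split.
  by rewrite divr_ge0 ?(ltW s0)// subr_ge0 symbol_nondecreasing.
have Pu := Psi_ge0 u0.
have D0 : 0 <= c2 * Psi u + d2 by rewrite addr_ge0// mulr_ge0.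
move: (u0); rewrite le_eqVlt => /predU1P[<-|up].
  by rewrite !mul0r subrr mul0r Psi0 mulr0 add0r mulr_ge0.
have vp : 0 < u / (1 + s) ^+ 2 by rewrite divr_gt0.
have vltu : u / (1 + s) ^+ 2 < u by rewrite ltr_pdivrMr// ltr_pMr//; nra.
have [c /andP[vc cu] E] := symbol_MVT vp vltu.
have cp : 0 < c by exact: lt_trans vc.
have h3 := H3 (ltW cp); have h1 := Psi'_ge0 cp.
have Pc : Psi c <= Psi u by apply: symbol_nondecreasing; lra.
rewrite ler_pdivrMr// E.
have -> : u - u / (1 + s) ^+ 2 = (u / (1 + s) ^+ 2) * ((2 + s) * s).
  by field; rewrite gt_eqF//; lra.
have h : derive1 Psi c * (u / (1 + s) ^+ 2) <= c2 * Psi u + d2.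
  have : derive1 Psi c * (u / (1 + s) ^+ 2) <= derive1 Psi c * c.
    by rewrite ler_wpM2l// ltW.
  have : c2 * Psi c <= c2 * Psi u by rewrite ler_wpM2l.
  lra.
rewrite mulrA mulrA ler_pM2r//.
have : 0 <= derive1 Psi c * (u / (1 + s) ^+ 2) by rewrite mulr_ge0// ltW.
nra.
Qed.

End dilation_quotient.

Lemma cvg_symbol_dilation_quotient u : 0 <= u ->
  (0 < u -> {for u, continuous (derive1 Psi)}) ->
  (Psi u - Psi (u / (1 + k.+1%:R^-1) ^+ 2)) / k.+1%:R^-1 @[k --> \oo] -->
  2 * u * derive1 Psi u.
Proof.
(* At u = 0 the value of [derive1 Psi 0] is arbitrary but multiplied by 0, and all the quotients
   vanish. *)
rewrite le_eqVlt => /predU1P[<- _|u0 /(_ u0) cP].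
  rewrite mulr0 mul0r (_ : (fun k => _) = fun=> 0); first exact: cvg_cst.
  by apply/funext => k; rewrite !mul0r subrr mul0r.
pose s k : R := k.+1%:R^-1.
have s0 k : 0 < s k by rewrite invr_gt0.
have cs : s k @[k --> \oo] --> (0 : R) by exact: cvg_harmonic.
have /choice[c cE] : forall k, exists c, u / (1 + s k) ^+ 2 < c < u /\
    (Psi u - Psi (u / (1 + s k) ^+ 2)) / s k =
    derive1 Psi c * (u / (1 + s k) ^+ 2 * (2 + s k)).
  move=> k; have t0 : 0 < (1 + s k) ^+ 2 by rewrite exprn_gt0// addr_gt0.
  have [||c cu E] := @symbol_MVT (u / (1 + s k) ^+ 2) u.
  - by rewrite divr_gt0.
  - rewrite ltr_pdivrMr// ltr_pMr//; have := s0 k; nra.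
  exists c; split => //; rewrite E.
  by field; rewrite !gt_eqF//= addr_gt0.
have cv : u / (1 + s k) ^+ 2 @[k --> \oo] --> u.
  rewrite [X in _ --> X](_ : u = u / ((1 + 0) * (1 + 0))); last first.
    by rewrite addr0 mulr1 divr1.
  apply: cvgM; first exact: cvg_cst.
  apply: cvgV; first by rewrite addr0 mulr1 oner_neq0.
  by apply: cvgM; apply: cvgD => //; exact: cvg_cst.
have cc : c k @[k --> \oo] --> u.
  apply: (squeeze_cvgr _ cv (cvg_cst u)); apply: nearW => k.
  by have [/andP[/ltW -> /ltW ->] _] := cE k.
rewrite (_ : (fun k => _) = fun k => derive1 Psi (c k) * (u / (1 + s k) ^+ 2 * (2 + s k))); last first.
  by apply/funext => k; case: (cE k).
rewrite [X in _ --> X](_ : _ = derive1 Psi u * (u * (2 + 0))); last by ring.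
apply: cvgM; first exact: (continuous_cvg _ cP).
by apply: cvgM => //; apply: cvgD => //; exact: cvg_cst.
Qed.

End symbol.

(** * The potential *)

Section euclidean_theory.
Context {R : realType} {d : nat}.
Local Notation X := 'rV[R]_d.
Implicit Types x y : X.

Lemma dotv_ge0 x : 0 <= dotv x x.
Proof. by apply: sumr_ge0 => i _; rewrite -expr2 sqr_ge0. Qed.

Lemma enorm_sqr x : enorm x ^+ 2 = dotv x x.
Proof. by rewrite sqr_sqrtr// dotv_ge0. Qed.

Lemma enorm_ge0 x : 0 <= enorm x. Proof. exact: sqrtr_ge0. Qed.

Lemma dotvZr a x y : dotv x (a *: y) = a * dotv x y.
Proof. by rewrite dotvC dotvZl dotvC. Qed.

Lemma enormZ a x : enorm (a *: x) = `|a| * enorm x.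
Proof. by rewrite /enorm dotvZl dotvZr mulrA -expr2 sqrtrM ?sqr_ge0// sqrtr_sqr. Qed.

Lemma dotv_le x y : `|dotv x y| <= enorm x * enorm y.
Proof.
rewrite -(ler_pXn2r (n := 2)) ?nnegrE ?mulr_ge0 ?enorm_ge0//.
rewrite real_normK ?num_real// exprMn !enorm_sqr.
apply: quadratic_CS => s t.
have := dotv_ge0 (s *: x + (- t) *: y).
rewrite dotvDl !dotvZl (dotvC x (_ + _)) (dotvC y (_ + _)) !dotvDl !dotvZl (dotvC y x).
by congr (0 <= _); ring.
Qed.

Lemma entry_le_enorm x i : `|x ord0 i| <= enorm x.
Proof.
rewrite -(ler_pXn2r (n := 2)) ?nnegrE ?enorm_ge0//.
rewrite real_normK ?num_real// enorm_sqr /dotv (bigD1 i)//= expr2 lerDl.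
by apply: sumr_ge0 => j _; rewrite -expr2 sqr_ge0.
Qed.

Lemma japanese_ge1 x : 1 <= japanese x.
Proof. by rewrite -{1}sqrtr1 ler_wsqrtr// lerDl sqr_ge0. Qed.

Lemma japanese_gt0 x : 0 < japanese x.
Proof. exact: lt_le_trans (japanese_ge1 x). Qed.

Lemma enorm_le_japanese x : enorm x <= japanese x.
Proof.
rewrite -[leLHS]ger0_norm ?enorm_ge0// -sqrtr_sqr ler_wsqrtr// lerDr.
exact: ler01.
Qed.

Lemma le_japanese x y : enorm x <= enorm y -> japanese x <= japanese y.
Proof.
by move=> xy; rewrite ler_wsqrtr// lerD2l lerXn2r// nnegrE enorm_ge0.
Qed.

Lemma measurable_japanese : measurable_fun setT (@japanese R d).
Proof.
have ms : measurable_fun setT (@Num.sqrt R).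
  by apply: continuous_measurable_fun; exact: sqrt_continuous.
apply: (measurableT_comp ms); apply: measurable_funD => //.
rewrite (_ : (fun x => _) = fun x => dotv x x); last by apply/funext => x; rewrite enorm_sqr.
by apply: measurable_dotv.
Qed.

(** The difference quotient along the ray is that of V at [s *: x] in direction x; differentiability
    expands it linearly in the coordinate directions. *)
Lemma is_derive_ray (V : X -> R) (x : X) (s : R) : differentiable V (s *: x) ->
  is_derive s (1 : R) (fun r => V (r *: x)) (dotv (grad V (s *: x)) x).
Proof.
move=> dV.
have E : (fun h : R => h^-1 *: (((fun r => V (r *: x)) \o shift s) (h *: (1 : R)) -
    V (s *: x))) = (fun h : R => h^-1 *: ((V \o shift (s *: x)) (h *: x) - V (s *: x))).
  by apply/funext => h; rewrite /= /GRing.scale/= mulr1 -scalerDl.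
have dx : derivable V (s *: x) x by exact: diff_derivable.
apply: DeriveDef; first by rewrite /derivable E.
rewrite /derive E -/(derive V (s *: x) x) {E}.
move: (s *: x) dV dx => y dV _; rewrite deriveE//.
rewrite [in LHS](row_sum_delta x) linear_sum/= /dotv.
apply: eq_bigr => i _; rewrite linearZ/= mxE deriveE//.
by rewrite mulrC.
Qed.

Section potential.
Variables (V : X -> R) (c gamma : R).
Hypothesis V_C1 : C1 V.
Hypothesis c_gt0 : 0 < c.
Hypothesis gamma_gt0 : 0 < gamma.
Hypothesis V_le : forall x, `|V x| <= c * japanese x `^ (- gamma).
Hypothesis gradV_le : forall x, enorm (grad V x) <= c * japanese x `^ (- 1 - gamma).

(** A common majorant of |V| and of |x . grad V|. *)
Definition weight x : R := c * japanese x `^ (- gamma).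

Lemma weight_ge0 x : 0 <= weight x.
Proof. by rewrite mulr_ge0 ?powR_ge0// ltW. Qed.

Lemma weight_le x : weight x <= c.
Proof.
rewrite ler_piMr ?(ltW c_gt0)// powRN invf_le1 ?powR_gt0 ?japanese_gt0//.
rewrite -(powRr0 (japanese x)) ler_powR ?japanese_ge1//.
exact: ltW.
Qed.

Lemma measurable_weight : measurable_fun setT weight.
Proof.
apply: measurable_funM => //.
exact: (measurableT_comp (measurable_powR (R := R) (- gamma)) measurable_japanese).
Qed.

Lemma measurable_potential : measurable_fun setT V.
Proof.
apply: continuous_measurable_fun_rV => x.
by apply: differentiable_continuous; case: V_C1.
Qed.

Lemma weight_decay eta : 0 < eta ->
  exists2 r, 0 < r & forall x, ~ ball (0 : X) r x -> weight x <= eta.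
Proof.
move=> eta0; have ce : 0 < c / eta by rewrite divr_gt0.
(* The radius solves c r^(-gamma) = eta. Outside the sup-norm ball of radius r the Euclidean norm,
   hence <x>, is at least r. *)
exists ((c / eta) `^ gamma^-1); first by rewrite powR_gt0.
move=> x xr.
have {}xr : (c / eta) `^ gamma^-1 <= japanese x.
  rewrite leNgt; apply/negP => h; apply: xr.
  rewrite ball_rVE ?powR_gt0// => i; rewrite /ball/= mxE sub0r normrN.
  apply: le_lt_trans (entry_le_enorm x i) _.
  exact: le_lt_trans (enorm_le_japanese x) h.
rewrite /weight powRN ler_pdivrMr ?powR_gt0 ?japanese_gt0// mulrC -ler_pdivrMr//.
have gn : gamma != 0 by rewrite gt_eqF.
rewrite -[leLHS](powRr1 (ltW ce)) -[X in _ `^ X <= _](mulVf gn) powRrM.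
by apply: ge0_ler_powR; rewrite ?nnegrE ?powR_ge0 ?(ltW (japanese_gt0 x)) ?(ltW gamma_gt0).
Qed.

(** Mean value theorem along the ray: at some r > 1 the slope is at most c <r x>^(-1-gamma) |x|. The
    dilation goes outward, so <r x> >= <x>, and |x| <= <x> removes one power. *)
Lemma potential_dilation x s : 0 < s ->
  `|V x - V ((1 + s) *: x)| <= s * weight x.
Proof.
move=> s0; pose g (r : R) := V (r *: x).
have dg r : is_derive r (1 : R) g (dotv (grad V (r *: x)) x).
  by apply: is_derive_ray; case: V_C1.
have dg' (r : R) : r \in `]1, (1 + s)[ ->
    is_derive r (1 : R) g (dotv (grad V (r *: x)) x) by move=> _; exact: dg.
have cg : {within `[1, (1 + s)], continuous g}.
  by apply: derivable_within_continuous => r r1; have [] := dg r.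
have lts : 1 < 1 + s by rewrite ltrDl.
have [r r1 E] := MVT lts dg' cg.
move: r1; rewrite in_itv/= => /andP[r1 _].
have -> : V x = g 1 by rewrite /g scale1r.
rewrite distrC -/(g (1 + s)) E (addrC 1) addrK.
rewrite normrM (gtr0_norm s0) mulrC ler_pM2l//.
apply: le_trans (dotv_le _ _) _.
have J : japanese x <= japanese (r *: x).
  by apply: le_japanese; rewrite enormZ ler_peMl ?enorm_ge0// (le_trans (ltW r1))// ler_norm.
apply: (@le_trans _ _ (c * japanese x `^ (- 1 - gamma) * japanese x)).
  apply: ler_pM; rewrite ?enorm_ge0 ?enorm_le_japanese//.
  apply: le_trans (gradV_le _) _; rewrite ler_pM2l// -opprD !powRN.
  rewrite lef_pV2 ?posrE ?powR_gt0 ?japanese_gt0//.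
  by apply: ge0_ler_powR => //; rewrite ?nnegrE ?(ltW (japanese_gt0 _))// addr_ge0// ltW.
rewrite /weight -mulrA ler_pM2l// -{2}(powRr1 (ltW (japanese_gt0 x))).
rewrite -powRD; last by rewrite (gt_eqF (japanese_gt0 x)) implybT.
by rewrite addrAC addNr add0r.
Qed.

End potential.
End euclidean_theory.

(** * Real multipliers and dilations *)

Section real_multipliers.
Context {R : realType} {n : nat}.
Local Notation X := 'rV[R]_n.
Local Notation mu := (@lebesgue_rV R n).
Implicit Types (f g : X -> R[i]) (k : X -> R).
Local Open Scope complex_scope.

Definition rmul k f (x : X) : R[i] := (k x)%:C * f x.

Lemma cdot_rmulr (a : R) (z w : R[i]) : cdot z (a%:C * w) = a * cdot z w.
Proof. by rewrite /cdot !ReIm/=; ring. Qed.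

Lemma cdot_rmull (a : R) (z w : R[i]) : cdot (a%:C * z) w = a * cdot z w.
Proof. by rewrite /cdot !ReIm/=; ring. Qed.

Lemma cdot_AMGM (z w : R[i]) : `|cdot z w| <= 2^-1 * (cdot z z + cdot w w).
Proof.
rewrite /cdot; case: z => a b; case: w => c d /=.
have := sqr_ge0 (a - c); have := sqr_ge0 (b - d).
have := sqr_ge0 (a + c); have := sqr_ge0 (b + d).
by rewrite ler_norml => *; apply/andP; split; nra.
Qed.

Lemma reF_rmul k f : reF (rmul k f) = fun x => k x * reF f x.
Proof. by apply/funext => x; rewrite /reF ReIm/= mul0r subr0. Qed.

Lemma imF_rmul k f : imF (rmul k f) = fun x => k x * imF f x.
Proof. by apply/funext => x; rewrite /imF ReIm/= mul0r addr0. Qed.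

Lemma L2c_rmul_bounded k M f : measurable_fun setT k -> (forall x, `|k x| <= M) ->
  L2c f -> L2c (rmul k f).
Proof.
move=> mk kM [f1 f2]; split.
  by rewrite reF_rmul; exact: L2r_bounded kM f1.
by rewrite imF_rmul; exact: L2r_bounded kM f2.
Qed.

Lemma cip_rmulC k f g : cip (rmul k f) g = cip f (rmul k g).
Proof. by apply: eq_Rintegral => x _; rewrite cdot_rmulr cdot_rmull. Qed.

(** The majorant [M] may be unbounded as long as M f is square integrable; this is what the
    quotients of the kinetic symbol require. *)
Lemma cvg_L2c_rmul (u : nat -> X -> R) k (M : X -> R) f :
  (forall j, measurable_fun setT (u j)) ->
  (forall x, u j x @[j --> \oo] --> k x) ->
  (forall j x, `|u j x| <= M x) -> L2c f -> L2c (rmul M f) ->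
  [/\ L2c (rmul k f), forall j, L2c (rmul (u j) f) &
   cip (fun x => rmul (u j) f x - rmul k f x) (fun x => rmul (u j) f x - rmul k f x)
     @[j --> \oo] --> 0].
Proof.
move=> mu_ uk uM [f1 f2] []; rewrite reF_rmul imF_rmul => M1 M2.
have c1 (v : X -> R) x : u j x * v x @[j --> \oo] --> k x * v x.
  by apply: cvgM => //; exact: cvg_cst.
have b1 (v : X -> R) j x : `|u j x * v x| <= `|M x * v x|.
  by rewrite !normrM ler_wpM2r// (le_trans (uM j x))// ler_norm.
have m1 j : measurable_fun setT (fun x => u j x * reF f x).
  by apply: measurable_funM => //; case: f1.
have m2 j : measurable_fun setT (fun x => u j x * imF f x).
  by apply: measurable_funM => //; case: f2.
have [k1 d1] := cvg_L2r_dominated m1 (c1 (reF f)) M1 (b1 (reF f)).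
have [k2 d2] := cvg_L2r_dominated m2 (c1 (imF f)) M2 (b1 (imF f)).
have Lk : L2c (rmul k f) by split; rewrite ?reF_rmul ?imF_rmul.
have Lu j : L2c (rmul (u j) f).
  by split; rewrite ?reF_rmul ?imF_rmul; [exact: L2r_le M1|exact: L2r_le M2].
split => //.
rewrite (_ : (fun j => _) = fun j =>
  rip mu (fun x => u j x * reF f x - k x * reF f x) (fun x => u j x * reF f x - k x * reF f x) +
  rip mu (fun x => u j x * imF f x - k x * imF f x) (fun x => u j x * imF f x - k x * imF f x)).
  by rewrite -[X in _ --> X](addr0 0); exact: cvgD.
apply/funext => j; rewrite cipE; [|exact: L2cB|exact: L2cB].
rewrite (_ : reF _ = fun x => u j x * reF f x - k x * reF f x); last first.
  by apply/funext => x; rewrite /reF /rmul !ReIm/= !mul0r !subr0.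
rewrite (_ : imF _ = fun x => u j x * imF f x - k x * imF f x)//.
by apply/funext => x; rewrite /imF /rmul !ReIm/= !mul0r !addr0.
Qed.

Lemma cvg_L2c_dilation (b : nat -> R) f : (forall j, 0 < b j) ->
  b j @[j --> \oo] --> (1 : R) -> L2c f ->
  (forall j, L2c (fun x => f (b j *: x))) /\
  cip (fun x => f (b j *: x) - f x) (fun x => f (b j *: x) - f x) @[j --> \oo] --> 0.
Proof.
move=> b0 b1 Lf.
pose phi j (x : X) := b j *: x.
have mphi j : measurable_fun setT (phi j) by exact: measurable_rVZ.
have phi_id x : phi j x @[j --> \oo] --> x.
  by rewrite -[X in _ --> X]scale1r; exact: cvgZr_tmp.
have C1 : b j ^- n @[j --> \oo] --> (1 : R).
  rewrite [X in _ --> X](_ : 1 = 1 ^- n :> R); last by rewrite expr1n invr1.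
  apply: cvgV; first by rewrite expr1n oner_neq0.
  apply: (cvg_comp b (fun r : R => r ^+ n) b1).
  exact: (@exprn_continuous R n 1).
have phi_int j (g : X -> \bar R) : measurable_fun setT g -> (forall x, 0 <= g x)%E ->
    (\int[mu]_x g (phi j x) = (b j ^- n)%:E * \int[mu]_x g x)%E.
  move=> mg g0; have bn0 : b j != 0 by rewrite gt_eqF.
  rewrite -(gtr0_norm (b0 j)) -(ge0_integral_affine 0 bn0 mg g0).
  by apply: eq_integral => x _; rewrite addr0.
have L j : L2c (fun x => f (b j *: x)).
  by have := L2c_affine 0 (b0 j) Lf; under [X in L2c X]eq_fun do rewrite addr0.
split => //; have [f1 f2] := Lf.
have c1 := L2r_comp_cvg mphi phi_id C1 phi_int f1.
have c2 := L2r_comp_cvg mphi phi_id C1 phi_int f2.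
rewrite (_ : (fun j => _) = fun j =>
  rip mu (fun x => reF f (phi j x) - reF f x) (fun x => reF f (phi j x) - reF f x) +
  rip mu (fun x => imF f (phi j x) - imF f x) (fun x => imF f (phi j x) - imF f x)).
  by rewrite -[X in _ --> X](addr0 0); exact: cvgD.
apply/funext => j; rewrite cipE; [|exact: L2cB|exact: L2cB].
rewrite (_ : reF _ = fun x => reF f (phi j x) - reF f x); last first.
  by apply/funext => x; rewrite /reF !ReIm.
rewrite (_ : imF _ = fun x => imF f (phi j x) - imF f x)//.
by apply/funext => x; rewrite /imF !ReIm.
Qed.

Lemma cip_eq0 f : L2c f -> cip f f = 0 -> f = cst 0 %[ae mu].
Proof.
move=> Lf f0; have i1 := integrable_cdot Lf Lf.
have mf : measurable_fun setT (fun x => (cdot (f x) (f x))%:E) by exact: measurable_int i1.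
have /(ae_eq_integral_abs _ measurableT mf) : (\int[mu]_x `|(cdot (f x) (f x))%:E| = 0)%E.
  under eq_integral do rewrite gee0_abs ?lee_fin ?cdot_ge0//.
  by rewrite (integral_EFin_Rintegral i1) -/(cip f f) f0.
apply: filterS => x /= H _; apply: cdot_eq0.
by have := H I => -[].
Qed.

End real_multipliers.

(** * Orthonormal families that are equicontinuous under translations *)

Section bessel.
Context {R : realType} {n : nat}.
Local Notation X := 'rV[R]_n.
Local Notation mu := (@lebesgue_rV R n).
Local Open Scope complex_scope.

Lemma L2c_sum (I : Type) (s : seq I) (w : I -> X -> R[i]) :
  (forall i, L2c (w i)) -> L2c (fun x => \sum_(i <- s) w i x).
Proof.
move=> Lw; elim: s => [|i s IH].
  under [X in L2c X]eq_fun do rewrite big_nil.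
  by split; exact: L2r0.
under [X in L2c X]eq_fun do rewrite big_cons.
exact: L2cD.
Qed.

Lemma cip_sumr (I : Type) (s : seq I) (w : I -> X -> R[i]) g :
  L2c g -> (forall i, L2c (w i)) ->
  cip g (fun x => \sum_(i <- s) w i x) = \sum_(i <- s) cip g (w i).
Proof.
move=> Lg Lw; elim: s => [|i s IH].
  rewrite big_nil /cip (_ : (fun x => _) = fun=> 0).
    by rewrite Rintegral_cst// mul0r.
  by apply/funext => x; rewrite big_nil /cdot/= !mulr0 addr0.
rewrite big_cons -IH -cipDr//; last exact: L2c_sum.
by congr (cip _ _); apply/funext => x; rewrite big_cons.
Qed.

Variables (N : nat) (f : 'I_N -> X -> R[i]).
Hypothesis Lf : forall i, L2c (f i).
Hypothesis f_orthonormal : forall i j, cip (f i) (f j) = (i == j)%:R.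

Lemma cip_orthonormal_sum (a : 'I_N -> R) g : L2c g ->
  cip g (fun x => \sum_i (a i)%:C * f i x) = \sum_i a i * cip g (f i).
Proof.
move=> Lg; rewrite cip_sumr//; last by move=> i; exact: L2cZ.
by apply: eq_bigr => i _; rewrite cipZr.
Qed.

Lemma cip_orthonormal_coord (a : 'I_N -> R) j :
  cip (f j) (fun x => \sum_i (a i)%:C * f i x) = a j.
Proof.
rewrite cip_orthonormal_sum// (bigD1 j)//= f_orthonormal eqxx mulr1 big1 ?addr0//.
by move=> i ij; rewrite f_orthonormal eq_sym (negbTE ij) mulr0.
Qed.

Lemma bessel g : L2c g -> \sum_i cip g (f i) ^+ 2 <= cip g g.
Proof.
move=> Lg; pose p x := \sum_i (cip g (f i))%:C * f i x.
have Lp : L2c p by apply: L2c_sum => i; exact: L2cZ.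
have gp : cip g p = \sum_i cip g (f i) ^+ 2.
  by rewrite cip_orthonormal_sum//; apply: eq_bigr => i _; rewrite expr2.
have pp : cip p p = \sum_i cip g (f i) ^+ 2.
  rewrite cip_orthonormal_sum//; apply: eq_bigr => i _.
  by rewrite [X in _ * X]cipC cip_orthonormal_coord expr2.
by have := cip_ge0 (fun x => g x - p x); rewrite cipBB// gp pp; lra.
Qed.

Variable delta : R.
Hypothesis delta_gt0 : 0 < delta.
Let Q : set X := ball (0 : X) delta.
Let vol : R := fine (mu Q).

Let mQ : measurable Q. Proof. exact: measurable_ball_rV. Qed.

(** The indicator of the cube x + Q as a function of y; pairing a function with it gives [vol] times
    its average around x. *)
Let chi (x y : X) : R := \1_Q (y - x).

Let mchi x : measurable_fun setT (chi x).
Proof.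
apply: (measurableT_comp (f := \1_Q : X -> R)); first exact: measurable_indic.
by apply: measurable_rVD => //; exact: measurable_cst.
Qed.

Let chi_sqr x y : chi x y * chi x y = chi x y.
Proof. by rewrite /chi indicE; case: (_ \in _); rewrite ?mulr1 ?mulr0. Qed.

Let chi_ge0 x y : 0 <= chi x y. Proof. by rewrite /chi indicE. Qed.

Let chi_norm x y : `|chi x y| <= 1.
Proof. by rewrite /chi indicE; case: (_ \in _); rewrite ?normr1 ?normr0. Qed.

Let iQ : mu.-integrable setT (EFin \o (\1_Q : X -> R)).
Proof. by apply: integrableR_indic => //; exact: lebesgue_rV_ball_lty. Qed.

Let chi_affine x : chi x = fun y => \1_Q (1 *: y + (- x)).
Proof. by apply/funext => y; rewrite scale1r. Qed.

Let ichi x : mu.-integrable setT (EFin \o chi x).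
Proof. by rewrite chi_affine; exact: (integrableR_affine (- x) (oner_neq0 R) iQ). Qed.

Let integral_chi x : \int[mu]_y chi x y = vol.
Proof.
rewrite chi_affine (Rintegral_affine (- x) (oner_neq0 R) iQ).
rewrite normr1 expr1n invr1 mul1r /Rintegral integral_indic// setIT.
by [].
Qed.

Let L2chi x : L2r mu (chi x).
Proof.
split; first exact: mchi.
by under [X in EFin \o X]eq_fun do rewrite expr2 chi_sqr; exact: ichi.
Qed.

(** v(x) vol is the integral of v(x) - v(y) over the cube plus the integral of v(y). Cauchy-Schwarz
    bounds the first, with the squared norm of [chi x] equal to vol. *)
Let average_estimate (v : X -> R) x : L2r mu v ->
  (v x * vol) ^+ 2 <= 2 * vol * \int[mu]_y (chi x y * (v x - v y) ^+ 2) +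
    2 * rip mu (chi x) v ^+ 2.
Proof.
move=> Lv.
pose w y := chi x y * (v x - v y).
have wE : w = fun y => v x * chi x y - chi x y * v y.
  by apply/funext => y; rewrite /w mulrBr mulrC.
have Lw : L2r mu w.
  rewrite wE; apply: L2rB; first exact: L2rZ.
  exact: (L2r_bounded (mchi x) (chi_norm x)).
have E : v x * vol = rip mu (chi x) w + rip mu (chi x) v.
  rewrite -ripDr// /rip -(integral_chi x) -RintegralZl//.
  apply: eq_Rintegral => y _; rewrite mulrDr /w mulrA chi_sqr; ring.
have CS := rip_CS (L2chi x) Lw.
have Ecc : rip mu (chi x) (chi x) = vol.
  by rewrite -(integral_chi x); apply: eq_Rintegral => y _; rewrite chi_sqr.
have Eww : rip mu w w = \int[mu]_y (chi x y * (v x - v y) ^+ 2).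
  apply: eq_Rintegral => y _; rewrite /w -{3}(chi_sqr x y); ring.
rewrite Ecc Eww in CS; rewrite E.
have := sqr_ge0 (rip mu (chi x) w - rip mu (chi x) v).
nra.
Qed.

Let sq (z : R[i]) : R := cdot z z.

Let integrable_chi_sqr (v : X -> R) x : L2r mu v ->
  mu.-integrable setT (EFin \o (fun y => chi x y * (v x - v y) ^+ 2)).
Proof.
move=> Lv; have Lw : L2r mu (fun y => v x * chi x y - chi x y * v y).
  apply: L2rB; first exact: L2rZ.
  exact: (L2r_bounded (mchi x) (chi_norm x)).
rewrite (_ : (fun y => _) = fun y => (v x * chi x y - chi x y * v y) ^+ 2); first exact: Lw.2.
by apply/funext => y; rewrite -{1}(chi_sqr x y); ring.
Qed.

Let chi_diffE g x : (fun y => chi x y * sq (g x - g y)) =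
  fun y => chi x y * (reF g x - reF g y) ^+ 2 + chi x y * (imF g x - imF g y) ^+ 2.
Proof. by apply/funext => y; rewrite /sq /cdot !ReIm /reF /imF; ring. Qed.

Let integrable_chi_diff g x : L2c g ->
  mu.-integrable setT (EFin \o (fun y => chi x y * sq (g x - g y))).
Proof.
by move=> [g1 g2]; rewrite chi_diffE; apply: integrableRD; exact: integrable_chi_sqr.
Qed.

(** Summed over the family, the averages are coefficients of the single function [chi x], so
    Bessel's inequality bounds them independently of N. *)
Let pointwise_estimate x : \sum_i sq (f i x) * vol ^+ 2 <=
  2 * vol * (\sum_i \int[mu]_y (chi x y * sq (f i x - f i y))) + 4 * vol.
Proof.
have S1 i : sq (f i x) * vol ^+ 2 <= 2 * vol * \int[mu]_y (chi x y * sq (f i x - f i y)) +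
    2 * (rip mu (chi x) (reF (f i)) ^+ 2 + rip mu (chi x) (imF (f i)) ^+ 2).
  have [Lr Li] := Lf i.
  have h1 := average_estimate x Lr; have h2 := average_estimate x Li.
  have -> : \int[mu]_y (chi x y * sq (f i x - f i y)) =
     \int[mu]_y (chi x y * (reF (f i) x - reF (f i) y) ^+ 2) +
     \int[mu]_y (chi x y * (imF (f i) x - imF (f i) y) ^+ 2).
    by rewrite chi_diffE RintegralD//; exact: integrable_chi_sqr.
  have -> : sq (f i x) * vol ^+ 2 = (reF (f i) x * vol) ^+ 2 + (imF (f i) x * vol) ^+ 2.
    by rewrite /sq /cdot /reF /imF; ring.
  lra.
(* Bessel holds over the reals: testing with chi yields the averages of the real parts, with i chi
   those of the imaginary parts. Each sum is at most vol, whence the term 4 vol. *)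
have chiC : L2c (fun y => (chi x y)%:C).
  split; first exact: L2chi.
  exact: L2r0.
have chiI : L2c (fun y => 'i * (chi x y)%:C) by exact: L2cZ.
have B1 := bessel chiC; have B2 := bessel chiI.
have Ecc : cip (fun y => (chi x y)%:C) (fun y => (chi x y)%:C) = vol.
  rewrite -(integral_chi x); apply: eq_Rintegral => y _.
  by rewrite /cdot/= mulr0 addr0 chi_sqr.
have Eii : cip (fun y => 'i * (chi x y)%:C) (fun y => 'i * (chi x y)%:C) = vol.
  rewrite -(integral_chi x); apply: eq_Rintegral => y _.
  by rewrite /cdot !ReIm/= -[RHS](chi_sqr x y); ring.
have R1 i : cip (fun y => (chi x y)%:C) (f i) = rip mu (chi x) (reF (f i)).
  by apply: eq_Rintegral => y _; rewrite /cdot/= mul0r addr0.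
have R2 i : cip (fun y => 'i * (chi x y)%:C) (f i) = rip mu (chi x) (imF (f i)).
  by apply: eq_Rintegral => y _; rewrite /cdot !ReIm/= /imF; ring.
have {}B1 : \sum_i rip mu (chi x) (reF (f i)) ^+ 2 <= vol.
  by move: B1; rewrite Ecc; under eq_bigr do rewrite R1.
have {}B2 : \sum_i rip mu (chi x) (imF (f i)) ^+ 2 <= vol.
  by move: B2; rewrite Eii; under eq_bigr do rewrite R2.
apply: (@le_trans _ _ (\sum_i (2 * vol * \int[mu]_y (chi x y * sq (f i x - f i y)) +
    2 * (rip mu (chi x) (reF (f i)) ^+ 2 + rip mu (chi x) (imF (f i)) ^+ 2)))).
  exact: ler_sum.
rewrite big_split/= -!mulr_sumr big_split/= lerD2l; lra.
Qed.

Variables (B : set X) (eps : R).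
Hypothesis mB : measurable B.
Hypothesis B_lty : (mu B < +oo)%E.
Hypothesis f_translation : forall i h, Q h ->
  cip (fun x => f i (x + h) - f i x) (fun x => f i (x + h) - f i x) <= eps.

Let vol_gt0 : 0 < vol. Proof. exact: lebesgue_rV_ball_gt0. Qed.

Let G i (z : X * X) := chi z.1 z.2 * sq (f i z.1 - f i z.2).

Let measurable_G i : measurable_fun setT (G i).
Proof.
have [m1 m2] := L2c_measurable (Lf i).
apply: measurable_funM.
  apply: (measurableT_comp (f := \1_Q : X -> R)); first exact: measurable_indic.
  by apply: measurable_rVD => //; apply: measurable_rVN.
rewrite /sq /cdot; under eq_fun do rewrite !ReIm.
have mr : measurable_fun setT (fun z : X * X => complex.Re (f i z.1) - complex.Re (f i z.2)).
  apply: measurable_funB; first exact: (measurableT_comp m1 (@measurable_fst _ _ _ _)).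
  exact: (measurableT_comp m1 (@measurable_snd _ _ _ _)).
have mi : measurable_fun setT (fun z : X * X => complex.Im (f i z.1) - complex.Im (f i z.2)).
  apply: measurable_funB; first exact: (measurableT_comp m2 (@measurable_fst _ _ _ _)).
  exact: (measurableT_comp m2 (@measurable_snd _ _ _ _)).
by apply: measurable_funD; exact: measurable_funM.
Qed.

Let G_ge0 i z : 0 <= G i z. Proof. by rewrite mulr_ge0 ?cdot_ge0. Qed.

(** After y = x + h and an exchange of the integrals, the inner integral for fixed h in Q is a
    squared translation difference, at most eps. *)
Let double_integral_le i :
  (\int[mu]_x \int[mu]_y (G i (x, y))%:E <= (vol * eps)%:E)%E.
Proof.
pose F (z : X * X) := G i (z.1, z.1 + z.2).
have mF : measurable_fun setT F.
  apply: (measurableT_comp (measurable_G i)).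
  by apply: measurable_fun_pair => //; exact: measurable_rVD.
have FE x h : F (x, h) = \1_Q h * sq (f i (x + h) - f i x).
  rewrite /F /G /chi/= addrAC subrr add0r; congr (_ * _).
  by rewrite /sq /cdot !ReIm; ring.
have -> : (\int[mu]_x \int[mu]_y (G i (x, y))%:E = \int[mu]_x \int[mu]_h (F (x, h))%:E)%E.
  apply: eq_integral => x _.
  have mGx : measurable_fun setT (fun y => (G i (x, y))%:E).
    apply/measurable_EFinP.
    exact: (measurableT_comp (measurable_G i) (@measurable_pair1 _ _ _ _ _)).
  have Gx0 y : (0 <= (G i (x, y))%:E)%E by rewrite lee_fin.
  have := ge0_integral_affine x (oner_neq0 R) mGx Gx0.
  rewrite normr1 expr1n invr1 mul1e => <-.
  by apply: eq_integral => h _; rewrite /F/= scale1r addrC.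
have F0 z : (0 <= (F z)%:E)%E by rewrite lee_fin /F.
rewrite (fubini_tonelli (fun z => (F z)%:E)) //; last exact/measurable_EFinP.
apply: (@le_trans _ _ (\int[mu]_h (eps * \1_Q h)%:E)%E); last first.
  rewrite (integral_EFin_Rintegral (integrableRZ eps iQ)) RintegralZl//.
  by rewrite /Rintegral integral_indic// setIT -/vol mulrC.
apply: ge0_le_integral => //.
- by move=> h _; exact: integral_ge0.
- by apply: (measurable_fun_fubini_tonelli_G (fun z => (F z)%:E)) => //; exact/measurable_EFinP.
- by apply/measurable_EFinP; apply: measurable_funM => //; exact: measurable_indic.
move=> h _; under eq_integral do rewrite FE.
have Lh : L2c (fun x => f i (x + h) - f i x).
  apply: L2cB => //; have := L2c_affine h (@ltr01 R) (Lf i).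
  by under [X in L2c X]eq_fun do rewrite scale1r.
have ih := integrable_cdot Lh Lh.
rewrite (integral_EFin_Rintegral (integrableRZ (\1_Q h) ih)) RintegralZl//.
rewrite lee_fin -/(cip _ _) mulrC indicE; have [hQ|_] := boolP (h \in Q).
  by rewrite ler_pM2r// f_translation// -in_setE.
by rewrite !mulr0.
Qed.

(** [pointwise_estimate] integrated over B and divided by the square of vol. Only the term with the
    factor eps grows with N. *)
Lemma orthonormal_local_mass :
  \sum_i \int[mu]_x (\1_B x * cdot (f i x) (f i x)) <=
  2 * N%:R * eps + 4 * fine (mu B) / vol.
Proof.
pose J i x := \int[mu]_y G i (x, y).
have JE i x : (\int[mu]_y (G i (x, y))%:E = (J i x)%:E)%E.
  by rewrite integral_EFin_Rintegral//; exact: integrable_chi_diff.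
have J0 i x : 0 <= J i x by apply: Rintegral_ge0.
have mJ i : measurable_fun setT (J i).
  apply/measurable_EFinP; rewrite (_ : EFin \o J i = fun x => (\int[mu]_y (G i (x, y))%:E)%E).
    apply: (measurable_fun_fubini_tonelli_F (fun z => (G i z)%:E)) => [|z].
      by apply/measurable_EFinP; exact: measurable_G.
    by rewrite lee_fin.
  by apply/funext => x; rewrite JE.
have JI i : (\int[mu]_x (J i x)%:E <= (vol * eps)%:E)%E.
  by have := double_integral_le i; under eq_integral do rewrite JE.
have iJ i : mu.-integrable setT (EFin \o J i).
  by apply: ge0_integrableR => //; exact: le_lt_trans (JI i) (ltry _).
have RJ i : \int[mu]_x J i x <= vol * eps.
  by have := JI i; rewrite integral_EFin_Rintegral// lee_fin.
have iB : mu.-integrable setT (EFin \o (\1_B : X -> R)) by exact: integrableR_indic.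
have iBf i : mu.-integrable setT (EFin \o (fun x => \1_B x * cdot (f i x) (f i x))).
  apply: (le_integrableR _ _ (integrable_cdot (Lf i) (Lf i))).
    apply: measurable_funM; first exact: measurable_indic.
    exact: integrableR_measurable (integrable_cdot (Lf i) (Lf i)).
  by move=> x; rewrite normrM ler_piMl// indicE; case: (_ \in _); rewrite ?normr1 ?normr0.
have Rsum (w : 'I_N -> X -> R) : (forall i, mu.-integrable setT (EFin \o w i)) ->
   mu.-integrable setT (EFin \o (fun x => \sum_i w i x)) /\
   \int[mu]_x \sum_i w i x = \sum_i \int[mu]_x w i x.
  move=> iw; elim: (index_enum _) => [|j r [IH1 IH2]].
    split; first by under [X in EFin \o X]eq_fun do rewrite big_nil; exact: integrable0.
    rewrite big_nil; under eq_Rintegral do rewrite big_nil.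
    by rewrite Rintegral_cst// mul0r.
  split; first by under [X in EFin \o X]eq_fun do rewrite big_cons; exact: integrableRD.
  under eq_Rintegral do rewrite big_cons.
  by rewrite RintegralD// IH2 big_cons.
have [iS ES] := Rsum _ iBf; have [iSJ ESJ] := Rsum _ iJ.
have v2 : 0 < vol ^+ 2 by rewrite exprn_gt0.
rewrite -(ler_pM2l v2) -ES -RintegralZl//.
apply: (@le_trans _ _ (\int[mu]_x (2 * vol * \sum_i J i x + 4 * vol * \1_B x))).
  apply: le_Rintegral => //.
  - exact: integrableRZ.
  - by apply: integrableRD; exact: integrableRZ.
  (* Off B the left side vanishes, and the error term [J] is nonnegative; it may therefore be
     integrated over the whole space. *)
  move=> x _; rewrite indicE; case: (_ \in B) => /=; last first.
    rewrite big1 => [|i _]; last by rewrite mul0r.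
    by rewrite !mulr0 addr0 mulr_ge0// ?sumr_ge0// mulr_ge0// ltW.
  rewrite mulr1; apply: le_trans (pointwise_estimate x).
  by rewrite mulr_sumr; apply: ler_sum => i _; rewrite mul1r mulrC.
rewrite RintegralD//; [|exact: integrableRZ|exact: integrableRZ].
rewrite !RintegralZl// ESJ.
have -> : \int[mu]_x (\1_B x : R) = fine (mu B).
  by rewrite /Rintegral integral_indic// setIT.
have : \sum_i \int[mu]_x J i x <= N%:R * (vol * eps).
  apply: (@le_trans _ _ (\sum_(i < N) (vol * eps))); first exact: ler_sum.
  by rewrite sumr_const card_ord mulr_natl.
move=> h.
have -> : vol ^+ 2 * (2 * N%:R * eps + 4 * fine (mu B) / vol) =
   2 * vol * (N%:R * (vol * eps)) + 4 * vol * fine (mu B).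
  by field; rewrite gt_eqF.
by rewrite lerD2r ler_wpM2l// mulr_ge0// ltW.
Qed.

End bessel.

(** * Eigenfunctions *)

Section eigenfunctions.
Context {R : realType} {d : nat}.
Local Notation X := 'rV[R]_d.
Local Notation mu := (@lebesgue_rV R d).
Local Open Scope complex_scope.
Variables (Psi : R -> R) (V : X -> R) (c2 d2 m c gamma : R).
Hypothesis Psi_measurable : measurable_fun (`[0, +oo[ : set R) Psi.
Hypothesis Psi_derivable : forall u : R, 0 < u -> derivable Psi u 1.
Hypothesis Psi'_continuous : forall u : R, 0 < u -> {for u, continuous (derive1 Psi)}.
Hypothesis Psi_ge0 : forall u : R, 0 <= u -> 0 <= Psi u.
Hypothesis Psi'_ge0 : forall u : R, 0 < u -> 0 <= derive1 Psi u.
Hypothesis Psi0 : Psi 0 = 0.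
Hypothesis c2_ge0 : 0 <= c2.
Hypothesis d2_ge0 : 0 <= d2.
Hypothesis H3 : forall u : R, 0 <= u -> u * derive1 Psi u <= c2 * Psi u + d2.
Hypothesis m_gt0 : 0 < m.
Hypothesis H4 : forall u : R, 0 <= u -> m * Psi u <= 2 * u * derive1 Psi u.
Hypothesis V_C1 : C1 V.
Hypothesis c_gt0 : 0 < c.
Hypothesis gamma_gt0 : 0 < gamma.
Hypothesis V_le : forall x, `|V x| <= c * japanese x `^ (- gamma).
Hypothesis gradV_le : forall x, enorm (grad V x) <= c * japanese x `^ (- 1 - gamma).

Definition symbol (xi : X) : R := Psi (enorm xi ^+ 2 / 2).

Local Notation W := (@weight R d c gamma).

Let arg_ge0 (xi : X) : 0 <= enorm xi ^+ 2 / 2.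
Proof. by rewrite divr_ge0// sqr_ge0. Qed.

Let measurable_arg : measurable_fun setT (fun xi : X => enorm xi ^+ 2 / 2).
Proof.
apply: measurable_funM => //.
rewrite (_ : (fun x => _) = fun x => dotv x x); last by apply/funext => x; rewrite enorm_sqr.
exact: measurable_dotv.
Qed.

Let measurable_Psi_comp (g : X -> R) : measurable_fun setT g -> (forall x, 0 <= g x) ->
  measurable_fun setT (fun x => Psi (g x)).
Proof.
move=> mg g0; have sub : g @` setT `<=` `[0, +oo[%classic.
  by move=> _ [x _ <-] /=; rewrite in_itv/= g0.
exact: (measurable_comp _ sub Psi_measurable mg).
Qed.

Lemma measurable_symbol : measurable_fun setT symbol.
Proof. exact: measurable_Psi_comp. Qed.

Lemma symbol_ge0 xi : 0 <= symbol xi.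
Proof. exact: Psi_ge0. Qed.

Let mV : measurable_fun setT V := measurable_potential V_C1.

Let V_bounded x : `|V x| <= c.
Proof. exact: le_trans (V_le x) (weight_le c_gt0 gamma_gt0 x). Qed.

(** The eigenvalue equation solved for the kinetic term, H_0 f = lambda f - V f, with the transform
    kept as a datum. No almost everywhere equality is left in it. *)
Definition eigenpair (lambda : R[i]) (f fhat : X -> R[i]) :=
  is_fourier f fhat /\
  is_fourier (fun x => lambda * f x - rmul V f x) (rmul symbol fhat).

Lemma eigenfunction_eigenpair lambda f : eigenfunctions Psi V lambda f ->
  exists fhat, eigenpair lambda f fhat.
Proof.
move=> [h [fhat F1 F2] [Lg gE]]; exists fhat; split => //.
have [Lf _] := is_fourier_L2 F1.
apply: (is_fourier_ae F2).
  by apply: L2cB; [exact: L2cZ|exact: L2c_rmul_bounded mV V_bounded Lf].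
move: gE; apply: filterS => x /= H Tx; rewrite (H Tx).
by rewrite /rmul addrK.
Qed.

Lemma eigenpair_L2 lambda f fhat : eigenpair lambda f fhat ->
  [/\ L2c f, L2c (rmul V f), L2c fhat & L2c (rmul symbol fhat)].
Proof.
move=> [F1 F2]; have [Lf Lfh] := is_fourier_L2 F1; have [_ Ls] := is_fourier_L2 F2.
by split => //; exact: L2c_rmul_bounded mV V_bounded Lf.
Qed.

(** The real inner product with i f extracts imaginary parts: symbol and potential are real and
    contribute 0, so only the imaginary part of lambda times the squared norm remains. *)
Lemma eigenpair_real lambda f fhat : eigenpair lambda f fhat -> cip f f != 0 ->
  complex.Im lambda = 0.
Proof.
move=> E fn0; have [Lf LVf Lfh Ls] := eigenpair_L2 E; case: E => F1 F2.
have := is_fourier_cip (is_fourierZ 'i F1) F2.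
have -> : cip (fun xi => 'i * fhat xi) (rmul symbol fhat) = 0.
  rewrite /cip (_ : (fun x => _) = fun=> 0).
    by rewrite Rintegral_cst// mul0r.
  by apply/funext => xi; rewrite /rmul cdot_rmulr /cdot !ReIm/=; ring.
have -> : cip (fun x => 'i * f x) (fun x => lambda * f x - rmul V f x) =
    complex.Im lambda * cip f f.
  rewrite /cip -RintegralZl//; last exact: integrable_cdot.
  by apply: eq_Rintegral => x _; rewrite /cdot /rmul !ReIm/=; ring.
by move=> /esym/eqP; rewrite mulf_eq0 (negbTE fn0) orbF => /eqP.
Qed.

(** Symmetry of H_0 and V in the real inner product gives (l1 - l2) <f1, f2> = 0. *)
Lemma eigenpair_orthogonal (l1 l2 : R) f1 f2 g1 g2 : l1 != l2 ->
  eigenpair l1%:C f1 g1 -> eigenpair l2%:C f2 g2 -> cip f1 f2 = 0.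
Proof.
move=> l12 E1 E2.
have [Lf1 LV1 Lg1 Ls1] := eigenpair_L2 E1; have [Lf2 LV2 Lg2 Ls2] := eigenpair_L2 E2.
case: E1 E2 => F1 H1 [F2 H2].
have := is_fourier_cip F1 H2; have := is_fourier_cip H1 F2.
rewrite cip_rmulC => -> /eqP.
rewrite cipBl ?cipBr ?cipZl ?cipZr//; try exact: L2cZ.
rewrite cip_rmulC -subr_eq0 opprB addrA subrK -mulrBl mulf_eq0 subr_eq0 (negbTE l12)/=.
by move=> /eqP.
Qed.

Lemma eigenpair_energy (l : R) f fhat : eigenpair l%:C f fhat ->
  l * cip f f = cip fhat (rmul symbol fhat) + cip f (rmul V f).
Proof.
move=> E; have [Lf LVf Lfh Ls] := eigenpair_L2 E; case: E => F1 F2.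
rewrite (is_fourier_cip F1 F2) cipBr//; last exact: L2cZ.
by rewrite cipZr// subrK.
Qed.

Lemma L2c_rmul_weight f : L2c f -> L2c (rmul W f).
Proof.
apply: (@L2c_rmul_bounded _ _ _ c); first exact: measurable_weight.
by move=> x; rewrite ger0_norm ?weight_ge0 ?weight_le.
Qed.

Lemma cip_potential_le f : L2c f -> `|cip f (rmul V f)| <= cip f (rmul W f).
Proof.
move=> Lf; have LV := L2c_rmul_bounded mV V_bounded Lf.
have LW := L2c_rmul_weight Lf.
have iV := integrable_cdot Lf LV.
apply: le_trans (le_normr_Rintegral _ iV) _ => //.
apply: le_Rintegral => //; [exact: integrable_norm iV|exact: integrable_cdot|].
move=> x _; rewrite !cdot_rmulr normrM (ger0_norm (cdot_ge0 _)).
by rewrite ler_wpM2r ?cdot_ge0.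
Qed.

Let s (k : nat) : R := k.+1%:R^-1.

Let s_gt0 k : 0 < s k. Proof. by rewrite invr_gt0. Qed.

Let s_le1 k : s k <= 1. Proof. by rewrite invf_le1// ler1n. Qed.

Let cvg_1s : 1 + s k @[k --> \oo] --> (1 : R).
Proof.
by rewrite -[X in _ --> X]addr0; apply: cvgD; [exact: cvg_cst|exact: cvg_harmonic].
Qed.

Let a_gt0 k : 0 < 1 + s k. Proof. by rewrite addr_gt0. Qed.

Let q (k : nat) (xi : X) : R := (symbol xi - symbol ((1 + s k)^-1 *: xi)) / s k.

Let qE k xi : q k xi =
  (Psi (enorm xi ^+ 2 / 2) - Psi (enorm xi ^+ 2 / 2 / (1 + s k) ^+ 2)) / s k.
Proof.
rewrite /q /symbol enormZ exprMn real_normK ?num_real// exprVn.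
congr ((_ - Psi _) / _). by ring.
Qed.

(** The commutator of H_0 with a finite dilation, evaluated twice. In Fourier space it is the
    difference quotient of the symbol, in position space that of the potential, which
    [potential_dilation] and AM-GM bound. *)
Let virial_dilation (l : R) f fhat k : eigenpair l%:C f fhat ->
  L2c (rmul (q k) fhat) ->
  (1 + s k) ^- d * cip (fun xi => fhat ((1 + s k)^-1 *: xi)) (rmul (q k) fhat) <=
  2^-1 * (cip (fun x => f ((1 + s k) *: x)) (rmul W (fun x => f ((1 + s k) *: x))) +
          cip f (rmul W f)).
Proof.
move=> E Lq; have [Lf LVf Lfh Ls] := eigenpair_L2 E; case: E => F1 F2.
set a := 1 + s k; have a0 : 0 < a := a_gt0 k.
have ia0 : 0 < a^-1 by rewrite invr_gt0.
pose G x : R[i] := l%:C * f x - rmul V f x.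
have D1 := is_fourier_affine 0 a0 F1; have D2 := is_fourier_affine 0 a0 F2.
have LD : L2c (fun x => f (a *: x)).
  by have := L2c_affine 0 a0 Lf; under [X in L2c X]eq_fun do rewrite addr0.
have Lh : L2c (fun xi => fhat (a^-1 *: xi)).
  by have := L2c_affine 0 ia0 Lfh; under [X in L2c X]eq_fun do rewrite addr0.
have Lhs : L2c (fun xi => rmul symbol fhat (a^-1 *: xi)).
  by have := L2c_affine 0 ia0 Ls; under [X in L2c X]eq_fun do rewrite addr0.
have mE xi : affine_multiplier a (0 : X) xi = (a ^- d)%:C.
  rewrite /affine_multiplier /dotv big1; last by move=> i _; rewrite mxE mul0r.
  by rewrite /expi cos0 sin0; apply: ReIm_inj; rewrite !ReIm/= ?mulr1 ?mulr0 ?mul0r ?subr0 ?addr0.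
have P1 := is_fourier_cip D1 F2; have P2 := is_fourier_cip D2 F1.
have LDW := L2c_rmul_weight LD.
have LfW := L2c_rmul_weight Lf.
(* The eigenvalue multiplies the same pairing of f(a x) with f(x) in both terms and cancels. *)
have E1 : cip (fun x => f (a *: x + 0)) (fun x => l%:C * f x - rmul V f x) -
          cip (fun x => l%:C * f (a *: x + 0) - rmul V f (a *: x + 0)) f =
   \int[mu]_x ((V (a *: x) - V x) * cdot (f (a *: x)) (f x)).
  rewrite /cip -RintegralB//; last 2 first.
  - apply: integrable_cdot; first exact: L2c_affine.
    by apply: L2cB => //; exact: L2cZ.
  - apply: integrable_cdot => //.
    by apply: L2cB; [exact: L2cZ (L2c_affine 0 a0 Lf)|exact: (L2c_affine 0 a0 LVf)].
  by apply: eq_Rintegral => x _; rewrite /rmul addr0 /cdot !ReIm/=; ring.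
have E2 : cip (fun xi => affine_multiplier a 0 xi * fhat (a^-1 *: xi)) (rmul symbol fhat) -
   cip (fun xi => affine_multiplier a 0 xi * rmul symbol fhat (a^-1 *: xi)) fhat =
   s k * (a ^- d * cip (fun xi => fhat (a^-1 *: xi)) (rmul (q k) fhat)).
  have M1 := L2c_affine_multiplier 0 a0 Lfh.
  have M2 := L2c_affine_multiplier 0 a0 Ls.
  have iq := integrable_cdot Lh Lq.
  rewrite /cip -RintegralB//; [|exact: integrable_cdot|exact: integrable_cdot].
  rewrite -!RintegralZl//; last exact: integrableRZ.
  apply: eq_Rintegral => xi _; rewrite !mE /rmul !cdot_rmulr !cdot_rmull.
  by rewrite /q -/a; field; rewrite expf_neq0 ?gt_eqF.
have {P1 P2} E3 : a ^- d * cip (fun xi => fhat (a^-1 *: xi)) (rmul (q k) fhat) =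
   (s k)^-1 * \int[mu]_x ((V (a *: x) - V x) * cdot (f (a *: x)) (f x)).
  by rewrite -E1 -P1 -P2 E2 mulKf// gt_eqF.
rewrite E3.
have i1 : mu.-integrable setT (EFin \o (fun x => (V (a *: x) - V x) * cdot (f (a *: x)) (f x))).
  have mVV : measurable_fun setT (fun x : X => V (a *: x) - V x).
    apply: measurable_funB => //; apply: (measurableT_comp mV).
    by apply: measurable_rVZ => //; exact: measurable_cst.
  have bVV x : `|V (a *: x) - V x| <= c + c.
    by rewrite (le_trans (ler_normB _ _))// lerD.
  have := integrable_cdot LD (L2c_rmul_bounded mVV bVV Lf).
  by under [X in EFin \o X]eq_fun do rewrite cdot_rmulr.
rewrite ler_pdivrMl//.
apply: (le_trans (ler_norm _)); apply: (le_trans (le_normr_Rintegral _ i1)) => //.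
rewrite /cip -RintegralD//; [|exact: integrable_cdot|exact: integrable_cdot].
have i2 := integrableRD (integrable_cdot LD LDW) (integrable_cdot Lf LfW).
rewrite -!RintegralZl//; last exact: integrableRZ.
apply: le_Rintegral => //; [exact: integrable_norm i1|by do 2 apply: integrableRZ|].
move=> x _; rewrite normrM !cdot_rmulr -mulrDr.
rewrite [leRHS](_ : _ = (s k * W x) *
   (2^-1 * (cdot (f (a *: x)) (f (a *: x)) + cdot (f x) (f x)))); last by ring.
apply: ler_pM => //; last exact: cdot_AMGM.
rewrite distrC; exact: potential_dilation.
Qed.

(* The dilation quotients of the potential need not converge: they are bounded by [W],
   and AM-GM together with the continuity of dilations gives the limit of the bound. *)
Lemma virial (l : R) f fhat : eigenpair l%:C f fhat ->
  m * cip fhat (rmul symbol fhat) <= cip f (rmul W f).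
Proof.
move=> E; have [Lf LVf Lfh Ls] := eigenpair_L2 E.
pose q0 (xi : X) : R := 2 * (enorm xi ^+ 2 / 2) * derive1 Psi (enorm xi ^+ 2 / 2).
have mq k : measurable_fun setT (q k).
  apply: measurable_funM => //; apply: measurable_funB; first exact: measurable_symbol.
  apply: (measurableT_comp measurable_symbol).
  by apply: measurable_rVZ => //; exact: measurable_cst.
have cq xi : q k xi @[k --> \oo] --> q0 xi.
  rewrite (_ : (fun k => _) = fun k => (Psi (enorm xi ^+ 2 / 2) -
    Psi (enorm xi ^+ 2 / 2 / (1 + s k) ^+ 2)) / s k); last by apply/funext => k; rewrite qE.
  exact: (cvg_symbol_dilation_quotient Psi_derivable (arg_ge0 xi) (@Psi'_continuous _)).
have bq k xi : `|q k xi| <= 8 * (c2 * symbol xi + d2).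
  have : 0 < s k <= 1 by rewrite s_gt0 s_le1.
  move=> /(symbol_dilation_quotient Psi_derivable Psi_ge0 Psi'_ge0 Psi0 H3
    c2_ge0 d2_ge0 (arg_ge0 xi)).
  by rewrite -qE => /andP[h1 h2]; rewrite ger0_norm.
(* The majorant supplied by H.3 is affine in the symbol, so its product with [fhat] is square
   integrable because f lies in the domain of H_0. *)
have LM : L2c (rmul (fun xi => 8 * (c2 * symbol xi + d2)) fhat).
  rewrite (_ : rmul _ _ = fun xi => (8 * c2)%:C * rmul symbol fhat xi + (8 * d2)%:C * fhat xi).
    by apply: L2cD; exact: L2cZ.
  by apply/funext => xi; apply: ReIm_inj; rewrite /rmul !ReIm/=; ring.
have [Lq0 Lqk cqf] := cvg_L2c_rmul mq cq bq Lfh LM.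
have [LDf cDf] := cvg_L2c_dilation a_gt0 cvg_1s Lf.
have iva k : 0 < (1 + s k)^-1 by rewrite invr_gt0.
have cva : (1 + s k)^-1 @[k --> \oo] --> (1 : R).
  by rewrite -[X in _ --> X]invr1; apply: cvgV => //; exact: oner_neq0.
have [LDh cDh] := cvg_L2c_dilation iva cva Lfh.
have cl := cvg_cip LDh Lqk Lfh Lq0 cDh cqf.
have LW g : L2c g -> L2c (rmul W g) by exact: L2c_rmul_weight.
have cW : cip (fun x => rmul W (fun x => f ((1 + s k) *: x)) x - rmul W f x)
    (fun x => rmul W (fun x => f ((1 + s k) *: x)) x - rmul W f x) @[k --> \oo] --> 0.
  have c0 : c ^+ 2 * cip (fun x => f ((1 + s k) *: x) - f x) (fun x => f ((1 + s k) *: x) - f x)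
      @[k --> \oo] --> 0.
    by rewrite -[X in _ --> X](mulr0 (c ^+ 2)); apply: cvgM => //; exact: cvg_cst.
  apply: (squeeze_cvgr _ (cvg_cst 0) c0); apply: nearW => k; rewrite cip_ge0/=.
  rewrite /cip -RintegralZl//; last by apply: integrable_cdot; exact: L2cB.
  apply: le_Rintegral => //.
  - by apply: integrable_cdot; apply: L2cB; exact: LW.
  - by apply: integrableRZ; apply: integrable_cdot; exact: L2cB.
  move=> x _; rewrite /rmul -mulrBr cdot_rmulr cdot_rmull mulrA -expr2.
  rewrite ler_wpM2r ?cdot_ge0// lerXn2r ?nnegrE ?weight_ge0 ?weight_le//.
  exact: ltW.
have cr := cvg_cip LDf (fun k => LW _ (LDf k)) Lf (LW _ Lf) cDf cW.
have : cip fhat (rmul q0 fhat) <= cip f (rmul W f).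
  have -> : cip f (rmul W f) = 2^-1 * (cip f (rmul W f) + cip f (rmul W f)) by lra.
  rewrite -[leLHS]mul1r.
  have cp : (1 + s k) ^- d @[k --> \oo] --> (1 : R).
    rewrite [X in _ --> X](_ : 1 = 1 ^- d :> R); last by rewrite expr1n invr1.
    apply: cvgV; first by rewrite expr1n oner_neq0.
    apply: (cvg_comp (fun k => 1 + s k) (fun r : R => r ^+ d) cvg_1s).
    exact: (@exprn_continuous R d 1).
  apply: (ler_cvg_to (cvgM cp cl) (cvgM (cvg_cst _) (cvgD cr (cvg_cst _)))).
  by apply: nearW => k; exact: (virial_dilation E (Lqk k)).
(* What remains is H.4 at u = |xi|^2 / 2, integrated against the squared modulus of [fhat]. *)
apply: le_trans.
rewrite /cip -RintegralZl//; last exact: integrable_cdot.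
apply: le_Rintegral => //.
- by apply: integrableRZ; exact: integrable_cdot.
- exact: integrable_cdot.
move=> xi _; rewrite !cdot_rmulr mulrA ler_wpM2r ?cdot_ge0//.
exact: H4.
Qed.

Hypothesis Psi_neq0 : exists2 u, 0 <= u & Psi u != 0.

Lemma dotv_le_entries (h xi : X) r : (forall i, `|h ord0 i| <= r) ->
  `|dotv h xi| <= d%:R * (r * enorm xi).
Proof.
move=> hr; apply: le_trans (ler_norm_sum _ _ _) _.
apply: (@le_trans _ _ (\sum_(i < d) (r * enorm xi))).
  by apply: ler_sum => i _; rewrite normrM ler_pM// entry_le_enorm.
by rewrite sumr_const card_ord mulr_natl.
Qed.

(* Low frequencies are controlled by the continuity of cos at 0, high frequencies by the
   kinetic energy, as Psi tends to infinity. *)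
Lemma translation_equicontinuous eps K : 0 < eps ->
  exists2 delta, 0 < delta & forall f fhat h,
    is_fourier f fhat -> L2c (rmul symbol fhat) ->
    cip fhat (rmul symbol fhat) <= K -> cip f f = 1 -> ball (0 : X) delta h ->
    cip (fun x => f (x + h) - f x) (fun x => f (x + h) - f x) <= eps.
Proof.
move=> eps0.
have [rho rho0 rhoP] : exists2 rho : R, 0 < rho &
    forall t : R, `|t| < rho -> 2 - 2 * cos t <= eps / 2.
  have e4 : 0 < eps / 4 by rewrite divr_gt0.
  have /cvgrPdist_le/(_ _ e4)/nbhs_ballP[r /= r0 rP] := @continuous_cos R 0.
  exists r => // t tr; have := rP t; rewrite /ball/= sub0r normrN => /(_ tr).
  by rewrite cos0 => h1; have := ler_norm (1 - cos t); lra.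
(* Where Psi >= A, the trivial bound 2 - 2 cos <= 4 is at most (4 / A) Psi, whose total contribution
   4 K / A is at most eps / 2. The added 1 keeps A positive. *)
pose A := 8 * `|K| / eps + 1.
have A0 : 0 < A by rewrite ltr_pwDr// divr_ge0 ?mulr_ge0// ltW.
have [M M0 AM] := symbol_unbounded Psi_derivable Psi_ge0 Psi'_ge0 Psi0 m_gt0 H4 Psi_neq0 A.
pose r0 := Num.sqrt (2 * M).
have D0 : 0 < d%:R * r0 + 1 by rewrite ltr_pwDr// mulr_ge0// sqrtr_ge0.
(* For frequencies below [r0] and h in the sup-norm ball, |h.xi| <= d delta r0 < rho. *)
exists (rho / (d%:R * r0 + 1)); first by rewrite divr_gt0.
move=> f fhat h F Ls EK f1 hd.
have hr i : `|h ord0 i| <= rho / (d%:R * r0 + 1).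
  move: hd; rewrite ball_rVE ?divr_gt0// => /(_ i).
  by rewrite /ball/= mxE sub0r normrN => /ltW.
have low (xi : X) : enorm xi ^+ 2 / 2 < M -> `|dotv h xi| < rho.
  move=> xiM; apply: le_lt_trans (dotv_le_entries xi hr) _.
  have xr : enorm xi <= r0.
    have r02 : r0 ^+ 2 = 2 * M by rewrite sqr_sqrtr// mulr_ge0// ltW.
    by rewrite -(ler_pXn2r (n := 2)) ?nnegrE ?enorm_ge0 ?sqrtr_ge0// r02; lra.
  have -> : d%:R * (rho / (d%:R * r0 + 1) * enorm xi) =
     rho * (d%:R * enorm xi) / (d%:R * r0 + 1) by ring.
  rewrite ltr_pdivrMr// ltr_pM2l//.
  have : d%:R * enorm xi <= d%:R * r0 by rewrite ler_wpM2l.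
  lra.
have bound (xi : X) : 2 - 2 * cos (dotv h xi) <= eps / 2 + 4 / A * symbol xi.
  have S0 : 0 <= 4 / A * symbol xi by rewrite mulr_ge0 ?symbol_ge0// divr_ge0// ltW.
  have [/low/rhoP|Mxi] := ltP (enorm xi ^+ 2 / 2) M; first lra.
  have : 4 <= 4 / A * symbol xi.
    rewrite mulrAC ler_pdivlMr// ler_pM2l//.
    apply: le_trans AM _.
    exact: (symbol_nondecreasing Psi_derivable Psi_ge0 Psi'_ge0 Psi0 (ltW M0)).
  have := cos_geN1 (dotv h xi); lra.
have [Lf Lfh] := is_fourier_L2 F.
have := is_fourier_norm (is_fourierD (is_fourier_affine h (@ltr01 R) F) (is_fourierZ (-1) F)).
have -> : cip (fun x => f (1 *: x + h) + -1 * f x) (fun x => f (1 *: x + h) + -1 * f x) =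
   cip (fun x => f (x + h) - f x) (fun x => f (x + h) - f x).
  by apply: eq_Rintegral => x _; rewrite scale1r mulN1r.
move=> <-.
(* The transform of f(x + h) - f(x) is (exp(i h.xi) - 1) fhat, and |exp(i t) - 1|^2 = 2 - 2 cos
   t. *)
have -> : cip (fun xi => affine_multiplier 1 h xi * fhat (1^-1 *: xi) + -1 * fhat xi)
    (fun xi => affine_multiplier 1 h xi * fhat (1^-1 *: xi) + -1 * fhat xi) =
    \int[mu]_xi ((2 - 2 * cos (dotv h xi)) * cdot (fhat xi) (fhat xi)).
  apply: eq_Rintegral => xi _.
  rewrite /affine_multiplier invr1 !scale1r expr1n invr1 mul1r.
  have -> : expi (dotv h xi) * fhat xi + -1 * fhat xi = (expi (dotv h xi) - 1) * fhat xi.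
    by rewrite mulrBl mul1r mulN1r.
  rewrite cdot_mul; congr (_ * _); rewrite /cdot !ReIm/=.
  by have := cos2Dsin2 (dotv h xi); lra.
have i1 := integrable_cdot Lfh Lfh; have i2 := integrable_cdot Lfh Ls.
have n1 : cip fhat fhat = 1 by rewrite (is_fourier_norm F).
apply: (@le_trans _ _ (\int[mu]_xi (eps / 2 * cdot (fhat xi) (fhat xi) +
    4 / A * cdot (fhat xi) (rmul symbol fhat xi)))).
  apply: le_Rintegral => //.
  - apply: (le_integrableR _ _ (integrableRZ 4 i1)).
      apply: measurable_funM; last exact: integrableR_measurable i1.
      apply: measurable_funB => //; apply: measurable_funM => //.
      exact: measurable_cos_dotv.
    move=> xi; rewrite !normrM ler_wpM2r// [leRHS]ger0_norm//.
    have := cos_geN1 (dotv h xi); have := cos_le1 (dotv h xi) => *.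
    by rewrite ler_norml; apply/andP; split; lra.
  - by apply: integrableRD; exact: integrableRZ.
  move=> xi _; rewrite /rmul cdot_rmulr.
  rewrite [leRHS](_ : _ = (eps / 2 + 4 / A * symbol xi) * cdot (fhat xi) (fhat xi)).
    by apply: ler_wpM2r; [exact: cdot_ge0|exact: bound].
  by ring.
rewrite RintegralD ?RintegralZl//; [|exact: integrableRZ|exact: integrableRZ].
rewrite -!/(cip _ _) n1.
have : 4 / A * cip fhat (rmul symbol fhat) <= eps / 2.
  rewrite mulrAC ler_pdivrMr//.
  have := ler_norm K; have : eps / 2 * A = 4 * `|K| + eps / 2.
    by rewrite /A; field; rewrite gt_eqF.
  lra.
lra.
Qed.

Lemma eigenpair_count eta : 0 < eta -> exists N0 : nat,
  forall (N : nat) (f fhat : 'I_N -> X -> R[i]) (l : 'I_N -> R),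
    (forall i, eigenpair (l i)%:C (f i) (fhat i)) ->
    (forall i j, cip (f i) (f j) = (i == j)%:R) ->
    (forall i, eta <= `|l i|) -> (N <= N0)%N.
Proof.
move=> eta0.
have m1 : 0 < m^-1 + 1 by rewrite addr_gt0// invr_gt0.
(* From |lambda| <= (1/m + 1) <f, W f> and |lambda| >= eta, [kappa] is a lower bound of <f, W f>. *)
pose kappa := eta / (m^-1 + 1).
have kappa0 : 0 < kappa by rewrite divr_gt0.
(* With W <= kappa / 2 outside B and W <= c inside, at least kappa / 2 of <f, W f> comes from B, so
   the mass in B is at least [beta]. *)
pose beta := kappa / (2 * c).
have beta0 : 0 < beta by rewrite divr_gt0// mulr_gt0.
have k2 : 0 < kappa / 2 by rewrite divr_gt0.
have [r _ rP] := weight_decay (d := d) c_gt0 gamma_gt0 k2.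
set B : set X := ball (0 : X) r in rP.
have b4 : 0 < beta / 4 by rewrite divr_gt0.
(* By the virial inequality and W <= c, the kinetic energy is at most c / m. The tolerance beta / 4
   makes the N-dependent term of [orthonormal_local_mass] equal to N beta / 2. *)
have [delta delta0 deltaP] := translation_equicontinuous (c / m) b4.
pose vol := fine (mu (ball (0 : X) delta)).
(* The inequality N beta <= N beta / 2 + 4 mu(B) / vol solved for N. *)
exists (Num.trunc (8 * fine (mu B) / (vol * beta))).+1 => N f fhat l E ON le.
have L i := eigenpair_L2 (E i).
have Lf i : L2c (f i) by case: (L i).
have LW i : L2c (rmul W (f i)) by exact: L2c_rmul_weight.
have f1 i : cip (f i) (f i) = 1 by rewrite ON eqxx.
have mB : measurable B by exact: measurable_ball_rV.
have iB i : mu.-integrable setT (EFin \o (fun x => \1_B x * cdot (f i x) (f i x))).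
  apply: (le_integrableR _ _ (integrable_cdot (Lf i) (Lf i))).
    apply: measurable_funM; first exact: measurable_indic.
    exact: integrableR_measurable (integrable_cdot (Lf i) (Lf i)).
  by move=> x; rewrite normrM ler_piMl// indicE; case: (_ \in _); rewrite ?normr1 ?normr0.
have Wc i : cip (f i) (rmul W (f i)) <= c.
  rewrite -[leRHS]mulr1 -(f1 i) /cip -RintegralZl//; last exact: integrable_cdot.
  apply: le_Rintegral => //; [exact: integrable_cdot|by apply: integrableRZ; exact: integrable_cdot|].
  by move=> x _; rewrite cdot_rmulr ler_wpM2r ?cdot_ge0// weight_le.
have mass i : beta <= \int[mu]_x (\1_B x * cdot (f i x) (f i x)).
  have h1 : cip (f i) (rmul W (f i)) <=
      kappa / 2 + c * \int[mu]_x (\1_B x * cdot (f i x) (f i x)).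
    have -> : kappa / 2 = kappa / 2 * cip (f i) (f i) by rewrite f1 mulr1.
    rewrite /cip -!RintegralZl//; last exact: integrable_cdot.
    rewrite -RintegralD//; last 2 first.
      by apply: integrableRZ; exact: integrable_cdot.
      exact: integrableRZ.
    apply: le_Rintegral => //; first exact: integrable_cdot.
      by apply: integrableRD; apply: integrableRZ => //; exact: integrable_cdot.
    move=> x _; rewrite /rmul cdot_rmulr.
    rewrite [leRHS](_ : _ = (kappa / 2 + c * \1_B x) * cdot (f i x) (f i x)); last by ring.
    apply: ler_wpM2r; first exact: cdot_ge0.
    have [xB|xB] := pselect (B x); rewrite indicE.
      have := weight_le c_gt0 gamma_gt0 x; rewrite mem_set//= mulr1; lra.
    by rewrite memNset//= mulr0 addr0 rP.
  have h2 := virial (E i).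
  have h3 := cip_potential_le (Lf i).
  have h4 := eigenpair_energy (E i); rewrite f1 mulr1 in h4.
  have h5 : kappa <= cip (f i) (rmul W (f i)).
    rewrite ler_pdivrMr//; apply: le_trans (le i) _; rewrite h4.
    apply: le_trans (ler_normD _ _) _; rewrite mulrDr mulr1 lerD//.
    rewrite ger0_norm; first by rewrite ler_pdivlMr// mulrC.
    apply: Rintegral_ge0 => xi _; rewrite cdot_rmulr.
    by rewrite mulr_ge0 ?cdot_ge0 ?symbol_ge0.
  by rewrite ler_pdivrMr ?mulr_gt0//; lra.
have tr i h : ball (0 : X) delta h ->
  cip (fun x => f i (x + h) - f i x) (fun x => f i (x + h) - f i x) <= beta / 4.
  move=> hd; have [F _] := E i; case: (L i) => _ _ _ Ls.
  apply: (deltaP _ _ _ F Ls) => //.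
  by rewrite ler_pdivlMr// mulrC (le_trans (virial (E i))).
have := orthonormal_local_mass Lf ON delta0 mB (lebesgue_rV_ball_lty _ _) tr.
rewrite -/vol => H.
have vol0 : 0 < vol by exact: lebesgue_rV_ball_gt0.
have S : N%:R * beta <= \sum_i \int[mu]_x (\1_B x * cdot (f i x) (f i x)).
  rewrite mulr_natl -{1}(card_ord N) -sumr_const.
  by apply: ler_sum => i _; exact: mass.
have : N%:R <= 8 * fine (mu B) / (vol * beta) :> R.
  have vb : 0 < vol * beta by exact: mulr_gt0.
  rewrite (ler_pdivlMr _ _ vb); have {H S} := le_trans S H.
  move=> H; have : N%:R * beta / 2 * vol <= 4 * fine (mu B).
    by rewrite -ler_pdivlMr//; lra.
  lra.
by move=> h; rewrite -(ler_nat R) (le_trans h)// ltW// truncnS_gt.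
Qed.

(** * From eigenpairs to the point spectrum *)

Lemma eigenpair_eigenfunction lambda f fhat : eigenpair lambda f fhat ->
  eigenfunctions Psi V lambda f.
Proof.
move=> E; have [Lf LVf Lfh Ls] := eigenpair_L2 E; case: E => F1 F2.
exists (fun x => lambda * f x - rmul V f x); first by exists fhat.
split; first by apply/Lp2P; exact: L2cZ.
by apply: aeW => x _; rewrite /rmul subrK.
Qed.

Let is_fourier_ext (f f' g g' : X -> R[i]) : f =1 f' -> g =1 g' ->
  is_fourier f g -> is_fourier f' g'.
Proof. by move=> /funext -> /funext ->. Qed.

Lemma eigenpairZ lambda (a : R[i]) f fhat : eigenpair lambda f fhat ->
  eigenpair lambda (fun x => a * f x) (fun xi => a * fhat xi).
Proof.
move=> [F1 F2]; split; first exact: is_fourierZ.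
by apply: (is_fourier_ext _ _ (is_fourierZ a F2)) => x; rewrite /rmul; ring.
Qed.

Lemma eigenpairD lambda f g fhat ghat : eigenpair lambda f fhat ->
  eigenpair lambda g ghat ->
  eigenpair lambda (fun x => f x + g x) (fun xi => fhat xi + ghat xi).
Proof.
move=> [F1 F2] [G1 G2]; split; first exact: is_fourierD.
by apply: (is_fourier_ext _ _ (is_fourierD F2 G2)) => x; rewrite /rmul; ring.
Qed.

Lemma eigenpair_sum lambda (I : Type) (r : seq I) (f fhat : I -> X -> R[i]) g ghat :
  eigenpair lambda g ghat -> (forall i, eigenpair lambda (f i) (fhat i)) ->
  eigenpair lambda (fun x => g x + \sum_(i <- r) f i x)
                   (fun xi => ghat xi + \sum_(i <- r) fhat i xi).
Proof.
have ext (f1 f1' g1 g1' : X -> R[i]) : f1 =1 f1' -> g1 =1 g1' ->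
    eigenpair lambda f1 g1 -> eigenpair lambda f1' g1' by move=> /funext -> /funext ->.
move=> Eg Ef; elim: r => [|i r IH].
  by apply: (ext _ _ _ _ _ _ Eg) => x; rewrite big_nil addr0.
by apply: (ext _ _ _ _ _ _ (eigenpairD (Ef i) IH)) => x; rewrite big_cons addrCA.
Qed.

(** The scaling factor is exposed so that orthogonality relations survive normalization. *)
Lemma eigenpair_normalize lambda f fhat : eigenpair lambda f fhat -> cip f f != 0 ->
  exists f' fhat', eigenpair lambda f' fhat' /\ cip f' f' = 1 /\
    exists a : R, f' = fun x => a%:C * f x.
Proof.
move=> E f0; have [Lf _ _ _] := eigenpair_L2 E.
pose a : R := (Num.sqrt (cip f f))^-1.
exists (fun x => a%:C * f x), (fun xi => a%:C * fhat xi).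
split; first exact: eigenpairZ.
split; last by exists a.
rewrite cipZl ?cipZr//; last exact: L2cZ.
by rewrite mulrA -expr2 exprVn sqr_sqrtr ?cip_ge0// mulVf.
Qed.

Lemma spec_p_real lambda : spec_p Psi V lambda ->
  exists (l : R) f fhat, [/\ lambda = l%:C, eigenpair l%:C f fhat & cip f f = 1].
Proof.
move=> [f /eigenfunction_eigenpair[fhat E] fn0].
have [Lf _ _ _] := eigenpair_L2 E.
have f0 : cip f f != 0 by apply/eqP => /(cip_eq0 Lf).
have lE : lambda = (complex.Re lambda)%:C.
  by apply: ReIm_inj => //=; exact: eigenpair_real E f0.
have [f' [fhat' [E' [f1 _]]]] := eigenpair_normalize E f0.
by exists (complex.Re lambda), f', fhat'; split => //; rewrite -lE.
Qed.

Lemma spec_p_finite eta : 0 < eta ->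
  finite_set [set lambda | spec_p Psi V lambda /\ eta <= `|complex.Re lambda|].
Proof.
move=> eta0; apply: contrapT.
have [N0 N0P] := eigenpair_count eta0.
move=> /infinite_set_fset /= /(_ N0.+1)[B BS NB].
pose bs := finmap.enum_fset B.
have sB (i : 'I_(size bs)) : spec_p Psi V (nth 0 bs i) /\ eta <= `|complex.Re (nth 0 bs i)|.
  by apply: BS => /=; exact: mem_nth.
have /choice[g gP] : forall i : 'I_(size bs), exists g : R * ((X -> R[i]) * (X -> R[i])),
    [/\ nth 0 bs i = g.1%:C, eigenpair g.1%:C g.2.1 g.2.2 & cip g.2.1 g.2.1 = 1].
  move=> i; have [l [f [fhat [E1 E2 E3]]]] := spec_p_real (sB i).1.
  by exists (l, (f, fhat)).
have : (size bs <= N0)%N; last by rewrite leqNgt NB.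
apply: (N0P _ (fun i => (g i).2.1) (fun i => (g i).2.2) (fun i => (g i).1)).
- by move=> i; case: (gP i).
- move=> i j; have [->|ij] := eqVneq i j; first by case: (gP j).
  have [Ei Pi _] := gP i; have [Ej Pj _] := gP j.
  apply: eigenpair_orthogonal Pi Pj; apply: contra ij => /eqP gij.
  have : nth 0 bs i = nth 0 bs j by rewrite Ei Ej gij.
  by move=> /eqP; rewrite nth_uniq// finmap.fset_uniq.
- by move=> i; have [_ ] := sB i; case: (gP i) => ->.
Qed.

(** Gram-Schmidt: if no finite family spans, an orthonormal family of any size can be extended by
    one more eigenfunction, against [eigenpair_count] with eta = |lambda|. Only the projection on
    the real span is subtracted; the remainder is nonzero because the new function lies outside even
    the complex span. *)
Lemma spec_p_finite_multiplicity lambda : spec_p Psi V lambda -> lambda != 0 ->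
  finite_multiplicity Psi V lambda.
Proof.
move=> spl l0; have [l [f0 [fhat0 [lE _ _]]]] := spec_p_real spl.
have eta0 : 0 < `|l|.
  by rewrite normr_gt0; apply: contra l0 => /eqP lz; rewrite lE lz.
have [N0 N0P] := eigenpair_count eta0.
apply: contrapT => infinite.
have P N : exists f fhat : 'I_N -> X -> R[i],
    (forall i, eigenpair lambda (f i) (fhat i)) /\
    (forall i j, cip (f i) (f j) = (i == j)%:R).
  elim: N => [|N [f [fhat [E ON]]]].
    by exists (fun=> cst 0), (fun=> cst 0); split=> -[].
  have Lf i : L2c (f i) by case: (eigenpair_L2 (E i)).
  have [g [gE gN]] : exists g, eigenfunctions Psi V lambda g /\
      forall a : 'I_N -> R[i], ~ (g = (fun x => \sum_(i < N) a i * f i x) %[ae mu]).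
    apply: contrapT => h; apply: infinite; exists N, f; split.
      by move=> i; exact: eigenpair_eigenfunction (E i).
    move=> g gE; apply: contrapT => h'; apply: h; exists g; split => // a ga.
    by apply: h'; exists a.
  have [ghat Eg] := eigenfunction_eigenpair gE.
  have [Lg _ _ _] := eigenpair_L2 Eg.
  pose a i := - cip g (f i).
  pose p x := g x + \sum_(i < N) (a i)%:C * f i x.
  pose phat xi := ghat xi + \sum_(i < N) (a i)%:C * fhat i xi.
  have Ep : eigenpair lambda p phat.
    by apply: eigenpair_sum => // i; exact: eigenpairZ.
  have [Lp _ _ _] := eigenpair_L2 Ep.
  have Ls : L2c (fun x => \sum_(i < N) (a i)%:C * f i x).
    by apply: L2c_sum => i; exact: L2cZ.
  have pf j : cip p (f j) = 0.
    by rewrite cipDl// [X in _ + X]cipC cip_orthonormal_coord// addrN.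
  have pn0 : cip p p != 0.
    apply/eqP => /(cip_eq0 Lp) pz; apply: (gN (fun i => (- a i)%:C)).
    move: pz; apply: filterS => x /= h T; have := h T.
    rewrite /p => /eqP; rewrite addr_eq0 => /eqP ->.
    rewrite -sumrN; apply: eq_bigr => i _.
    by rewrite -mulNr; congr (_ * _); apply: ReIm_inj => /=; rewrite ?oppr0.
  have [p' [phat' [E' [p1 [b pb]]]]] := eigenpair_normalize Ep pn0.
  have p'f j : cip p' (f j) = 0 by rewrite pb cipZl// pf mulr0.
  exists (fun i => oapp f p' (unlift ord0 i)), (fun i => oapp fhat phat' (unlift ord0 i)).
  split; first by move=> i; case: unliftP => [j|] _ /=.
  move=> i j; case: (unliftP ord0 i) => [i'|] ->; case: (unliftP ord0 j) => [j'|] -> /=.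
  - by rewrite ON (inj_eq lift_inj).
  - by rewrite cipC p'f.
  - by rewrite p'f.
  - by rewrite p1.
have [f [fhat [E ON]]] := P N0.+1.
have : (N0.+1 <= N0)%N; last by rewrite ltnn.
apply: (N0P _ f fhat (fun=> l)) => //.
by move=> i; rewrite -lE.
Qed.

(** Within distance eta = |lambda| / 2 of lambda every eigenvalue has modulus at least eta, so it
    lies in a finite set; the finitely many eigenvalues other than lambda are then removed from the
    disc. As lambda need not be an eigenvalue, the lemma serves both isolation and the exclusion of
    nonzero limit points. *)
Lemma spec_p_locally_finite (lambda : R[i]^o) : lambda != 0 ->
  exists2 U, nbhs lambda U & U `&` spec_p Psi V `<=` [set lambda].
Proof.
move=> l0; pose eta : R := Normc.normc (lambda : R[i]) / 2.
have eta0 : 0 < eta.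
  rewrite divr_gt0// lt_neqAle eq_sym normc_ge0 andbT.
  by apply: contra l0 => /eqP/Normc.eq0_normc ->.
pose S := [set z | spec_p Psi V z /\ eta <= `|complex.Re z|].
have fS : finite_set (S `\ lambda) by apply: finite_setD; exact: spec_p_finite.
exists (ball lambda (eta%:C : R[i]^o) `&` ~` (S `\ lambda)).
  apply: filterI; first by apply: nbhsx_ballx; rewrite ltcR.
  apply: open_nbhs_nbhs; split; last by move=> [_] /(_ erefl).
  apply: closed_openC; apply: (accessible_finite_set_closed.1 _ _ fS).
  by apply: hausdorff_accessible; exact: norm_hausdorff.
move=> z [[zl zS] spz]; apply: contrapT => znl; apply: zS; split => //; split => //.
have [r [_ [_ [zE _ _]]]] := spec_p_real spz.
have nz : Normc.normc (z : R[i]) = `|complex.Re z|.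
  by rewrite zE /= expr0n/= addr0 sqrtr_sqr.
have d1 : Normc.normc ((lambda : R[i]) - z) < eta.
  by move: zl; rewrite -ball_normE /= -ltcR.
have : Normc.normc (lambda : R[i]) <= Normc.normc ((lambda : R[i]) - z) + Normc.normc (z : R[i]).
  have := ler_normD ((lambda : R[i]) - z) z; rewrite subrK.
  by rewrite -lecR rmorphD.
have -> : Normc.normc (lambda : R[i]) = 2 * eta by rewrite /eta mulrC divfK.
rewrite nz; lra.
Qed.

End eigenfunctions.

(* H1_nonzero excludes Psi = 0 on [0, +oo[, for which H is multiplication by V
   and the claim fails (V may be a nonzero constant on a ball). *)
Theorem theorem3p10 (R : realType) (d : nat) (d_gt0 : (0 < d)%N)
    (Psi : R -> R) (V : 'rV[R]_d -> R)
    (Psi_measurable : measurable_fun (`[0, +oo[ : set R) Psi)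
    (H1_derivable : forall u : R, 0 < u -> derivable Psi u 1)
    (H1_C1 : forall u : R, 0 < u -> {for u, continuous (derive1 Psi)})
    (H1_ge0 : forall u : R, 0 <= u -> 0 <= Psi u)
    (H1_derive_ge0 : forall u : R, 0 < u -> 0 <= derive1 Psi u)
    (H1_at_0 : Psi 0 = 0)
    (H1_right_0 : Psi u @[u --> 0^'+] --> (0 : R))
    (H1_nonzero : exists2 u, 0 <= u & Psi u != 0)
    (H3 : exists c2 d2 : R, [/\ 0 <= c2, 0 <= d2 &
      forall u : R, 0 <= u -> u * derive1 Psi u <= c2 * Psi u + d2])
    (H4 : exists2 mu : R, 0 < mu &
      forall u : R, 0 <= u -> mu * Psi u <= 2 * u * derive1 Psi u)
    (H6_C1 : C1 V)
    (H6_decay : exists c gamma : R, [/\ 0 < c, 0 < gamma,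
      forall x, `|V x| <= c * japanese x `^ (- gamma) &
      forall x, enorm (grad V x) <= c * japanese x `^ (- 1 - gamma)]) :
  [/\ forall lambda, (spec_p Psi V `\ 0) lambda ->
        isolated (spec_p Psi V `\ 0) lambda,
      forall lambda, (spec_p Psi V `\ 0) lambda ->
        finite_multiplicity Psi V lambda &
      limit_point (spec_p Psi V) `<=` [set 0]].
Proof.
have [c2 [d2 [c2_ge0 d2_ge0 H3']]] := H3.
have [m m_gt0 H4'] := H4.
have [c [gamma [c_gt0 gamma_gt0 V_le gradV_le]]] := H6_decay.
have loc lambda : lambda != 0 ->
    exists2 U, nbhs lambda U & U `&` spec_p Psi V `<=` [set lambda].
  exact: (spec_p_locally_finite Psi_measurable H1_derivable H1_C1 H1_ge0
    H1_derive_ge0 H1_at_0 c2_ge0 d2_ge0 H3' m_gt0 H4' H6_C1 c_gt0 gamma_gt0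
    V_le gradV_le H1_nonzero).
split.
- move=> lambda spl; split; first exact/mem_set.
  have [U Ul US] : exists2 U, nbhs lambda U & U `&` spec_p Psi V `<=` [set lambda].
    by apply: loc; apply/eqP => l0; case: spl => _; apply.
  exists U => //; apply/seteqP; split => [z [Uz [spz _]]|z ->]; first exact: US.
  by split => //; exact: nbhs_singleton Ul.
- move=> lambda [spl /eqP l0].
  exact: (spec_p_finite_multiplicity Psi_measurable H1_derivable H1_C1 H1_ge0
    H1_derive_ge0 H1_at_0 c2_ge0 d2_ge0 H3' m_gt0 H4' H6_C1 c_gt0 gamma_gt0
    V_le gradV_le H1_nonzero spl l0).
- move=> lambda lim; apply/eqP; apply: contrapT => /negP l0.
  have [U Ul US] := loc lambda l0.
  have [z [zl spz Uz]] := lim U Ul.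
  by move: zl; rewrite (US z (conj Uz spz)) eqxx.
Qed.
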